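(* Let $\mu>0$ and $2<p<6$, and let $\mathcal G=(V,E)$ be a connected metric graph with set of vertices at infinity $V_\infty$. Assume that after removal of any edge $e\in E$, every connected component of the graph $(V,E\setminus\{e\})$ contains at least one vertex $v\in V_\infty$. Then $$\inf_{u\in H^1_\mu(\mathcal G)} E(u,\mathcal G)=\min_{\phi\in H^1_\mu(\mathbb R)} E(\phi,\mathbb R)=E(\phi_\mu,\mathbb R),$$ but the infimum on the left-hand side is never achieved unless $\mathcal G$ is isometric to one of the following metric graphs: (a) the real line $\mathbb R$; (b) for some $a_1>0$, the quotient of $\mathbb R$ obtained by gluing together the two points $a_1$ and $-a_1$ into a unique point; (c) for some $n\ge 2$ and some $a_n>\dots>a_1>0$, the quotient of $\mathbb R$ obtained by gluing together each pair of points $a_j$ and $-a_j$ into a unique point $x_j$, $j=1,\dots,n$.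
   Context: Metric graph: a connected multigraph $\mathcal G=(V,E)$ with $V$ and $E$ finite (multiple edges and self-loops allowed), where each edge $e\in E$ is associated with either a closed bounded interval $I_e=[0,\ell_e]$, $\ell_e>0$, or a closed half-line $I_e=[0,+\infty)$, with a coordinate $x_e$ along $I_e$ such that the ends of $I_e$ correspond to the two end vertices of $e$. If $I_e$ is a half-line, it is attached to the rest of the graph at $x_e=0$, and the vertex corresponding to $x_e=+\infty$ is called a vertex at infinity; $V_\infty\subseteq V$ is the set of vertices at infinity, and every vertex at infinity is assumed to have degree one. As a metric space, $\mathcal G$ is the disjoint union of the $I_e$ with endpoints glued at the vertices in $V\setminus V_\infty$ according to the graph, with the shortest-path distance measured along the edges (vertices at infinity are not points of this space, but they are vertices of the graph; in particular, removing a half-line $e$ leaves its vertex at infinity as an isolated vertex, which is a connected component of $(V,E\setminus\{e\})$). The quotients of $\mathbb R$ in (b), (c) are viewed as metric graphs with shortest-path distance: in (b) there are two half-lines and a self-loop of length $2a_1$, all attached at one vertex; in (c) there is a self-loop of length $2a_1$ at $x_1$, two parallel edges of length $a_j-a_{j-1}$ joining $x_{j-1}$ and $x_j$ for $2\le j\le n$, and two half-lines attached at $x_n$. The line $\mathbb R$ is viewed as two half-lines joined at their initial point. Functions: $u:\mathcal G\to\mathbb R$ is identified with the family $(u_e)_{e\in E}$ of its restrictions to the edges. $\|u\|_{L^r(\mathcal G)}^r=\sum_e\|u_e\|_{L^r(I_e)}^r$; $H^1(\mathcal G)$ is the set of $u$ continuous on $\mathcal G$ with $u_e\in H^1(I_e)$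 for all $e$. For $\mu>0$, $H^1_\mu(\mathcal G)=\{u\in H^1(\mathcal G):\|u\|_{L^2(\mathcal G)}^2=\mu\}$. The NLS energy is $$E(u,\mathcal G)=\tfrac12\|u'\|_{L^2(\mathcal G)}^2-\tfrac1p\|u\|_{L^p(\mathcal G)}^p=\tfrac12\sum_e\int_{I_e}|u_e'|^2\,dx_e-\tfrac1p\sum_e\int_{I_e}|u_e|^p\,dx_e .$$ The same notation is used with $\mathcal G$ replaced by $\mathbb R$. Soliton: $\phi_\mu$ denotes the unique positive and even minimizer of $E(\cdot,\mathbb R)$ over $H^1_\mu(\mathbb R)$ (the dependence on $p$ is understood). It is given by $\phi_\mu(x)=\mu^\alpha\phi_1(\mu^\beta x)$ with $\alpha=\frac{2}{6-p}$, $\beta=\frac{p-2}{6-p}$ and $\phi_1(x)=C_p\,\mathrm{sech}(c_p x)^{\alpha/\beta}$ for suitable constants $C_p,c_p>0$. *)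

(* Defs.v *)
From HB Require Import structures.
From mathcomp Require Import all_boot all_order all_algebra.
From mathcomp Require Import all_classical all_reals all_analysis.
Set Implicit Arguments.
Unset Strict Implicit.
Unset Printing Implicit Defensive.
Import Order.TTheory GRing.Theory Num.Theory numFieldNormedType.Exports.
Local Open Scope classical_set_scope.
Local Open Scope ring_scope.

(* Sobolev space H^1 of an interval I : set R, in the usual one-dimensional
   weak form, with C^1 test functions compactly supported in the interior of I.
   Functions are total; only their values on I matter. *)

Definition L2 (R : realType) (I : set R) (u : R -> R) : Prop :=
  measurable_fun I u /\
  (\int[@lebesgue_measure R]_(x in I) (`|u x| ^+ 2)%:E < +oo)%E.

Definition test_function (R : realType) (I : set R) (phi : R -> R) : Prop :=
  [/\ forall x, derivable phi x 1,
      continuous (derive1 phi),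
      compact (closure [set x | phi x != 0]) &
      closure [set x | phi x != 0] `<=` interior I].

Definition weak_derivative (R : realType) (I : set R) (u v : R -> R) : Prop :=
  forall phi, test_function I phi ->
    \int[@lebesgue_measure R]_(x in I) (u x * derive1 phi x) =
    - \int[@lebesgue_measure R]_(x in I) (v x * phi x).

Definition H1 (R : realType) (I : set R) (u : R -> R) : Prop :=
  L2 I u /\ exists v, L2 I v /\ weak_derivative I u v.

(* A chosen representative of u', which is unique up to a null set. *)
Definition wderiv (R : realType) (I : set R) (u : R -> R) : R -> R :=
  xget (fun=> 0) [set v | L2 I v /\ weak_derivative I u v].

(* The r-th power of the L^r(I) norm. *)
Definition Lpow (R : realType) (r : R) (I : set R) (u : R -> R) : R :=
  \int[@lebesgue_measure R]_(x in I) (`|u x| `^ r).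

(* A multigraph with edge lengths in ]0, +oo]; an edge of length +oo is a
   half-line.  Edge e joins src e (coordinate 0) to tgt e (coordinate len e). *)
Record graph (R : realType) := Graph {
  vertex : finType;
  edge : finType;
  src : edge -> vertex;
  tgt : edge -> vertex;
  len : edge -> \bar R }.

Section Graph.
Variables (R : realType) (G : graph R).

Definition at_infinity : pred (vertex G) :=
  fun v => [exists e : edge G, (len e == +oo%E) && (tgt e == v)].

(* A self-loop counts twice. *)
Definition degree (v : vertex G) : nat :=
  (#|[pred e : edge G | src e == v]| + #|[pred e : edge G | tgt e == v]|)%N.

Definition joined (A : pred (edge G)) : rel (vertex G) :=
  fun v w => [exists e : edge G, (e \in A) &&
    (((src e == v) && (tgt e == w)) || ((src e == w) && (tgt e == v)))].

(* The graph with no edge at all is excluded: it carries no function of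
   positive mass. *)
Definition metric_graph : Prop :=
  [/\ inhabited (edge G),
      forall e : edge G, (0 < len e)%E,
      forall v, at_infinity v -> degree v = 1%N &
      forall v w, connect (joined predT) v w].

Definition edge_itv (e : edge G) : set R :=
  match len e with
  | EFin l => `[0, l]
  | _ => `[0, +oo[
  end.

(* A pair (e, x) is the point of coordinate x on the edge e; the points of the
   metric space are these pairs up to [glued]. *)
Definition is_point (p : edge G * R) : Prop := edge_itv p.1 p.2.

Definition at_vertex (p : edge G * R) (v : vertex G) : Prop :=
  (p.2 = 0 /\ src p.1 = v) \/ (p.2%:E = len p.1 /\ tgt p.1 = v).

Definition glued (p q : edge G * R) : Prop :=
  p = q \/ exists v, at_vertex p v /\ at_vertex q v.

Inductive walk : edge G * R -> edge G * R -> R -> Prop :=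
| walk_end p q : glued p q -> walk p q 0
| walk_edge p e x y q l : glued p (e, x) -> edge_itv e x -> edge_itv e y ->
    walk (e, y) q l -> walk p q (`|x - y| + l).

Definition dist (p q : edge G * R) : R := inf [set l | walk p q l].

Definition continuous_on_graph (u : edge G -> R -> R) : Prop :=
  (forall e, {within edge_itv e, continuous (u e)}) /\
  (forall p q, is_point p -> is_point q -> glued p q -> u p.1 p.2 = u q.1 q.2).

Definition H1_graph (u : edge G -> R -> R) : Prop :=
  continuous_on_graph u /\ forall e, H1 (edge_itv e) (u e).

Definition H1_mass (mu : R) (u : edge G -> R -> R) : Prop :=
  H1_graph u /\ \sum_(e : edge G) Lpow 2 (edge_itv e) (u e) = mu.

Definition energy (p : R) (u : edge G -> R -> R) : R :=
  2^-1 * (\sum_(e : edge G) Lpow 2 (edge_itv e) (wderiv (edge_itv e) (u e)))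
  - p^-1 * (\sum_(e : edge G) Lpow p (edge_itv e) (u e)).

End Graph.

Definition isometric (R : realType) (G H : graph R) : Prop :=
  exists f : edge G * R -> edge H * R,
    [/\ forall p, is_point p -> is_point (f p),
        forall p q, is_point p -> is_point q -> dist (f p) (f q) = dist p q &
        forall q, is_point q -> exists2 p, is_point p & glued (f p) q].

(* The vertices are the origin (None) and the two ends at infinity. *)
Definition line_graph (R : realType) : graph R :=
  @Graph R (option bool) bool (fun=> None) Some (fun=> +oo%E).

(* The quotient of the line gluing a_j and -a_j into x_j for 1 <= j <= n
   (meaningful for n >= 1).  Vertices: x_(i+1) is inl i, the ends at infinity
   are inr b.  Edges: half-lines inl (inl b), the self-loop inl (inr tt), and
   inr (i, b) for the two parallel edges between x_(i+1) and x_(i+2). *)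
Definition folded_line (R : realType) (n : nat) (a : nat -> R) : graph R :=
  @Graph R ('I_n.-1.+1 + bool)%type ((bool + unit) + ('I_n.-1 * bool))%type
    (fun e => match e with
      | inl (inl _) => inl ord_max
      | inl (inr _) => inl ord0
      | inr (i, _) => inl (widen_ord (leqnSn _) i)
      end)
    (fun e => match e with
      | inl (inl b) => inr b
      | inl (inr _) => inl ord0
      | inr (i, _) => inl (lift ord0 i)
      end)
    (fun e => match e with
      | inl (inl _) => +oo%E
      | inl (inr _) => (2 * a 1%N)%:E
      | inr (i, _) => (a i.+2 - a i.+1)%:E
      end).

Section Line.
Variable R : realType.

Definition H1_mass_line (mu : R) (phi : R -> R) : Prop :=
  [/\ continuous phi, H1 setT phi & Lpow 2 setT phi = mu].

Definition energy_line (p : R) (phi : R -> R) : R :=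
  2^-1 * Lpow 2 setT (wderiv setT phi) - p^-1 * Lpow p setT phi.

Definition minimizer_line (p mu : R) (phi : R -> R) : Prop :=
  H1_mass_line mu phi /\
  forall psi, H1_mass_line mu psi -> energy_line p phi <= energy_line p psi.

(* The positive even minimizer on the line.  For mu > 0 the default value 0
   does not have mass mu, so "minimizer_line p mu (soliton p mu)" does assert
   that a positive even minimizer exists. *)
Definition soliton (p mu : R) : R -> R :=
  xget (fun=> 0) [set phi | [/\ minimizer_line p mu phi,
    forall x, 0 < phi x & forall x, phi (- x) = phi x]].

End Line.

(* Main.v *)
(* Calibration replaces rearrangement. On each half-line the soliton [phi] solves
   [phi' = -+ slope phi], and [|u'|^2 / 2 + (slope |u|)^2 / 2 >= slope |u| |u'|],
   where the right-hand side is the variation of [calib |u|], [calib] being the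
   primitive of [slope]. The hypothesis on the graph and Menger's theorem provide,
   for the edge where [|u|] is maximal, a trail through this edge which ends at two
   distinct vertices at infinity. Since [|u|] vanishes there, the variation of
   [calib |u|] along the trail is at least twice its value at the maximum. Choosing
   the frequency of the soliton so that its amplitude is [max |u|], and optimizing
   over this frequency at fixed mass, bounds [E(u)] below by the energy of the
   soliton. A soliton sent to infinity along a half-line shows that the bound is
   sharp.

   If it is attained at u, then [|u'| = slope |u|] almost everywhere, so that
   [|u| >= phi(t)] at distance at most t from the maximum point. The trail, laid on
   the line with this point at 0, thus carries at least the mass of [phi], that is
   all the mass of u. Hence the trail uses every edge, [|u| = phi] along it, and it
   can only identify points t and -t. *)
Require Import Defs.
From HB Require Import structures.
From mathcomp Require Import all_boot all_order all_algebra.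
From mathcomp Require Import all_classical all_reals all_analysis.
From mathcomp Require Import measurable_realfun zify ring lra.
Import Order.TTheory GRing.Theory Num.Theory numFieldNormedType.Exports.
Local Open Scope classical_set_scope.
Local Open Scope ring_scope.
Set Implicit Arguments.
Unset Strict Implicit.
Unset Printing Implicit Defensive.

(** * Calculus and integrals *)

(** Rearranging u on a graph would require counting the preimages of almost every value of [|u|];
    calibration only needs a chain rule for [calib |u|] and one trail through a maximum point. The
    choice of frequency succeeds because [action] is a power of [lam] whose exponent [rexp] exceeds
    1 when p < 6: [action p lam - lam / 2 * mu] then has a strict minimum, located where the soliton
    has mass [mu]. In the equality case, [|u'| = slope |u|] does not determine [|u|]: [slope]
    vanishes at the amplitude, so that plateaus at the maximum satisfy the equation too. Only the
    one-sided comparison with [phi] follows from it, by integrating a regularized [1 / slope] along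
    walks; equality of the masses then excludes plateaus. An edge missed by the trail would carry u
    = 0, which continuity and connectedness exclude since [phi] is positive. Points that are glued
    have the same [|u|], and [phi] is even and injective on the half-line, whence the
    identifications of t with -t only. *)

Notation leb := (@lebesgue_measure _).
Notation intg I f := ((@lebesgue_measure _).-integrable I (EFin \o f)).

Section Calculus.
Variable R : realType.
Implicit Types (f g u v : R -> R) (I : set R) (a b x : R).

(** Suited to piecewise quadratic functions, whose Taylor remainder is bounded by a case analysis on
    signs. *)
Lemma is_derive_quadratic_error f x d (C : R) :
  (forall h, `|f (x + h) - f x - d * h| <= C * h ^+ 2) -> is_derive x 1 f d.
Proof.
move=> H.
have L : h^-1 *: (f (h *: 1 + x) - f x) @[h --> 0^'] --> d.
  apply/cvgrPdist_le => e e0.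
  have C0 : 0 < `|C| + 1 by rewrite ltr_wpDl.
  near=> h.
  have h0 : h != 0 by near: h; exact: nbhs_dnbhs_neq.
  have hs : `|h| <= e / (`|C| + 1).
    near: h; apply: dnbhs0_le; exact: divr_gt0.
  rewrite -[_ *: 1]/(h * 1) mulr1 (addrC h x).
  have -> : d - h^-1 *: (f (x + h) - f x) = - (h^-1 * (f (x + h) - f x - d * h)).
    by rewrite -[_ *: _]/(h^-1 * _); field.
  rewrite normrN normrM normfV ler_pdivrMl ?normr_gt0//.
  apply: le_trans (H h) _.
  have -> : h ^+ 2 = `|h| * `|h| by rewrite -expr2 real_normK// num_real.
  have : `|C| * `|h| <= e.
    apply: (@le_trans _ _ ((`|C| + 1) * `|h|)).
      by rewrite ler_wpM2r// lerDl.
    by rewrite mulrC -ler_pdivlMr.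
  have := normr_ge0 h; have := ler_norm C; nra.
by apply: DeriveDef; [apply/cvg_ex; exists d|exact/cvg_lim].
Unshelve. all: by end_near. Qed.

Lemma is_derive_continuous f (df : R -> R) :
  (forall x, is_derive x 1 f (df x)) -> continuous f.
Proof.
move=> H x; apply: differentiable_continuous; apply/derivable1_diffP.
by have := H x => Hx; exact: ex_derive.
Qed.

Lemma continuous_intg f a b : {within `[a, b], continuous f} -> intg `[a, b] f.
Proof. by move=> cf; apply: continuous_compact_integrable => //; exact: segment_compact. Qed.

Lemma Rintegral_FTC2 (f F : R -> R) a b : a <= b -> continuous f ->
  (forall x, is_derive x 1 F (f x)) -> \int[leb]_(x in `[a, b]) f x = F b - F a.
Proof.
rewrite le_eqVlt => /orP[/eqP <- cf dF|ab cf dF].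
  by rewrite set_itv1 Rintegral_set1 subrr.
rewrite /Rintegral (@continuous_FTC2 R f F a b)//.
- exact: continuous_subspaceT.
- have cF := is_derive_continuous dF.
  split; [by move=> x _; have := dF x => ?; exact: ex_derive| |].
    exact: cvg_at_right_filter (cF a).
  exact: cvg_at_left_filter (cF b).
- by move=> x _; rewrite derive1E; have := dF x => ?; rewrite derive_val.
Qed.

(** The derivative of [F] is two-sided even at [a]; the primitives used below are therefore based to
    the left of [a]. *)
Lemma integral_FTC2y (f F : R -> R) a l : (forall x, a <= x -> 0 <= f x) -> continuous f ->
  (forall x, a <= x -> is_derive x (1 : R) F (f x)) -> F x @[x --> +oo] --> l ->
  (\int[leb]_(x in `[a, +oo[) (f x)%:E = (l - F a)%:E)%E.
Proof.
move=> f0 cf dF Fl.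
have cFa : F y @[y --> a] --> F a.
  apply: differentiable_continuous; apply/derivable1_diffP.
  by have := dF a (lexx a) => Ha; exact: ex_derive.
rewrite (@ge0_continuous_FTC2y R f F a l)//.
- exact: continuous_subspaceT.
- by move=> x ax; have := dF x (ltW ax) => ?; exact: ex_derive.
- exact: cvg_at_right_filter cFa.
- move=> x; rewrite in_itv/= andbT => ax; rewrite derive1E.
  by have := dF x (ltW ax) => ?; rewrite derive_val.
Qed.

Lemma Rintegral_split f a b c : intg `[a, c] f -> a <= b -> b <= c ->
  \int[leb]_(x in `[a, c]) f x =
  \int[leb]_(x in `[a, b]) f x + \int[leb]_(x in `[b, c]) f x.
Proof.
move=> fi ab bc; have := Rintegral_itvB fi (x := b); rewrite !bnd_simp => /(_ ab bc).
rewrite Rintegral_itv_obnd_cbnd => [<-|]; first by rewrite addrC subrK.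
apply: integrableS fi => // x/=; rewrite !in_itv/= => /andP[bx ->].
by rewrite (le_trans ab (ltW bx)).
Qed.

Lemma Rintegral_support f A B : A `<=` B ->
  (forall x, B x -> ~ A x -> f x = 0) ->
  \int[leb]_(x in B) f x = \int[leb]_(x in A) f x.
Proof.
move=> AB f0; rewrite Rintegral_mkcond [RHS]Rintegral_mkcond.
apply: eq_Rintegral => x _; rewrite !patchE.
case: (boolP (x \in A)) => [/set_mem xA|/negP xA].
  by rewrite mem_set//; exact: AB.
case: ifPn => // /set_mem xB; apply: f0 => // xA'; apply: xA; exact: mem_set.
Qed.

Lemma intg_norm I f : intg I f -> intg I (fun x => `|f x|).
Proof. by move=> /integrable_norm. Qed.

Lemma intgZ I f (c : R) : measurable I -> intg I f -> intg I (fun x => c * f x).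
Proof. by move=> mI fi; exact: (@integrableZl _ _ _ (@lebesgue_measure R) I mI c _ fi). Qed.

Lemma intgD I f g : measurable I -> intg I f -> intg I g -> intg I (fun x => f x + g x).
Proof. by move=> mI fi gi; exact: (@integrableD _ _ _ (@lebesgue_measure R) I mI _ _ fi gi). Qed.

Lemma intgB I f g : measurable I -> intg I f -> intg I g -> intg I (fun x => f x - g x).
Proof. by move=> mI fi gi; exact: (@integrableB _ _ _ (@lebesgue_measure R) I mI _ _ fi gi). Qed.

Lemma intgS I J f : measurable I -> measurable J -> J `<=` I -> intg I f -> intg J f.
Proof. by move=> mI mJ JI; exact: integrableS. Qed.

Lemma le_intg I f g : measurable I -> measurable_fun I f ->
  (forall x, I x -> `|f x| <= g x) -> intg I g -> intg I f.
Proof.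
move=> mI mf fg; apply: le_integrable => //; first exact/measurable_EFinP.
by move=> x Ix /=; rewrite lee_fin (le_trans (fg x Ix))// ler_norm.
Qed.

Lemma eq_intg I f g : measurable I -> (forall x, I x -> f x = g x) -> intg I f -> intg I g.
Proof.
move=> mI fg; apply: (@eq_integrable _ _ _ (@lebesgue_measure R) I mI) => x /set_mem Ix /=.
by rewrite fg.
Qed.

Lemma intg_restrict I f : measurable I -> intg I f -> intg setT (f \_ I).
Proof.
move=> mI; rewrite (@integrable_mkcond _ _ _ (@lebesgue_measure R))// => H.
apply: (@eq_integrable _ _ _ (@lebesgue_measure R) setT measurableT _ _ _ H) => x _.
by rewrite /= !patchE; case: ifP.
Qed.

Lemma L2_sq I u : measurable I -> L2 I u -> intg I (fun x => u x ^+ 2).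
Proof.
move=> mI [mu u2]; apply/integrableP; split.
  by apply/measurable_EFinP; exact: measurable_funX.
apply: le_lt_trans u2; apply: ge0_le_integral => //=.
- by apply/measurable_EFinP; apply: measurableT_comp => //; exact: measurable_funX.
- by apply/measurable_EFinP; apply: measurable_funX; exact: measurableT_comp.
- by move=> x _; rewrite lee_fin normrX.
Qed.

Lemma L2_mul I u v : measurable I -> L2 I u -> L2 I v -> intg I (fun x => u x * v x).
Proof.
move=> mI Lu Lv; have iu := L2_sq mI Lu; have iv := L2_sq mI Lv.
case: Lu Lv => [mu _] [mv _].
apply: (le_intg mI _ _ (intgD mI iu iv)); first exact: measurable_funM.
move=> x _ /=; rewrite normrM.
rewrite -(real_normK (num_real (u x))) -(real_normK (num_real (v x))).
have := normr_ge0 (u x); have := normr_ge0 (v x); nra.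
Qed.

Lemma L2_subset I J u : measurable I -> measurable J -> J `<=` I -> L2 I u -> L2 J u.
Proof.
move=> mI mJ JI [mu u2]; split; first exact: measurable_funS mu.
apply: le_lt_trans u2; apply: ge0_subset_integral => //.
by apply/measurable_EFinP; apply: measurable_funX; exact: measurableT_comp.
Qed.

Lemma L2_intg a b u : L2 `[a, b] u -> intg `[a, b] u.
Proof.
move=> Lu; have iu := L2_sq (measurable_itv _) Lu; case: Lu => mu _.
have i1 : intg `[a, b] (fun=> 1 : R) by apply: continuous_intg => x; exact: cst_continuous.
apply: (le_intg (measurable_itv _) mu _ (intgD (measurable_itv _) i1 iu)).
move=> x _ /=.
rewrite -(real_normK (num_real (u x))); have := normr_ge0 (u x); nra.
Qed.

End Calculus.

(** * Weak derivatives *)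

Section WeakDerivative.
Variable R : realType.
Implicit Types (u v : R -> R) (I : set R) (a b x : R).

(** Half the second difference of the squared positive part is a C^1 step from 0 to 1 on [0, 2]; its
    derivative [hat] is a triangular density. *)
Definition sqramp (t : R) := Num.max t 0 ^+ 2.
Definition smoothstep (t : R) := (sqramp t - 2 * sqramp (t - 1) + sqramp (t - 2)) / 2.
Definition hat (t : R) := Num.max t 0 - 2 * Num.max (t - 1) 0 + Num.max (t - 2) 0.

Lemma is_derive_sqramp (t : R) : is_derive t 1 sqramp (2 * Num.max t 0).
Proof.
apply: (@is_derive_quadratic_error _ _ _ _ 1) => h; rewrite mul1r /sqramp ler_norml.
by apply/andP; split; case: (leP t 0) => ?; case: (leP (t + h) 0) => ?; nra.
Qed.

Lemma is_derive_smoothstep (t : R) : is_derive t 1 smoothstep (hat t).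
Proof.
have d0 := is_derive_sqramp t.
have dsh c : is_derive t 1 (fun s => sqramp (s - c)) (2 * Num.max (t - c) 0).
  apply: (@is_derive_quadratic_error _ _ _ _ 1) => h; rewrite mul1r /sqramp ler_norml.
  by apply/andP; split; case: (leP (t - c) 0) => ?; case: (leP (t + h - c) 0) => ?; nra.
have d1 := dsh 1; have d2 := dsh 2.
rewrite /smoothstep; apply: is_derive_eq.
by rewrite /hat /GRing.scale/=; lra.
Qed.

Lemma hat_ge0 t : 0 <= hat t.
Proof.
rewrite /hat; case: (leP t 0) => ?; case: (leP (t - 1) 0) => ?; case: (leP (t - 2) 0) => ?; lra.
Qed.

Lemma hat_out t : (t <= 0) || (2 <= t) -> hat t = 0.
Proof.
rewrite /hat => /orP[] ?; case: (leP t 0) => ?; case: (leP (t - 1) 0) => ?; case: (leP (t - 2) 0) => ?; lra.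
Qed.

Lemma smoothstep0 t : t <= 0 -> smoothstep t = 0.
Proof.
rewrite /smoothstep /sqramp => ?; case: (leP t 0) => ?; case: (leP (t - 1) 0) => ?; case: (leP (t - 2) 0) => ?; lra.
Qed.

Lemma smoothstep1 t : 2 <= t -> smoothstep t = 1.
Proof.
rewrite /smoothstep /sqramp => ?; case: (leP t 0) => ?; case: (leP (t - 1) 0) => ?; case: (leP (t - 2) 0) => ?; nra.
Qed.

Lemma smoothstep_itv t : 0 <= smoothstep t <= 1.
Proof.
rewrite /smoothstep /sqramp; apply/andP; split; case: (leP t 0) => ?; case: (leP (t - 1) 0) => ?; case: (leP (t - 2) 0) => ?; nra.
Qed.

Lemma continuous_hat : continuous hat.
Proof.
have cm c : continuous (fun t : R => Num.max (t - c) 0).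
  move=> t; apply: (@continuous_max _ _ (fun t => t - c) (fun=> 0)); last exact: cvg_cst.
  by apply: cvgB; [exact: cvg_id|exact: cvg_cst].
have -> : hat = fun t => Num.max (t - 0) 0 - 2 * Num.max (t - 1) 0 + Num.max (t - 2) 0.
  by apply/funext => t; rewrite /hat subr0.
move=> t; apply: cvgD; last exact: cm.
apply: cvgB; first exact: cm.
by apply: cvgM; [exact: cvg_cst|exact: cm].
Qed.

Lemma is_derive_smoothstep_affine (c d x : R) :
  is_derive x 1 (fun y => smoothstep ((y - c) / d)) (hat ((x - c) / d) / d).
Proof.
pose g y := (y - c) / d.
have dg : is_derive x 1 g d^-1.
  rewrite /g; apply: is_derive_eq; rewrite /GRing.scale/=; lra.
have dS := is_derive_smoothstep (g x).
have H := is_derive1_comp dS dg.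
by apply: (is_derive_eq H); rewrite mulrC.
Qed.

(** A C^1 cut-off that rises on [a + e, a + 3e] and falls on [b - 3e, b - e]. The margins e keep its
    support compact inside ]a, b[, and 6e < b - a separates the two ramps. *)
Definition trapezoid a b e x :=
  smoothstep ((x - (a + e)) / e) - smoothstep ((x - (b - 3 * e)) / e).

Definition dtrapezoid a b e x :=
  hat ((x - (a + e)) / e) / e - hat ((x - (b - 3 * e)) / e) / e.

Lemma is_derive_trapezoid a b e x : is_derive x 1 (trapezoid a b e) (dtrapezoid a b e x).
Proof.
have d1 := is_derive_smoothstep_affine (a + e) e x.
have d2 := is_derive_smoothstep_affine (b - 3 * e) e x.
by rewrite /trapezoid /dtrapezoid; apply: is_derive_eq.
Qed.

Lemma continuous_hat_affine (c d : R) : continuous (fun x => hat ((x - c) / d) / d).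
Proof.
move=> x; apply: cvgM; last exact: cvg_cst.
apply: (@continuous_comp _ _ _ (fun x => (x - c) / d) hat); last exact: continuous_hat.
apply: cvgM; last exact: cvg_cst.
by apply: cvgB; [exact: cvg_id|exact: cvg_cst].
Qed.

Lemma continuous_dtrapezoid a b e : continuous (dtrapezoid a b e).
Proof. by move=> x; apply: cvgB; exact: continuous_hat_affine. Qed.

Lemma trapezoid_out a b e x : 0 < e -> 6 * e < b - a -> (x <= a + e) || (b - e <= x) ->
  trapezoid a b e x = 0.
Proof.
move=> e0 eab; rewrite /trapezoid => /orP[xa|xb].
  by rewrite !smoothstep0 ?subrr// ler_pdivrMr// mul0r; lra.
by rewrite !smoothstep1 ?subrr// ler_pdivlMr//; lra.
Qed.

Lemma trapezoid_in a b e x : 0 < e -> 6 * e < b - a -> a + 3 * e <= x -> x <= b - 3 * e ->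
  trapezoid a b e x = 1.
Proof.
move=> e0 eab xa xb; rewrite /trapezoid smoothstep1 ?ler_pdivlMr//; last lra.
by rewrite smoothstep0 ?subr0// ler_pdivrMr// mul0r; lra.
Qed.

Lemma trapezoid_itv a b e x : 0 < e -> 6 * e < b - a -> `|trapezoid a b e x| <= 1.
Proof.
move=> e0 eab; rewrite /trapezoid ler_norml.
have /andP[] := smoothstep_itv ((x - (a + e)) / e).
have /andP[] := smoothstep_itv ((x - (b - 3 * e)) / e).
by move=> ? ? ? ?; apply/andP; split; lra.
Qed.

Lemma dtrapezoid_out a b e x : 0 < e -> 6 * e < b - a -> (x <= a + e) || (b - e <= x) ->
  dtrapezoid a b e x = 0.
Proof.
move=> e0 eab; rewrite /dtrapezoid => H.
rewrite !hat_out ?mul0r ?subr0//.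
  by rewrite ler_pdivrMr// ler_pdivlMr// mul0r; lra.
by rewrite ler_pdivrMr// ler_pdivlMr// mul0r; lra.
Qed.

Lemma test_function_trapezoid I a b e : 0 < e -> 6 * e < b - a -> `]a, b[ `<=` I ->
  test_function I (trapezoid a b e).
Proof.
move=> e0 eab abI.
have cl : closure [set x | trapezoid a b e x != 0] `<=` `[a + e, b - e].
  rewrite [X in _ `<=` X](closure_id _).1; last exact: interval_closed.
  apply: closureS => x /= /eqP bx; rewrite in_itv/=; apply/andP; split.
    by rewrite leNgt; apply/negP => /ltW xa; apply: bx; apply: trapezoid_out => //; rewrite xa.
  by rewrite leNgt; apply/negP => /ltW xa; apply: bx; apply: trapezoid_out => //; rewrite xa orbT.
split.
- by move=> x; have := is_derive_trapezoid a b e x => ?; exact: ex_derive.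
- have -> : derive1 (trapezoid a b e) = dtrapezoid a b e.
    by apply/funext => x; rewrite derive1E; have := is_derive_trapezoid a b e x => ?; rewrite derive_val.
  exact: continuous_dtrapezoid.
- apply: (@subclosed_compact _ _ `[a + e, b - e]) => //; first exact: closed_closure.
  exact: segment_compact.
- apply: subset_trans cl _ => x /=; rewrite in_itv/= => /andP[x1 x2].
  apply: (interiorS abI); rewrite (interior_id _).1; last exact: interval_open.
  by rewrite /= in_itv/=; apply/andP; split; lra.
Qed.

Lemma Rintegral_hat (c d a b : R) : 0 < d -> a <= c -> c + 2 * d <= b ->
  \int[leb]_(x in `[a, b]) (hat ((x - c) / d) / d) = 1.
Proof.
move=> d0 ac cb; have ab : a <= b by lra.
rewrite (Rintegral_FTC2 ab (@continuous_hat_affine c d) (is_derive_smoothstep_affine c d)).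
by rewrite smoothstep1 ?smoothstep0 ?subr0// ?ler_pdivrMr ?ler_pdivlMr// ?mul0r; lra.
Qed.

(** The rescaled [hat] has integral 1, so the integral is an average of [u] over [c, c + 2d]. *)
Lemma Rintegral_hat_eval u (c d a b y eta : R) : 0 < d -> a <= c -> c + 2 * d <= b ->
  {within `[a, b], continuous u} ->
  (forall x, c <= x <= c + 2 * d -> `|u x - y| <= eta) ->
  `|\int[leb]_(x in `[a, b]) (u x * (hat ((x - c) / d) / d)) - y| <= eta.
Proof.
move=> d0 ac cb cu Hu.
have mI : measurable `[a, b] by exact: measurable_itv.
have ch : {within `[a, b], continuous (fun x => hat ((x - c) / d) / d)}.
  exact/continuous_subspaceT/continuous_hat_affine.
have ih := continuous_intg ch.
have iuh : intg `[a, b] (fun x => u x * (hat ((x - c) / d) / d)).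
  by apply: continuous_intg => x; apply: cvgM; [exact: cu|exact: ch].
have hge x : 0 <= hat ((x - c) / d) / d by rewrite divr_ge0 ?hat_ge0 ?ltW.
rewrite -[X in _ - X](mulr1 y) -(Rintegral_hat d0 ac cb) -RintegralZl//.
rewrite -RintegralB//; last exact: intgZ.
apply: le_trans (le_normr_Rintegral _ _) _ => //; first by apply: intgB => //; exact: intgZ.
rewrite -[leRHS](mulr1 eta) -(Rintegral_hat d0 ac cb) -RintegralZl//.
apply: le_Rintegral => //; first by apply: intg_norm; apply: intgB => //; exact: intgZ.
  exact: intgZ.
move=> x xab; rewrite -mulrBl normrM (ger0_norm (hge x)).
have [xc|xc] := boolP (c <= x <= c + 2 * d); first by rewrite ler_wpM2r// Hu.
rewrite hat_out ?mul0r ?mulr0//; move: xc; rewrite negb_and -!ltNge => /orP[xc|xc].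
  by rewrite ler_pdivrMr// mul0r; apply/orP; left; lra.
by apply/orP; right; rewrite ler_pdivlMr//; lra.
Qed.

Lemma within_continuous_distP I u : {within I, continuous u} <->
  forall x, I x -> forall eta, 0 < eta ->
    exists2 d, 0 < d & forall y, I y -> `|y - x| < d -> `|u y - u x| <= eta.
Proof.
rewrite subspace_continuousP; split=> [H x Ix eta eta0|H x Ix].
  have /cvgrPdist_le /(_ eta eta0) := H x Ix.
  rewrite near_withinE => /nbhs_ballP[d d0 Hd]; exists d => // y Iy yx.
  by rewrite distrC; apply: Hd => //; rewrite /ball/= distrC.
apply/cvgrPdist_le => eta eta0; have [d d0 Hd] := H x Ix eta eta0.
rewrite near_withinE; apply/nbhs_ballP; exists d => // y /= yx Iy.
by rewrite distrC; apply: Hd => //; rewrite distrC.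
Qed.

End WeakDerivative.

Section WeakDerivative.
Variable R : realType.
Implicit Types (u v : R -> R) (I : set R) (a b x : R).

(** Test with trapezoids converging to the indicator of ]a, b[. One side is an average of [u] near a
    minus an average near b; the other converges to minus the integral of [v] by dominated
    convergence. *)
Lemma weak_derivative_FTC I u v a b : L2 I v -> weak_derivative I u v ->
  measurable I -> a < b -> `[a, b] `<=` I -> {within I, continuous u} ->
  \int[leb]_(x in `[a, b]) v x = u b - u a.
Proof.
move=> Lv wd mI ab abI cu.
have mab : measurable `[a, b] by exact: measurable_itv.
have moo : measurable `]a, b[ by exact: measurable_itv.
have ooI : `]a, b[ `<=` I by apply: subset_trans abI; exact: subset_itv_oo_cc.
have Lvab := L2_subset mI mab abI Lv.
have iv := L2_intg Lvab.
have ivo : intg `]a, b[ v by apply: intgS iv => //; exact: subset_itv_oo_cc.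
have cuab : {within `[a, b], continuous u} by exact: continuous_subspaceW cu.
(* The index shift by 2 makes 6e < b - a strict already for n = 0. *)
pose e n : R := (b - a) / (6 * n.+2%:R).
have e0 n : 0 < e n by rewrite /e divr_gt0 ?mulr_gt0 ?subr_gt0.
have e6 n : 6 * e n < b - a.
  have n1 : (1 : R) < n.+2%:R by rewrite ltr1n.
  have -> : 6 * e n = (b - a) / n.+2%:R by rewrite /e; field; rewrite lt0r_neq0// (lt_trans _ n1).
  by rewrite ltr_pdivrMr ?(lt_trans _ n1)// ltr_pMr// subr_gt0.
have ecvg : e n @[n --> \oo] --> 0.
  have -> : e = (fun n => (b - a) / 6 * harmonic n.+1).
    by apply/funext => n; rewrite /e /harmonic/= invfM mulrA.
  rewrite -(mulr0 ((b - a) / 6)); apply: cvgM; first exact: cvg_cst.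
  by have := @cvg_harmonic R; rewrite -cvg_shiftS.
have lhs : \int[leb]_(x in I) (u x * derive1 (trapezoid a b (e n)) x) @[n --> \oo] --> u a - u b.
  apply/cvgrPdist_le => eta eta0; have eta20 : 0 < eta / 2 by rewrite divr_gt0.
  have /within_continuous_distP cd := cuab.
  have [|da da0 Ha] := cd a _ _ eta20; first by rewrite /= in_itv/= lexx ltW.
  have [|db db0 Hb] := cd b _ _ eta20; first by rewrite /= in_itv/= lexx ltW.
  near=> n.
  have ea : 3 * e n < da.
    rewrite mulrC -ltr_pdivlMr//; near: n; apply: (cvgr_lt _ ecvg).
    by rewrite divr_gt0.
  have eb : 3 * e n < db.
    rewrite mulrC -ltr_pdivlMr//; near: n; apply: (cvgr_lt _ ecvg).
    by rewrite divr_gt0.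
  have en0 := e0 n; have en6 := e6 n.
  rewrite (_ : derive1 _ = dtrapezoid a b (e n)); last first.
    apply/funext => x; rewrite derive1E.
    by have := is_derive_trapezoid a b (e n) x => ?; rewrite derive_val.
  rewrite (@Rintegral_support _ _ `[a, b])//; last first.
    move=> x _ /= /negP; rewrite in_itv/= negb_and -!ltNge => xab.
    by rewrite dtrapezoid_out ?mulr0//; move: xab => /orP[?|?]; apply/orP; [left|right]; lra.
  have ch c : {within `[a, b], continuous (fun x => hat ((x - c) / e n) / e n)}.
    exact/continuous_subspaceT/continuous_hat_affine.
  have iuh c : intg `[a, b] (fun x => u x * (hat ((x - c) / e n) / e n)).
    by apply: continuous_intg => x; apply: cvgM; [exact: cuab|exact: ch].
  under eq_Rintegral do rewrite /dtrapezoid mulrBr.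
  rewrite RintegralB//.
  have h1 : `|\int[leb]_(x in `[a, b]) (u x * (hat ((x - (a + e n)) / e n) / e n)) - u a|
      <= eta / 2.
    apply: Rintegral_hat_eval => //; [lra|lra|move=> x /andP[x1 x2]; apply: Ha].
      by rewrite /= in_itv/=; apply/andP; split; lra.
    by rewrite ger0_norm; lra.
  have h2 : `|\int[leb]_(x in `[a, b]) (u x * (hat ((x - (b - 3 * e n)) / e n) / e n)) - u b|
      <= eta / 2.
    apply: Rintegral_hat_eval => //; [lra|lra|move=> x /andP[x1 x2]; apply: Hb].
      by rewrite /= in_itv/=; apply/andP; split; lra.
    by rewrite ltr_norml; apply/andP; split; lra.
  by move: h1 h2; rewrite !ler_norml => /andP[? ?] /andP[? ?]; apply/andP; split; lra.
have rhs : \int[leb]_(x in I) (v x * trapezoid a b (e n) x) @[n --> \oo] --> \int[leb]_(x in `[a, b]) v x.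
  (* On the open interval the trapezoids tend to 1 at every point, whereas they stay 0 at a and
     b. *)
  have -> : (fun n => \int[leb]_(x in I) (v x * trapezoid a b (e n) x)) =
            fine \o (fun n => (\int[leb]_(x in `]a, b[) (v x * trapezoid a b (e n) x)%:E)%E).
    apply/funext => n; rewrite -[RHS]/(\int[leb]_(x in `]a, b[) (v x * trapezoid a b (e n) x)).
    apply: Rintegral_support => // x _ /= /negP.
    have en0 := e0 n; have en6 := e6 n.
    rewrite in_itv/= negb_and -!leNgt => xab.
    by rewrite trapezoid_out ?mulr0//; move: xab => /orP[?|?]; apply/orP; [left|right]; lra.
  have cb n : continuous (trapezoid a b (e n)) by exact: is_derive_continuous (is_derive_trapezoid a b (e n)).
  have mv : measurable_fun `]a, b[ v by apply/measurable_EFinP; exact: measurable_int ivo.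
  have [||||| _ _] := @dominated_convergence _ _ _ leb `]a, b[ moo
    (fun n x => (v x * trapezoid a b (e n) x)%:E) (EFin \o v) (fun x => `|v x|%:E).
  - move=> n; apply/measurable_EFinP; apply: measurable_funM => //.
    by apply: measurable_funTS; exact: continuous_measurable_fun.
  - exact/measurable_EFinP.
  - apply/aeW => x /= xab; apply/cvg_EFin; first exact: nearW.
    rewrite /comp/= -[X in _ --> X](mulr1 (v x)); apply: cvgM; first exact: cvg_cst.
    apply: cvg_near_cst; move: xab; rewrite in_itv/= => /andP[ax xb].
    near=> n; apply: trapezoid_in => //.
      suff : 3 * e n < x - a by lra.
      rewrite mulrC -ltr_pdivlMr//; near: n; apply: (cvgr_lt _ ecvg).
      by rewrite divr_gt0// subr_gt0.
    suff : 3 * e n < b - x by lra.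
    rewrite mulrC -ltr_pdivlMr//; near: n; apply: (cvgr_lt _ ecvg).
    by rewrite divr_gt0// subr_gt0.
  - exact: intg_norm.
  - apply/aeW => x n xab /=; rewrite lee_fin normrM ler_piMr//.
    exact: trapezoid_itv.
  move=> H; rewrite {1}/Rintegral integral_itv_bndoo; last exact/measurable_EFinP.
  apply: fine_cvg; rewrite fineK//; exact: integrable_fin_num.
have : \int[leb]_(x in I) (u x * derive1 (trapezoid a b (e n)) x) @[n --> \oo] -->
   - \int[leb]_(x in `[a, b]) v x.
  under eq_fun do rewrite (wd _ (test_function_trapezoid (e0 _) (e6 _) ooI)).
  exact: cvgN.
move=> /(cvg_unique (@Rhausdorff R) lhs) H.
by rewrite -[LHS]opprK -H opprB.
Unshelve. all: by end_near. Qed.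
End WeakDerivative.

(** * Chain rule for functions whose variation is bounded by an integral *)

Section Chain.
Variable R : realType.
Implicit Types (f g u v U V : R -> R) (I : set R) (a b x y : R).

(** Consider the supremum of the points where [D] is at least [D a]. Monotonicity to its left shows
    that it is such a point, and monotonicity to its right would push it further unless it is b. *)
Lemma locally_monotone_le (D : R -> R) a b : a <= b ->
  (forall x, a <= x <= b -> exists2 d, 0 < d & forall y, a <= y <= b -> `|y - x| < d ->
     (x <= y -> D x <= D y) /\ (y <= x -> D y <= D x)) ->
  D a <= D b.
Proof.
move=> ab H; pose S := [set x | a <= x <= b /\ D a <= D x].
have Sa : S a by split; rewrite ?lexx ?ab.
have hS : has_sup S.
  by split; [exists a|exists b => x [/andP[_ ]]].
have sa : a <= sup S by apply: ub_le_sup => //; case: hS.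
have sb : sup S <= b by apply: ge_sup; [exists a|move=> x [/andP[]]].
have [|d d0 Hd] := H (sup S); first by rewrite sa sb.
have Ds : D a <= D (sup S).
  have [x [/andP[ax xb] Dx] xs] := sup_adherent d0 hS.
  have xS : x <= sup S by apply: ub_le_sup; [case: hS|split; rewrite ?ax].
  apply: le_trans Dx _; apply: (Hd x _ _).2 => //; first by rewrite ax.
  by rewrite ltr_norml; apply/andP; split; lra.
move: sb; rewrite le_eqVlt => /orP[/eqP <- //|sb].
have [y /andP[sy yb] yd] : exists2 y, sup S < y <= b & y - sup S < d.
  have [bd|bd] := ltP (b - sup S) d; first by exists b; rewrite ?sb ?lexx.
  by exists (sup S + d / 2); [apply/andP; split|]; lra.
suff : y <= sup S by rewrite leNgt sy.
apply: ub_le_sup; first by case: hS.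
split; first by rewrite yb (le_trans sa)// ltW.
apply: le_trans Ds _; apply: (Hd y _ _).1; last exact: ltW.
  by rewrite yb (le_trans sa)// ltW.
by rewrite gtr0_norm; lra.
Qed.

Lemma is_derive_within f (df : R -> R) a b : (forall r : R, a <= r <= b -> is_derive r (1 : R) f (df r)) ->
  {within `[a, b], continuous f}.
Proof.
move=> dF; apply: derivable_within_continuous => r.
by rewrite in_itv/= => rab; have := dF r rab => ?; exact: ex_derive.
Qed.

Lemma derivable_lipschitz f (df : R -> R) (K s t : R) : s <= t ->
  (forall r : R, s <= r <= t -> is_derive r (1 : R) f (df r)) ->
  (forall r, s <= r <= t -> `|df r| <= K) -> `|f t - f s| <= K * (t - s).
Proof.
move=> st dF HK.
have [r|c cst ->] := @MVT_segment R f df s t st _ (is_derive_within dF).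
  by rewrite in_itv/= => /andP[sr rt]; apply: dF; rewrite !ltW.
by rewrite normrM (ger0_norm (x := t - s)) ?subr_ge0// ler_wpM2r ?subr_ge0// HK.
Qed.

Lemma continuous_within_bounded f a b : a <= b -> {within `[a, b], continuous f} ->
  exists K, forall x, a <= x <= b -> `|f x| <= K.
Proof.
move=> ab cf; have [c _ Hc] := EVT_max ab (f := fun x => `|f x|) (fun x => cvg_norm (cf x)).
by exists `|f c| => x xab; apply: Hc; rewrite in_itv.
Qed.

Lemma intg_continuousM f V a b : {within `[a, b], continuous f} -> intg `[a, b] V ->
  intg `[a, b] (fun x => f x * V x).
Proof.
move=> cf iV; have [ab|ba] := leP a b; last first.
  by rewrite set_itv_ge ?bnd_simp -?ltNge//; exact: integrable_set0.
have [K HK] := continuous_within_bounded ab cf.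
have mab : measurable `[a, b] by exact: measurable_itv.
apply: (@le_intg _ _ _ (fun x => K * `|V x|)) => //.
- apply: measurable_funM; first exact: subspace_continuous_measurable_fun.
  by apply/measurable_EFinP; exact: measurable_int iV.
- by move=> x xab; rewrite normrM ler_wpM2r// HK.
- by apply: intgZ => //; exact: intg_norm.
Qed.

Section ChainRule.
Variables (a b : R) (U V f df : R -> R).
Hypotheses (ab : a <= b) (iV : intg `[a, b] V) (V0 : forall x, a <= x <= b -> 0 <= V x)
  (cU : {within `[a, b], continuous U})
  (HU : forall x y, a <= x -> x <= y -> y <= b -> `|U y - U x| <= \int[leb]_(t in `[x, y]) V t)
  (U0 : forall x, a <= x <= b -> 0 <= U x)
  (dF : forall s : R, 0 <= s -> is_derive s (1 : R) f (df s)) (cdf : continuous df).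

Let sub_itv x y : a <= x -> y <= b -> `[x, y] `<=` `[a, b].
Proof.
move=> ax yb z /=; rewrite !in_itv/= => /andP[xz zy].
by rewrite (le_trans ax xz) (le_trans zy yb).
Qed.

Let intgV x y : a <= x -> y <= b -> intg `[x, y] V.
Proof. by move=> ax yb; apply: intgS iV => //; exact: sub_itv. Qed.

(** By the mean value theorem the increment of [f] is at most the variation of [U] times a bound of
    [|df|] near [U x]; continuity replaces this bound by [|df (U t)| + e] under the integral. *)
Lemma chain_local (e x : R) : 0 < e -> a <= x <= b ->
  exists2 d, 0 < d & forall y z, a <= y -> y <= z -> z <= b -> x - d < y -> z < x + d ->
    `|f (U z) - f (U y)| <= \int[leb]_(t in `[y, z]) ((`|df (U t)| + e) * V t).
Proof.
move=> e0 xab; have e20 : 0 < e / 2 by rewrite divr_gt0.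
have /cvgrPdist_le /(_ _ e20) /nbhs_ballP[r r0 Hr] := cdf (x := U x).
have Hr' s : `|s - U x| < r -> `|df s - df (U x)| <= e / 2.
  by move=> sx; rewrite distrC; apply: Hr; rewrite /ball/= distrC.
have /within_continuous_distP /(_ x xab _ (divr_gt0 r0 (ltr0Sn R 1))) [d d0 Hd] := cU.
exists d => // y z ay yz zb xy zx.
have near t : y <= t <= z -> `|U t - U x| < r.
  move=> /andP[yt tz]; apply: (@le_lt_trans _ _ (r / 2)); last by rewrite ltr_pdivrMr// ltr_pMr// ltr1n.
  apply: Hd; first by rewrite /= in_itv/= (le_trans ay yt) (le_trans tz zb).
  by rewrite ltr_norml; apply/andP; split; lra.
have Uy : 0 <= U y by apply: U0; rewrite ay (le_trans yz zb).
have Uz : 0 <= U z by apply: U0; rewrite zb (le_trans ay yz).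
have yyz : y <= y <= z by rewrite lexx yz.
have zyz : y <= z <= z by rewrite lexx yz.
have L : `|f (U z) - f (U y)| <= (`|df (U x)| + e / 2) * `|U z - U y|.
  have K s : `|s - U x| < r -> `|df s| <= `|df (U x)| + e / 2.
    move=> /Hr'; have := ler_normD (df s - df (U x)) (df (U x)); rewrite subrK; lra.
  have := near y yyz; have := near z zyz; rewrite !ltr_norml => /andP[z1 z2] /andP[y1 y2].
  have [UU|/ltW UU] := leP (U y) (U z).
    rewrite (ger0_norm (x := U z - _)) ?subr_ge0//; apply: (@derivable_lipschitz f df) => //.
      by move=> s /andP[s1 _]; apply: dF; rewrite (le_trans Uy).
    by move=> s /andP[s1 s2]; apply: K; rewrite ltr_norml; apply/andP; split; lra.
  rewrite distrC (distrC (U z)) (ger0_norm (x := U y - _)) ?subr_ge0//.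
  apply: (@derivable_lipschitz f df) => //.
    by move=> s /andP[s1 _]; apply: dF; rewrite (le_trans Uz).
  by move=> s /andP[s1 s2]; apply: K; rewrite ltr_norml; apply/andP; split; lra.
have xz := le_trans ay yz; have yb := le_trans yz zb.
apply: le_trans L _; apply: le_trans (ler_wpM2l _ (HU ay yz zb)) _.
  by rewrite addr_ge0// ltW.
have myz : measurable `[y, z] by exact: measurable_itv.
rewrite -RintegralZl//; last exact: intgV.
have cdU : {within `[y, z], continuous (fun t => `|df (U t)| + e)}.
  move=> t; apply: cvgD; last exact: cvg_cst.
  apply: cvg_norm; apply: (@continuous_comp (subspace `[y, z]) _ _ U df); last exact: cdf.
  exact: (continuous_subspaceW (sub_itv ay zb) cU).
apply: le_Rintegral => //.
- by apply: intgZ => //; exact: intgV.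
- by apply: intg_continuousM => //; exact: intgV.
move=> t /=; rewrite in_itv/= => tyz; apply: ler_wpM2r.
  by apply: V0; move: tyz => /andP[yt tz]; rewrite (le_trans ay yt) (le_trans tz zb).
have := Hr' _ (near t tyz).
have := ler_normD (df (U x) - df (U t)) (df (U t)); rewrite subrK (distrC (df (U x))); lra.
Qed.

Let cdU : {within `[a, b], continuous (fun t => `|df (U t)|)}.
Proof.
move=> t; apply: cvg_norm; apply: (@continuous_comp (subspace `[a, b]) _ _ U df); last exact: cdf.
exact: cU.
Qed.

(** Applied below to U = |u| and V = |u'|, so that neither [|u|] nor [f |u|] has to be
    differentiated. The sign s covers both halves of the absolute value, and e tends to 0 at the
    end. *)
Lemma chain_variation : `|f (U b) - f (U a)| <= \int[leb]_(t in `[a, b]) (`|df (U t)| * V t).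
Proof.
have mab : measurable `[a, b] by exact: measurable_itv.
have ik : intg `[a, b] (fun t => `|df (U t)| * V t) by exact: intg_continuousM.
have ike e : intg `[a, b] (fun t => (`|df (U t)| + e) * V t).
  by apply: intg_continuousM => // t; apply: cvgD; [exact: cdU|exact: cvg_cst].
have IV0 : 0 <= \int[leb]_(t in `[a, b]) V t.
  by apply: Rintegral_ge0 => t /=; rewrite in_itv; exact: V0.
have main (s e : R) : `|s| = 1 -> 0 < e ->
    s * (f (U b) - f (U a)) <= \int[leb]_(t in `[a, b]) ((`|df (U t)| + e) * V t).
  move=> s1 e0.
  (* The bound minus the signed increment: [chain_local] says that it is locally nondecreasing. *)
  pose D x := \int[leb]_(t in `[a, x]) ((`|df (U t)| + e) * V t) - s * (f (U x) - f (U a)).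
  suff : D a <= D b.
    by rewrite /D set_itv1 Rintegral_set1 subrr mulr0 subrr subr_ge0.
  have Dyz y z : a <= y -> y <= z -> z <= b ->
    `|f (U z) - f (U y)| <= \int[leb]_(t in `[y, z]) ((`|df (U t)| + e) * V t) -> D y <= D z.
    move=> ay yz zb H; rewrite /D (@Rintegral_split _ _ a y z)//; last first.
      by apply: intgS (ike e) => //; exact: sub_itv.
    have : s * (f (U z) - f (U y)) <= `|f (U z) - f (U y)|.
      by rewrite (le_trans (ler_norm _))// normrM s1 mul1r.
    move: H; nra.
  apply: locally_monotone_le => // x xab; have [d d0 Hd] := chain_local e0 xab.
  exists d => // y /andP[ay yb]; move: xab => /andP[ax xb].
  rewrite ltr_norml => /andP[? ?].
  by split=> ?; apply: Dyz => //; apply: Hd => //; lra.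
have main' (s : R) : `|s| = 1 ->
    s * (f (U b) - f (U a)) <= \int[leb]_(t in `[a, b]) (`|df (U t)| * V t).
  move=> s1; apply/ler_addgt0Pr => e e0.
  (* Scaled so that the error [c] times the integral of [V] is at most e; adding 1 covers a
     vanishing integral. *)
  pose c := e / (\int[leb]_(t in `[a, b]) V t + 1).
  have c0 : 0 < c by rewrite divr_gt0// ltr_wpDl.
  apply: le_trans (main s c s1 c0) _.
  under eq_Rintegral do rewrite mulrDl.
  rewrite RintegralD//; last exact: intgZ.
  rewrite lerD2l RintegralZl// /c mulrAC ler_pdivrMr ?ltr_wpDl//.
  by rewrite ler_wpM2l ?ltW// ltrDl.
have := main' 1 (normr1 _); have := main' (-1) (normrN1 _).
by rewrite mulN1r mul1r ler_norml => ? ?; apply/andP; split; lra.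
Qed.

End ChainRule.
End Chain.

(** * Uniqueness of weak derivatives and the case of C^1 functions *)

Section Uniqueness.
Variable R : realType.
Implicit Types (f g u v w du : R -> R) (I : set R) (a b x y : R).

Lemma L2_bounded_intg I u a b : measurable I -> L2 I u -> intg (I `&` `[a, b]) u.
Proof.
move=> mI Lu; have mab : measurable (I `&` `[a, b]) by apply: measurableI => //; exact: measurable_itv.
have Lab := L2_subset mI mab (@subIsetl _ _ _) Lu.
have i1 : intg (I `&` `[a, b]) (fun=> 1 : R).
  apply: (@intgS _ `[a, b]) => //.
  by apply: continuous_intg => x; exact: cst_continuous.
case: (Lab) => mu _.
apply: (le_intg mab mu _ (intgD mab i1 (L2_sq mab Lab))) => x _.
rewrite -(real_normK (num_real (u x))); have := normr_ge0 (u x); nra.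
Qed.

(** At an interior point of I the primitive of [w] is locally constant, and by Lebesgue
    differentiation its derivative is [w] almost everywhere. Truncation to [-n, n] provides the
    integrability that this requires; the boundary points of I form a null set. *)
Lemma ae_zero_of_itv I w : measurable I -> L2 I w -> countable (I `\` I°) ->
  (forall a b, a < b -> `[a, b] `<=` I -> \int[leb]_(x in `[a, b]) w x = 0) ->
  {ae leb, forall x, I x -> w x = 0}.
Proof.
move=> mI Lw cI Hw.
pose J n : set R := I `&` `[(- n%:R), n%:R].
have mJ n : measurable (J n) by apply: measurableI => //; exact: measurable_itv.
pose f n : R -> R := w \_ (J n).
have lf n : locally_integrable setT (f n).
  by apply: integrable_locally_restrict => //; exact: L2_bounded_intg.
have mf n : intg setT (f n).
  by apply: intg_restrict => //; exact: L2_bounded_intg.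
have ae_f := ae_filter_ringOfSetsType (@lebesgue_measure R).
have H1 : {ae leb, forall x, forall n : nat, - n%:R < x ->
    derivable (fun y => \int[leb]_(t in [set` Interval (BLeft (- n%:R)) (BRight y)]) f n t) x 1 /\
    derive1 (fun y => \int[leb]_(t in [set` Interval (BLeft (- n%:R)) (BRight y)]) f n t) x = f n x}.
  apply: ae_foralln => n.
  have inty y : intg [set` Interval (BLeft (- n%:R)) (BRight y)] (f n) by apply: integrableS (mf n).
  apply: filterS (FTC1 inty (lf n)) => x Hx nx.
  by apply: Hx => //; exact: ltW.
have H2 : {ae leb, forall x, ~ (I `\` I°) x}.
  exists (I `\` I°); split; first exact: countable_measurable.
    exact: countable_lebesgue_measure0.
  by move=> x /= /contrapT.
apply: filterS2 H1 H2 => x Hx xI Ix.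
have {xI} xI : I° x by apply: contrapT => xI'; exact: xI.
pose n := (Num.trunc `|x|).+1.
have xn : `|x| < n%:R by rewrite /n; apply: truncnS_gt.
have [mxn xn'] : - n%:R < x /\ x < n%:R by move: xn; rewrite ltr_norml => /andP[].
have -> : w x = f n x by rewrite /f patchE mem_set//; split=> //=; rewrite in_itv/= !ltW.
have [dF <-] := Hx n mxn.
move: xI => /nbhs_ballP[d d0 xd].
pose F y := \int[leb]_(t in `[(- n%:R)%R, y]) f n t.
rewrite derive1E (@near_eq_derive _ _ _ F (cst (F x))); first by rewrite derive_cst.
have eqF y z : y <= z -> - n%:R <= y -> z < n%:R -> `|y - x| < d -> `|z - x| < d -> F y = F z.
  move=> yz ny zn yd zd; rewrite /F (@Rintegral_split _ _ (- n%:R) y z)//; last first.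
    by apply: integrableS (mf n).
  suff -> : \int[leb]_(t in `[y, z]) f n t = 0 by rewrite addr0.
  have yzI t : y <= t <= z -> I t.
    move=> /andP[yt tz]; apply: xd; rewrite /ball/= distrC.
    by move: yd zd; rewrite !ltr_norml => /andP[? ?] /andP[? ?]; apply/andP; split; lra.
  transitivity (\int[leb]_(t in `[y, z]) w t).
    apply: eq_Rintegral => t /set_mem/=; rewrite in_itv/= => tyz; rewrite /f patchE mem_set//; split; first exact: yzI.
    by move: tyz => /andP[yt tz]; rewrite /= in_itv/=; apply/andP; split; lra.
  move: yz; rewrite le_eqVlt => /orP[/eqP ->|yz]; first by rewrite set_itv1 Rintegral_set1.
  by apply: Hw => // t /=; rewrite in_itv; exact: yzI.
have n1 : 0 < x + n%:R by lra.
have n2 : 0 < n%:R - x by lra.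
near=> y.
have yd : `|y - x| < d.
  have : ball x d y by near: y; exact: nbhsx_ballx.
  by rewrite /ball/= distrC.
have : ball x (x + n%:R) y by near: y; exact: nbhsx_ballx.
have : ball x (n%:R - x) y by near: y; exact: nbhsx_ballx.
rewrite /ball/= !ltr_norml => /andP[? ?] /andP[? ?].
have y1 : - n%:R < y by lra.
have y2 : y < n%:R by lra.
have xx : `|x - x| < d by rewrite subrr normr0.
by have [yx|/ltW xy] := leP y x; [apply: eqF => //; exact: ltW|apply/esym/eqF => //; exact: ltW].
Unshelve. all: by end_near. Qed.

Lemma Rintegral_powR2 I u : \int[leb]_(x in I) (`|u x| `^ 2) = \int[leb]_(x in I) (u x ^+ 2).
Proof.
apply: eq_Rintegral => x _.
by rewrite -[2]/(2%:R) powR_mulrn// real_normK// num_real.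
Qed.

Lemma wderivP I u : H1 I u -> L2 I (wderiv I u) /\ weak_derivative I u (wderiv I u).
Proof. by move=> [_ [v Hv]]; exact: (@xgetPex _ (fun=> 0) [set v | L2 I v /\ weak_derivative I u v] (ex_intro _ v Hv)). Qed.

(** Both integrands vanish off the support of the test function, so they may be integrated over a
    segment [-M, M] whose ends lie outside this support; the boundary terms of the product rule then
    vanish. *)
Lemma weak_derivative_C1 I u du : (forall x, is_derive x (1 : R) u (du x)) -> continuous du ->
  weak_derivative I u du.
Proof.
move=> dU cdu phi [dphi cphi cpt sub].
have dp x : is_derive x (1 : R) phi (derive1 phi x).
  by rewrite derive1E; exact: derivableP.
have p0 x : ~ closure [set x | phi x != 0] x -> phi x = 0.
  move=> nx; apply/eqP/negP => px; apply: nx; apply: subset_closure; exact/negP.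
have dp0 x : ~ closure [set x | phi x != 0] x -> derive1 phi x = 0.
  move=> nx; rewrite derive1E (@near_eq_derive _ _ _ phi (cst 0)) ?derive_cst//.
  have : nbhs x (~` closure [set x | phi x != 0]).
    by apply: open_nbhs_nbhs; split => //; apply: closed_openC; exact: closed_closure.
  by apply: filterS => y; exact: p0.
have [N [Nr HN]] := compact_bounded cpt.
pose M := `|N| + 1.
have M0 : 0 < M by rewrite ltr_wpDl.
(* [compact_bounded] bounds the support by every number above N; [|N| + 2^-1] is one that is still
   below [M]. *)
have KM x : closure [set x | phi x != 0] x -> `|x| < M.
  move=> Kx; apply: le_lt_trans (HN (`|N| + 2^-1) _ _ Kx) _.
    by rewrite (le_lt_trans (ler_norm _))// ltrDl invr_gt0.
  by rewrite /M ltrD2l invf_lt1// ltr1n.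
have KB : closure [set x | phi x != 0] `<=` `[- M, M].
  by move=> x /KM; rewrite ltr_norml /= in_itv/= => /andP[? ?]; rewrite !ltW.
have KI : closure [set x | phi x != 0] `<=` I.
  by apply: subset_trans sub _; exact: interior_subset.
have toB (h : R -> R) : (forall x, ~ closure [set x | phi x != 0] x -> h x = 0) ->
    \int[leb]_(x in I) h x = \int[leb]_(x in `[- M, M]) h x.
  move=> h0; transitivity (\int[leb]_(x in closure [set x | phi x != 0]) h x).
    by apply: Rintegral_support => // x _; exact: h0.
  by apply/esym; apply: Rintegral_support => // x _; exact: h0.
rewrite toB; last by move=> x /dp0 ->; rewrite mulr0.
rewrite toB; last by move=> x /p0 ->; rewrite mulr0.
have cu := is_derive_continuous dU; have cp := is_derive_continuous dp.
have i1 : intg `[- M, M] (fun x => u x * derive1 phi x).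
  by apply: continuous_intg; apply: continuous_subspaceT => x; apply: cvgM; [exact: cu|exact: cphi].
have i2 : intg `[- M, M] (fun x => du x * phi x).
  by apply: continuous_intg; apply: continuous_subspaceT => x; apply: cvgM; [exact: cdu|exact: cp].
apply/eqP; rewrite -addr_eq0 -RintegralD//.
have dup x : is_derive x (1 : R) (fun x => u x * phi x) (u x * derive1 phi x + du x * phi x).
  by have := dU x; have := dp x => ? ?; apply: is_derive_eq; rewrite /GRing.scale/= (mulrC (phi x)).
rewrite (Rintegral_FTC2 _ _ dup); last first.
- by move=> x; apply: cvgD; apply: cvgM; [exact: cu|exact: cphi|exact: cdu|exact: cp].
- by lra.
have pM : phi M = 0 by apply: p0 => /KM; rewrite gtr0_norm// ltxx.
have pNM : phi (- M) = 0 by apply: p0 => /KM; rewrite normrN gtr0_norm// ltxx.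
by rewrite pM pNM !mulr0 subrr.
Qed.

(** [wderiv] is a chosen representative. It has the same integral as [du] over every segment of I,
    by [weak_derivative_FTC] for both, hence it equals [du] almost everywhere and the energy can be
    computed with [du]. *)
Lemma H1_C1 I u du : measurable I -> countable (I `\` I°) ->
  (forall x, is_derive x (1 : R) u (du x)) -> continuous du -> L2 I u -> L2 I du ->
  H1 I u /\ \int[leb]_(x in I) (wderiv I u x ^+ 2) = \int[leb]_(x in I) (du x ^+ 2).
Proof.
move=> mI cI dU cdu Lu Ldu.
have wd := @weak_derivative_C1 I _ _ dU cdu.
have H1u : H1 I u by split => //; exists du.
split=> //; have [Lv wv] := wderivP H1u.
have cu : {within I, continuous u} by apply: continuous_subspaceT; exact: is_derive_continuous dU.
have Lw : L2 I (fun x => wderiv I u x - du x).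
  case: (Lv) (Ldu) => [mv _] [mdu _]; split; first exact: measurable_funB.
  have mB : measurable_fun I (fun x => wderiv I u x - du x) by exact: measurable_funB.
  have : intg I (fun x => 2 * (wderiv I u x ^+ 2 + du x ^+ 2)).
    by apply: intgZ => //; apply: intgD => //; exact: L2_sq.
  move=> /(le_intg mI (f := fun x => (wderiv I u x - du x) ^+ 2)).
  case/(_ _ _)/integrableP => [||_]; first exact: measurable_funX.
    move=> x _; rewrite ger0_norm ?sqr_ge0//; have := sqr_ge0 (wderiv I u x + du x).
    by move: (wderiv I u x) (du x) => s t; nra.
  apply: le_lt_trans; rewrite le_eqVlt; apply/orP; left; apply/eqP.
  by apply: eq_integral => x _; rewrite /= normrX.
have /(ae_zero_of_itv mI Lw cI) ae0 a b : a < b -> `[a, b] `<=` I ->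
    \int[leb]_(x in `[a, b]) (wderiv I u x - du x) = 0.
  move=> ab abI; have mab : measurable `[a, b] by exact: measurable_itv.
  rewrite RintegralB//; first last.
  - by apply: L2_intg; exact: L2_subset Ldu.
  - by apply: L2_intg; exact: L2_subset Lv.
  by rewrite (weak_derivative_FTC Lv wv)// (weak_derivative_FTC Ldu wd)// subrr.
congr fine.
apply: ae_eq_integral => //.
- by apply/measurable_EFinP; apply: measurable_funX; case: Lv.
- by apply/measurable_EFinP; apply: measurable_funX; case: Ldu.
have ae_f := ae_filter_ringOfSetsType (@lebesgue_measure R).
by apply: filterS ae0 => x H Ix; move/eqP: (H Ix); rewrite subr_eq0 => /eqP ->.
Qed.

End Uniqueness.

(** * Invariance of Lebesgue measure under translations and reflections *)

Section AffineInvariance.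
Variable R : realType.
Implicit Types (b : bool) (c : R).

Definition affine b c : measurableTypeR R -> measurableTypeR R := fun x => c + (if b then x else - x).

Lemma continuous_affine b c : continuous (affine b c : R -> R).
Proof.
move=> x; apply: cvgD; first exact: cvg_cst.
by case: b; [exact: cvg_id|apply: cvgN; exact: cvg_id].
Qed.

Lemma measurable_affine b c : measurable_fun setT (affine b c).
Proof. apply: measurable_funD => //; case: b => //; exact: measurable_funN. Qed.

HB.instance Definition _ b c := isMeasurableFun.Build _ _ _ _ (affine b c) (measurable_affine b c).

Lemma lebesgue_measure_affine b c (A : set R) : measurable A ->
  pushforward leb (affine b c) A = leb A.
Proof.
move=> mA; apply/esym/lebesgue_measure_unique => //= _ [[x y]] _ <-.
rewrite /pushforward.
have -> : affine b c @^-1` `]x, y]%classic =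
    [set` if b then `](x - c), (y - c)] else `[(c - y), (c - x)[ ].
  by rewrite /affine; case: b; apply/seteqP; split=> z /=; rewrite !in_itv/=; lra.
by case: b; rewrite !lebesgue_measure_itv/= !lte_fin ?ltrD2r ?ltrD2l ?ltrN2; case: ifP => // _;
  rewrite -!EFinD; congr EFin; ring.
Qed.

Lemma ge0_integral_affine b c (D : set R) (k : R -> \bar R) : measurable D ->
  measurable_fun D k -> (forall x, D x -> (0 <= k x)%E) ->
  (\int[leb]_(x in D) k x = \int[leb]_(x in affine b c @^-1` D) k (affine b c x))%E.
Proof.
move=> mD mk k0; rewrite -[RHS](ge0_integral_pushforward (measurable_affine b c))//; last first.
  by move=> x; rewrite inE; exact: k0.
by apply: eq_measure_integral => A mA _; exact/esym/lebesgue_measure_affine.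
Qed.

End AffineInvariance.

(** * The soliton on the line *)

Section Hyperbolic.
Variable R : realType.
Implicit Types t : R.

Definition cosh t := (expR t + expR (- t)) / 2.
Definition sinh t := (expR t - expR (- t)) / 2.

Lemma is_derive_expRN t : is_derive t 1 (fun s => expR (- s)) (- expR (- t)).
Proof.
have H := is_derive1_comp (is_derive_expR (- t)) (is_deriveNid t 1).
by apply: (is_derive_eq H); rewrite mulrN1.
Qed.

Lemma is_derive_cosh t : is_derive t 1 cosh (sinh t).
Proof.
have := is_derive_expRN t => ?.
by rewrite /cosh; apply: is_derive_eq; rewrite /sinh /GRing.scale/=; lra.
Qed.

Lemma is_derive_sinh t : is_derive t 1 sinh (cosh t).
Proof.
have := is_derive_expRN t => ?.
by rewrite /sinh; apply: is_derive_eq; rewrite /cosh /GRing.scale/=; lra.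
Qed.

Lemma cosh_sinh t : cosh t ^+ 2 = 1 + sinh t ^+ 2.
Proof.
have := expRxMexpNx_1 t; rewrite /cosh /sinh.
by move: (expR t) (expR (- t)) => a b ab; nra.
Qed.

Lemma cosh_ge1 t : 1 <= cosh t.
Proof.
have := cosh_sinh t; have := sqr_ge0 (sinh t).
have : 0 < cosh t by rewrite /cosh divr_gt0// addr_gt0// expR_gt0.
nra.
Qed.

Lemma cosh_gt0 t : 0 < cosh t.
Proof. exact: lt_le_trans ltr01 (cosh_ge1 t). Qed.

Lemma coshN t : cosh (- t) = cosh t.
Proof. by rewrite /cosh opprK addrC. Qed.

Lemma sinhN t : sinh (- t) = - sinh t.
Proof. by rewrite /sinh opprK; lra. Qed.

Lemma cosh0 : cosh 0 = 1.
Proof. by rewrite /cosh oppr0 expR0; lra. Qed.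

Lemma sinh_ge0 t : 0 <= t -> 0 <= sinh t.
Proof. by move=> t0; rewrite /sinh divr_ge0// subr_ge0 ler_expR; lra. Qed.

Lemma sinh_gt0 t : 0 < t -> 0 < sinh t.
Proof. by move=> t0; rewrite /sinh divr_gt0// subr_gt0 ltr_expR; lra. Qed.

Lemma cosh_ge t : t / 2 <= cosh t.
Proof.
rewrite /cosh ler_pM2r ?invr_gt0//.
have := expR_ge1Dx t; have := expR_ge0 (- t); lra.
Qed.

Lemma ltr_cosh s t : 0 <= s -> s < t -> cosh s < cosh t.
Proof.
move=> s0 st; have [|r rst E] := MVT st (fun r _ => is_derive_cosh r).
  by apply: continuous_subspaceT; exact: is_derive_continuous is_derive_cosh.
rewrite -subr_gt0 E mulr_gt0 ?subr_gt0// sinh_gt0//.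
by move: rst; rewrite in_itv/= => /andP[sr _]; exact: le_lt_trans sr.
Qed.

End Hyperbolic.

Section Soliton.
Variables (R : realType) (p lam : R).
Hypotheses (p2 : 2 < p) (lam0 : 0 < lam).
Implicit Types (t s r : R).

(** The exponent alpha / beta of the sech profile. The parameter [lam] is the frequency in the
    soliton equation phi'' = lam phi - phi^(p-1). *)
Definition kap : R := 2 / (p - 2).
(** The positive zero of lam s^2 - (2/p) s^p, that is the height at which the first integral
    [dphi_sqr] makes phi' vanish. *)
Definition amp : R := (p * lam / 2) `^ (kap / 2).
Definition freq : R := Num.sqrt lam / kap.
Definition phi t : R := amp * cosh (freq * t) `^ (- kap).
Definition dphi t : R := - Num.sqrt lam * (sinh (freq * t) / cosh (freq * t)) * phi t.
(** The slope of the soliton as a function of its height, both normalized: |phi'| / (sqrt lam amp)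
    at height r amp. The absolute value makes it continuous on the whole line. *)
Definition gprof r : R := r * Num.sqrt (1 - `|r| `^ (p - 2)).

Lemma kap_gt0 : 0 < kap.
Proof. by rewrite divr_gt0// subr_gt0. Qed.

Lemma kapE : kap * (p - 2) = 2.
Proof. by rewrite /kap mulfVK// gt_eqF// subr_gt0. Qed.

Lemma amp_gt0 : 0 < amp.
Proof. by rewrite powR_gt0// divr_gt0// mulr_gt0// (lt_trans _ p2). Qed.

Lemma sqrt_lam_gt0 : 0 < Num.sqrt lam.
Proof. by rewrite sqrtr_gt0. Qed.

Lemma freq_gt0 : 0 < freq.
Proof. by rewrite divr_gt0 ?kap_gt0 ?sqrt_lam_gt0. Qed.

Lemma sqrt_lam2 : Num.sqrt lam ^+ 2 = lam.
Proof. by rewrite sqr_sqrtr// ltW. Qed.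

Lemma amp_pow : amp `^ (p - 2) = p * lam / 2.
Proof.
have h : 0 <= p * lam / 2 by rewrite divr_ge0// mulr_ge0// ltW// (lt_trans _ p2).
by rewrite /amp -powRrM (mulrAC kap) kapE divff// powRr1.
Qed.

(** Keeps the formula available once [amp] is opaque. *)
Lemma ampE : amp = (p * lam / 2) `^ (kap / 2).
Proof. by []. Qed.

Lemma phi_gt0 t : 0 < phi t.
Proof. by rewrite mulr_gt0 ?amp_gt0// powR_gt0// cosh_gt0. Qed.

Lemma phiN t : phi (- t) = phi t.
Proof. by rewrite /phi mulrN coshN. Qed.

Lemma dphiN t : dphi (- t) = - dphi t.
Proof. by rewrite /dphi phiN mulrN coshN sinhN; ring. Qed.

Lemma phi0 : phi 0 = amp.
Proof. by rewrite /phi mulr0 cosh0 powR1 mulr1. Qed.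

Lemma phi_lt s t : 0 <= s -> s < t -> phi t < phi s.
Proof.
move=> s0 st; rewrite /phi ltr_pM2l ?amp_gt0// !powRN.
have c : cosh (freq * s) < cosh (freq * t).
  by apply: ltr_cosh; [rewrite mulr_ge0// ltW// freq_gt0|rewrite ltr_pM2l ?freq_gt0].
rewrite ltf_pV2 ?posrE ?powR_gt0 ?cosh_gt0//.
by apply: gt0_ltr_powR; rewrite ?kap_gt0// nnegrE ltW// cosh_gt0.
Qed.

Lemma phi_le s t : 0 <= s -> s <= t -> phi t <= phi s.
Proof. by move=> s0; rewrite le_eqVlt => /orP[/eqP -> //|st]; rewrite ltW// phi_lt. Qed.

Lemma phi_norm t : phi `|t| = phi t.
Proof. by have [t0|t0] := leP 0 t; [rewrite (ger0_norm t0)|rewrite (ltr0_norm t0) phiN]. Qed.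

Lemma phi_le_amp t : phi t <= amp.
Proof. by rewrite -phi0 -phi_norm phi_le. Qed.

Lemma phi_inj s t : 0 <= s -> 0 <= t -> phi s = phi t -> s = t.
Proof.
move=> s0 t0 E; have [st|ts|//] := ltgtP s t.
  by have := phi_lt s0 st; rewrite E ltxx.
by have := phi_lt t0 ts; rewrite E ltxx.
Qed.

Lemma is_derive_phi t : is_derive t 1 phi (dphi t).
Proof.
have dl : is_derive t 1 (fun s => freq * s) freq.
  by apply: is_derive_eq; rewrite /GRing.scale/= ?mulr1 ?mulr0 ?addr0.
have dc := is_derive1_comp (is_derive_cosh (freq * t)) dl.
have dpow := is_derive1_powR (- kap) (cosh_gt0 (freq * t)).
have dp := @is_derive1_comp R (fun x => x `^ (- kap)) (@cosh R \o *%R freq) t _ _ dpow dc.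
have H : is_derive t 1 phi (amp *: (- kap * cosh (freq * t) `^ (- kap - 1) * (sinh (freq * t) * freq))).
  exact: is_deriveZ.
apply: (is_derive_eq H); rewrite /dphi /phi /GRing.scale/=.
rewrite powRB; last by apply/implyP => _; rewrite gt_eqF// cosh_gt0.
rewrite powRr1 ?ltW ?cosh_gt0// /freq; field.
by rewrite !gt_eqF ?kap_gt0 ?cosh_gt0.
Qed.

Definition ddphi t := phi t * (lam * (sinh (freq * t) / cosh (freq * t)) ^+ 2 -
  lam / kap * (1 - (sinh (freq * t) / cosh (freq * t)) ^+ 2)).

Lemma is_derive_dphi t : is_derive t 1 dphi (ddphi t).
Proof.
have dl : is_derive t 1 (fun s => freq * s) freq.
  by apply: is_derive_eq; rewrite /GRing.scale/= ?mulr1 ?mulr0 ?addr0.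
have dc := is_derive1_comp (is_derive_cosh (freq * t)) dl.
have ds := is_derive1_comp (is_derive_sinh (freq * t)) dl.
have c0 : cosh (freq * t) != 0 by rewrite gt_eqF ?cosh_gt0.
have di := @is_deriveV R (@cosh R \o *%R freq) t _ 1 c0 dc.
have dp := is_derive_phi t.
have dsc := is_deriveM ds di.
have H := is_deriveM (is_deriveZ (- Num.sqrt lam) dsc) dp.
apply: (is_derive_eq H); rewrite /ddphi /dphi !fctE /GRing.scale/= /freq.
have E := esym sqrt_lam2; set q := Num.sqrt lam in E *; rewrite E.
have k0 : kap != 0 by rewrite gt_eqF ?kap_gt0.
move: c0 k0; rewrite /freq -/q; set c := cosh _; set s := sinh _ => c0 k0.
rewrite -[- q *: _]/(- q * _); field.
by rewrite c0.
Qed.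

Lemma continuous_phi : continuous phi.
Proof. exact: is_derive_continuous is_derive_phi. Qed.

Lemma continuous_dphi : continuous dphi.
Proof. exact: is_derive_continuous is_derive_dphi. Qed.

Lemma phi_pow t : (phi t / amp) `^ (p - 2) = (cosh (freq * t) ^+ 2)^-1.
Proof.
rewrite /phi mulrAC divff ?gt_eqF ?amp_gt0// mul1r -powRrM mulNr kapE.
by rewrite powRN -[2]/(2%:R) powR_mulrn// ltW// cosh_gt0.
Qed.

Lemma tanh2 t : (sinh t / cosh t) ^+ 2 = 1 - (cosh t ^+ 2)^-1.
Proof.
by rewrite exprMn exprVn -(addKr 1 (sinh t ^+ 2)) -cosh_sinh; field; rewrite gt_eqF ?cosh_gt0.
Qed.

(** The first integral of the soliton equation, from tanh^2 = 1 - 1 / cosh^2 and [phi_pow]. *)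
Lemma dphi_sqr t : dphi t ^+ 2 = lam * phi t ^+ 2 - 2 / p * phi t `^ p.
Proof.
have a0 := amp_gt0; have f0 := phi_gt0 t.
have -> : phi t `^ p = phi t ^+ 2 * (p * lam / 2 * (cosh (freq * t) ^+ 2)^-1).
  have {1}-> : p = 2%:R + (p - 2) by ring.
  rewrite powRD; last by apply/implyP => _; rewrite gt_eqF.
  rewrite powR_mulrn ?ltW// -phi_pow -amp_pow -powRM ?divr_ge0 ?ltW//.
  by rewrite mulrC (mulrC amp) divfK ?gt_eqF// mulrC.
rewrite /dphi exprMn [(- _ * _) ^+ 2]exprMn sqrrN sqrt_lam2 tanh2; field.
by rewrite gt_eqF ?cosh_gt0 ?gt_eqF// (lt_trans _ p2).
Qed.

(** The left-hand side is the derivative of 2 phi phi'; integrated over the half-line, this identity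
    of Pohozaev type expresses the mass through the integral of phi'^2. *)
Lemma dphi_pohozaev t :
  2 * (dphi t ^+ 2 + phi t * ddphi t) = (p + 2) * dphi t ^+ 2 - (p - 2) * lam * phi t ^+ 2.
Proof.
rewrite /ddphi /dphi exprMn [(- _ * _) ^+ 2]exprMn sqrrN sqrt_lam2.
set T := (_ / _) ^+ 2; rewrite /kap; field.
by rewrite gt_eqF// subr_gt0.
Qed.

(** The soliton solves an autonomous first-order equation on the half-line; the sign of sinh selects
    the decreasing branch. *)
Lemma dphi_gprof t : 0 <= t -> dphi t = - Num.sqrt lam * amp * gprof (phi t / amp).
Proof.
move=> t0; rewrite /gprof (ger0_norm (x := phi t / amp)) ?divr_ge0 ?ltW ?phi_gt0 ?amp_gt0//.
rewrite phi_pow -tanh2 sqrtr_sqr ger0_norm; last first.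
  have ft : 0 <= freq * t by rewrite mulr_ge0// ltW// freq_gt0.
  by rewrite divr_ge0 ?sinh_ge0// ltW// cosh_gt0.
by rewrite /dphi; field; rewrite !gt_eqF ?amp_gt0 ?cosh_gt0.
Qed.

Lemma phi_cvg0 : phi t @[t --> +oo] --> 0.
Proof.
apply/cvgrPdist_le => e e0.
have h : 0 <= amp / e by rewrite divr_ge0 ?ltW ?amp_gt0.
have K : \forall t \near +oo, freq^-1 * ((amp / e) `^ kap^-1 * 2) <= t.
  by apply: nbhs_pinfty_ge; exact: num_real.
apply: filterS K => t ht.
rewrite sub0r normrN (gtr0_norm (phi_gt0 t)) /phi powRN.
have cp : 0 < cosh (freq * t) `^ kap by rewrite powR_gt0// cosh_gt0.
rewrite ler_pdivrMr// -ler_pdivrMl// mulrC.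
have -> : amp / e = ((amp / e) `^ kap^-1) `^ kap.
  by rewrite -powRrM mulVf ?powRr1// gt_eqF ?kap_gt0.
have hc : (amp / e) `^ kap^-1 <= cosh (freq * t).
  apply: le_trans (cosh_ge _); rewrite ler_pdivlMr//.
  by move: ht; rewrite ler_pdivrMl ?freq_gt0.
apply: ge0_ler_powR => //; first exact: ltW kap_gt0.
  by rewrite nnegrE powR_ge0.
by rewrite nnegrE ltW// cosh_gt0.
Qed.

Lemma dphi_le t : `|dphi t| <= Num.sqrt lam * phi t.
Proof.
have h0 : 0 <= Num.sqrt lam * phi t.
  by apply: mulr_ge0; apply: ltW; [exact: sqrt_lam_gt0|exact: phi_gt0].
rewrite -(ler_pXn2r (n := 2)) ?nnegrE//.
rewrite real_normK ?num_real// dphi_sqr [(Num.sqrt lam * _) ^+ 2]exprMn sqrt_lam2.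
have : 0 <= 2 / p * phi t `^ p.
  by rewrite mulr_ge0 ?powR_ge0// divr_ge0// ltW// (lt_trans _ p2).
lra.
Qed.

End Soliton.

#[global] Opaque cosh sinh kap amp freq phi dphi.

(** * Primitives and strict Bernoulli inequalities *)

Section Primitive.
Variable R : realType.
Implicit Types (k : R -> R) (x y r : R).

(* The base point -1 makes [0, +oo[ interior to the domain of differentiability. *)
Definition prim k x : R := \int[leb]_(t in `[(-1)%R, x]) k t.

Lemma is_derive_prim k x : continuous k -> 0 <= x -> is_derive x 1 (prim k) (k x).
Proof.
move=> ck x0; have x1 : x < x + 1 by rewrite ltrDl.
have ik : intg `[(-1)%R, x + 1] k by apply: continuous_intg; exact: continuous_subspaceT.
have [|dk E] := continuous_FTC1_closed x1 ik _ (ck x); first lra.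
by rewrite -E derive1E; exact: derivableP.
Qed.

Lemma continuous_powR_norm (q : R) : 0 < q -> continuous (fun r => `|r| `^ q).
Proof.
move=> q0 r; have [->|r0] := eqVneq r 0.
  apply/cvgrPdist_le => e e0; rewrite normr0 powR0 ?gt_eqF//.
  have d0 : 0 < e `^ q^-1 by rewrite powR_gt0.
  apply/nbhs_ballP; exists (e `^ q^-1) => // y /=; rewrite /ball/= sub0r normrN => yd.
  rewrite sub0r normrN ger0_norm ?powR_ge0//.
  have -> : e = (e `^ q^-1) `^ q by rewrite -powRrM mulVf ?powRr1 ?gt_eqF ?ltW.
  by apply: ge0_ler_powR; [exact: ltW|rewrite nnegrE|rewrite nnegrE powR_ge0|exact: ltW].
apply: (@continuous_comp R R R (fun r => `|r|) (fun s => s `^ q)); first exact: norm_continuous.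
apply: differentiable_continuous; apply/derivable1_diffP.
have r0' : 0 < `|r| by rewrite normr_gt0.
by have := is_derive1_powR q r0' => ?; exact: ex_derive.
Qed.

Lemma lt_ln1 y : 0 < y -> y != 1 -> ln y < y - 1.
Proof.
move=> y0 y1; rewrite -ltr_expR lnK ?posrE//.
by have := @expR_gt1Dx R (y - 1); rewrite subr_eq0 => /(_ y1); rewrite addrC subrK.
Qed.

Lemma le_ln1 y : 0 < y -> ln y <= y - 1.
Proof.
move=> y0; have [->|y1] := eqVneq y 1; first by rewrite ln1 subrr.
exact: ltW (lt_ln1 y0 y1).
Qed.

(** With m the affine value, sum ln z <= z - 1 at z = y / m with weight th and at z = 1 / m with
    weight 1 - th: the right-hand sides cancel. *)
Lemma powR_lt_affine (th y : R) : 0 < th -> th < 1 -> 0 < y -> y != 1 ->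
  y `^ th < 1 + th * (y - 1).
Proof.
move=> t0 t1 y0 y1; set m := 1 + th * (y - 1).
have m0 : 0 < m by rewrite /m; nra.
have ym : y / m != 1.
  apply/eqP => /(congr1 (fun s => s * m)); rewrite divfK ?gt_eqF// mul1r /m => E.
  have : (1 - th) * (y - 1) = 0 by lra.
  by move/eqP; rewrite mulf_eq0 !subr_eq0 (negPf y1) orbF => /eqP th1; move: t1; rewrite -th1 ltxx.
have h1 := lt_ln1 (divr_gt0 y0 m0) ym.
have h2 : ln m^-1 <= m^-1 - 1 by apply: le_ln1; rewrite invr_gt0.
move: h1 h2; rewrite lnM ?posrE ?invr_gt0// lnV ?posrE// => h1 h2.
rewrite /powR gt_eqF// -[ltRHS]lnK ?posrE// ltr_expR.
have e1 : th * (y / m) + (1 - th) * m^-1 = 1.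
  have -> : th * (y / m) + (1 - th) * m^-1 = (1 + th * (y - 1)) / m by ring.
  by rewrite divff// gt_eqF.
have : th * (ln y - ln m) < th * (y / m - 1) by rewrite ltr_pM2l.
have : (1 - th) * (- ln m) <= (1 - th) * (m^-1 - 1) by apply: ler_wpM2l => //; rewrite subr_ge0 ltW.
lra.
Qed.

(** The concave inequality with exponent 1 / r at the point x^r. *)
Lemma powR_gt_affine (r x : R) : 1 < r -> 0 < x -> x != 1 -> 1 + r * (x - 1) < x `^ r.
Proof.
move=> r1 x0 x1; have r0 : 0 < r by exact: lt_trans r1.
have y0 : 0 < x `^ r by rewrite powR_gt0.
have E : (x `^ r) `^ r^-1 = x by rewrite -powRrM mulfV ?powRr1 ?gt_eqF ?ltW.
have y1 : x `^ r != 1 by apply: contra_neq x1 => y1; rewrite -E y1 powR1.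
have ri0 : 0 < r^-1 by rewrite invr_gt0.
have ri1 : r^-1 < 1 by rewrite invf_lt1.
have := powR_lt_affine ri0 ri1 y0 y1; rewrite E => h.
have : r * (x - 1) < r * (r^-1 * (x `^ r - 1)) by rewrite ltr_pM2l//; lra.
by rewrite mulrA mulfV ?gt_eqF// mul1r; lra.
Qed.

End Primitive.

Section SolitonIntegrals.
Variables (R : realType) (p : R).
Hypotheses (p2 : 2 < p).
Implicit Types (t s r lam : R).

Lemma continuous_gprof : continuous (gprof p).
Proof.
have q0 : 0 < p - 2 by rewrite subr_gt0.
move=> r; apply: cvgM; first exact: cvg_id.
apply: (@continuous_comp R R R (fun r => 1 - `|r| `^ (p - 2)) Num.sqrt); last exact: sqrt_continuous.
by apply: cvgB; [exact: cvg_cst|exact: continuous_powR_norm].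
Qed.

(** The integral of [gprof] over [0, 1]; the substitution s = phi / amp turns the integral of phi'^2
    over a half-line into it. *)
Definition wtot : R := prim (gprof p) 1 - prim (gprof p) 0.

Lemma gprof_gt0 r : 0 < r -> r < 1 -> 0 < gprof p r.
Proof.
move=> r0 r1; rewrite mulr_gt0// sqrtr_gt0 subr_gt0 gtr0_norm//.
have : r `^ (p - 2) < 1 `^ (p - 2).
  by apply: gt0_ltr_powR; [rewrite subr_gt0|rewrite nnegrE ltW|rewrite nnegrE|].
by rewrite powR1.
Qed.

Lemma gprof_ge0 r : 0 <= r -> 0 <= gprof p r.
Proof. by move=> r0; rewrite mulr_ge0// sqrtr_ge0. Qed.

Lemma wtot_gt0 : 0 < wtot.
Proof.
have dW r : 0 <= r <= 1 -> is_derive r (1 : R) (prim (gprof p)) (gprof p r).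
  by move=> /andP[r0 _]; apply: is_derive_prim => //; exact: continuous_gprof.
have [r|c c01 E] := @MVT R (prim (gprof p)) (gprof p) 0 1 ltr01 _ (is_derive_within dW).
  by rewrite in_itv/= => /andP[r0 r1]; apply: dW; rewrite !ltW.
by rewrite /wtot E subr0 mulr1; move: c01; rewrite in_itv/= => /andP[? ?]; exact: gprof_gt0.
Qed.

Section FixedLam.
Variable lam : R.
Hypothesis lam0 : 0 < lam.
Let M := amp p lam.
Let M0 : 0 < M := amp_gt0 p2 lam0.

(** The antiderivative of phi'^2 given by this substitution; the minus sign comes from phi being
    decreasing. *)
Let F t := - Num.sqrt lam * M ^+ 2 * prim (gprof p) (phi p lam t / M).

Let dF t : 0 <= t -> is_derive t (1 : R) F (dphi p lam t ^+ 2).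
Proof.
move=> t0.
have dp := is_derive_phi lam p2 t.
have dq : is_derive t (1 : R) (fun s => phi p lam s / M) (dphi p lam t / M).
  by apply: is_derive_eq; rewrite /GRing.scale/= ?mulr0 ?add0r mulrC.
have q0 : 0 <= phi p lam t / M by rewrite divr_ge0 ?ltW ?phi_gt0.
have dW := is_derive_prim continuous_gprof q0.
have dc := @is_derive1_comp R (prim (gprof p)) (fun s => phi p lam s / M) t _ _ dW dq.
have H := is_deriveZ (- Num.sqrt lam * M ^+ 2) dc.
apply: (is_derive_eq H); rewrite /GRing.scale/=.
transitivity ((- Num.sqrt lam * M * gprof p (phi p lam t / M)) * dphi p lam t).
  by field; rewrite gt_eqF.
by rewrite -(dphi_gprof p2 lam0 t0) expr2.
Qed.

Let prim_cvg : prim (gprof p) (phi p lam t / M) @[t --> +oo] --> prim (gprof p) 0.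
Proof.
have c0 : prim (gprof p) x @[x --> 0] --> prim (gprof p) 0.
  apply: differentiable_continuous; apply/derivable1_diffP.
  by have := is_derive_prim continuous_gprof (lexx 0) => ?; exact: ex_derive.
have hq : phi p lam t / M @[t --> +oo] --> 0.
  by rewrite -(mul0r M^-1); apply: cvgM; [exact: phi_cvg0|exact: cvg_cst].
exact: (cvg_comp _ _ hq c0).
Qed.

Lemma integral_dphi2 :
  (\int[leb]_(t in `[0%R, +oo[) (dphi p lam t ^+ 2)%:E = (Num.sqrt lam * M ^+ 2 * wtot)%:E)%E.
Proof.
have cd := continuous_dphi p2 lam0.
have cd2 : continuous (fun t => dphi p lam t ^+ 2).
  by move=> x; under eq_fun do rewrite expr2; apply: cvgM; exact: cd.
have cF : F t @[t --> +oo] --> - Num.sqrt lam * M ^+ 2 * prim (gprof p) 0.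
  by apply: cvgM; [exact: cvg_cst|exact: prim_cvg].
rewrite (integral_FTC2y (fun x _ => sqr_ge0 _) cd2 dF cF).
by congr EFin; rewrite /F phi0 -/M divff ?gt_eqF// /wtot; ring.
Qed.

Lemma integral_phi2 : (\int[leb]_(t in `[0%R, +oo[) (phi p lam t ^+ 2)%:E =
  ((p + 2) / (p - 2) / lam * (Num.sqrt lam * M ^+ 2 * wtot))%:E)%E.
Proof.
have cd := continuous_dphi p2 lam0; have cp := @continuous_phi R p lam p2.
have pn : p - 2 != 0 by rewrite gt_eqF// subr_gt0.
have ln : lam != 0 by rewrite gt_eqF.
(* The antiderivative of phi^2 read off [dphi_pohozaev]. Its term phi phi' vanishes at 0 because
   phi' is odd, and at infinity because |phi'| <= sqrt lam phi. *)
pose Phi t := ((p - 2) * lam)^-1 * ((p + 2) * F t - 2 * (phi p lam t * dphi p lam t)).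
have cp2 : continuous (fun t => phi p lam t ^+ 2).
  by move=> x; under eq_fun do rewrite expr2; apply: cvgM; exact: cp.
have dPhi t : 0 <= t -> is_derive t (1 : R) Phi (phi p lam t ^+ 2).
  move=> t0; have d1 := dF t0; have d2 := is_derive_phi lam p2 t.
  have d3 := is_derive_dphi p2 lam0 t.
  have d4 := is_deriveZ 2 (is_deriveM d2 d3).
  have d5 := is_deriveB (is_deriveZ (p + 2) d1) d4.
  have H := is_deriveZ ((p - 2) * lam)^-1 d5.
  apply: (is_derive_eq H); rewrite /GRing.scale/=.
  have := dphi_pohozaev p2 lam0 t; rewrite expr2.
  move: (phi p lam t) (dphi p lam t) (ddphi p lam t) => f d e E.
  have -> : (p + 2) * (d * d) - 2 * (f * e + d * d) = (p - 2) * lam * f ^+ 2 by lra.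
  by rewrite mulKf// mulf_neq0.
have fdf : phi p lam t * dphi p lam t @[t --> +oo] --> 0.
  have c2 : Num.sqrt lam * (phi p lam t * phi p lam t) @[t --> +oo] --> 0.
    rewrite -[X in _ --> X](mulr0 (Num.sqrt lam)); apply: cvgM; first exact: cvg_cst.
    by rewrite -[X in _ --> X](mulr0 0); apply: cvgM; exact: phi_cvg0.
  have c3 : - (Num.sqrt lam * (phi p lam t * phi p lam t)) @[t --> +oo] --> 0.
    by rewrite -oppr0; apply: cvgN.
  apply: (squeeze_cvgr _ c3 c2); apply: nearW => t.
  have := dphi_le p2 lam0 t; rewrite ler_norml => /andP[h1 h2].
  have := phi_gt0 p2 lam0 t; move: h1 h2.
  by move: (phi p lam t) (dphi p lam t) => f d ? ? ?; apply/andP; split; nra.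
have cPhi : Phi t @[t --> +oo] --> ((p - 2) * lam)^-1 *
    ((p + 2) * (- Num.sqrt lam * M ^+ 2 * prim (gprof p) 0) - 2 * 0).
  apply: cvgM; first exact: cvg_cst.
  apply: cvgB; apply: cvgM; try exact: cvg_cst; last exact: fdf.
  by apply: cvgM; [exact: cvg_cst|exact: prim_cvg].
rewrite (integral_FTC2y (fun x _ => sqr_ge0 _) cp2 dPhi cPhi).
congr EFin; rewrite /Phi /F phi0 -/M divff ?gt_eqF// /wtot.
have -> : dphi p lam 0 = 0 by have := dphiN p lam 0; rewrite oppr0; lra.
by field; rewrite pn ln.
Qed.
End FixedLam.
End SolitonIntegrals.

Section SolitonLine.
Variables (R : realType) (p : R).
Hypotheses (p2 : 2 < p).
Implicit Types (t s r lam mu : R) (I : set R).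

(** The integral of phi'^2 over the line. By the first integral it is also E(phi) + lam / 2 times
    the mass, see [energy_phi]. *)
Definition action lam : R := 2 * (Num.sqrt lam * amp p lam ^+ 2 * wtot p).

Definition mass lam : R := (p + 2) / (p - 2) / lam * action lam.

(** The degree of [action] in [lam]: [amp ^+ 2] contributes [kap] and the square root contributes
    1/2. *)
Definition rexp : R := kap p + 2^-1.

Lemma integralT_even (f : R -> R) (c : R) : (forall x, 0 <= f x) -> continuous f ->
  (forall x, f (- x) = f x) ->
  (\int[leb]_(t in `[0%R, +oo[) (f t)%:E = c%:E -> \int[leb]_t (f t)%:E = (2 * c)%:E)%E.
Proof.
move=> f0 cf ev H; rewrite ge0_symfun_integralT//; last by move=> x /=; rewrite ev.
by rewrite -set_itvcy H.
Qed.

Lemma pge0 : 0 < p. Proof. exact: lt_trans p2. Qed.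

Lemma rexpE : 2 * rexp = (p + 2) / (p - 2).
Proof.
have pn : p - 2 != 0 by rewrite gt_eqF// subr_gt0.
have := kapE p2; rewrite /rexp => /(congr1 (fun x => x / (p - 2))); rewrite mulfK// => ->.
by field.
Qed.

Lemma action_powR lam : 0 < lam ->
  action lam = 2 * wtot p * (p / 2) `^ kap p * lam `^ rexp.
Proof.
move=> lam0; rewrite /action /rexp powRD; last by apply/implyP => _; rewrite gt_eqF.
rewrite powR12_sqrt ?ltW//.
have -> : amp p lam ^+ 2 = (p / 2) `^ kap p * lam `^ kap p.
  rewrite -powRM ?ltW// ?divr_gt0 ?pge0// -powR_mulrn ?ltW ?amp_gt0//.
  rewrite ampE -powRrM mulfVK//; congr (_ `^ _); ring.
ring.
Qed.

Lemma wtot_coef_gt0 : 0 < 2 * wtot p * (p / 2) `^ kap p.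
Proof. by rewrite !mulr_gt0 ?wtot_gt0// powR_gt0// divr_gt0 ?pge0. Qed.

Lemma action_gt0 lam : 0 < lam -> 0 < action lam.
Proof. by move=> l0; rewrite action_powR// mulr_gt0 ?wtot_coef_gt0// powR_gt0. Qed.

(** In other words [mass] is twice the derivative of [action], so that [action lam - lam / 2 * mu]
    is stationary where the mass is [mu]. *)
Lemma massE lam : 0 < lam -> mass lam = 2 * rexp * action lam / lam.
Proof. by move=> l0; rewrite /mass rexpE; ring. Qed.

Lemma rexp_gt1 : p < 6 -> 1 < rexp.
Proof.
move=> p6; have h : 0 < p - 2 by rewrite subr_gt0.
have := rexpE; have : 2 < (p + 2) / (p - 2) by rewrite ltr_pdivlMr//; lra.
lra.
Qed.

(** The mass is a multiple of lam^(rexp - 1), a power with positive exponent since p < 6, and is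
    inverted explicitly. *)
Lemma exists_mass mu : p < 6 -> 0 < mu -> exists2 lam, 0 < lam & mass lam = mu.
Proof.
move=> p6 mu0; have r1 := rexp_gt1 p6; have r0 : 0 < rexp by exact: lt_trans r1.
pose C := 2 * rexp * (2 * wtot p * (p / 2) `^ kap p).
have C0 : 0 < C by rewrite !mulr_gt0 ?wtot_gt0// powR_gt0// divr_gt0 ?pge0.
exists ((mu / C) `^ (rexp - 1)^-1); first by rewrite powR_gt0// divr_gt0.
set lam := _ `^ _; have l0 : 0 < lam by rewrite powR_gt0// divr_gt0.
rewrite massE// action_powR//.
have -> : lam `^ rexp = lam * lam `^ (rexp - 1).
  by rewrite mulr_powRB1 ?ltW.
have -> : lam `^ (rexp - 1) = mu / C.
  by rewrite /lam -powRrM mulVf ?powRr1 ?divr_ge0 ?ltW// gt_eqF// subr_gt0.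
rewrite -[RHS](@divfK _ C) ?gt_eqF// /C.
by field; rewrite !gt_eqF ?wtot_gt0// ?powR_gt0// ?divr_gt0 ?pge0.
Qed.

(** With x = lam / lam0 and [massE], this is the strict Bernoulli inequality for x^rexp. *)
Lemma action_min mu lam0 lam : p < 6 -> 0 < lam0 -> mass lam0 = mu -> 0 < lam ->
  lam != lam0 -> action lam0 - lam0 / 2 * mu < action lam - lam / 2 * mu.
Proof.
move=> p6 l0 <- l1 ll; rewrite massE//.
pose x := lam / lam0; have x0 : 0 < x by rewrite divr_gt0.
have x1 : x != 1.
  by apply: contra_neq ll => /(congr1 (fun z => z * lam0)); rewrite divfK ?gt_eqF// mul1r.
have E : lam = x * lam0 by rewrite divfK ?gt_eqF.
have -> : action lam = x `^ rexp * action lam0.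
  have e2 : lam `^ rexp = x `^ rexp * lam0 `^ rexp by rewrite {1}E powRM ?ltW.
  by rewrite (action_powR l1) (action_powR l0) e2; ring.
have h := powR_gt_affine (rexp_gt1 p6) x0 x1.
have a0 := action_gt0 l0.
have : (1 + rexp * (x - 1)) * action lam0 < x `^ rexp * action lam0 by rewrite ltr_pM2r.
have -> : lam0 / 2 * (2 * rexp * action lam0 / lam0) = rexp * action lam0.
  by field; rewrite gt_eqF.
have -> : lam / 2 * (2 * rexp * action lam0 / lam0) = x * (rexp * action lam0).
  by rewrite E; field; rewrite gt_eqF.
by move: (x `^ rexp) (action lam0) => A S; lra.
Qed.

Lemma exists_amp (M : R) : 0 < M -> exists2 lam, 0 < lam & amp p lam = M.
Proof.
move=> M0; exists (2 / p * M `^ (p - 2)).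
  by rewrite mulr_gt0 ?powR_gt0// divr_gt0// pge0.
rewrite ampE; have -> : p * (2 / p * M `^ (p - 2)) / 2 = M `^ (p - 2).
  by field; rewrite gt_eqF ?pge0.
by rewrite -powRrM mulrC mulrAC kapE// divff// powRr1// ltW.
Qed.

Section FixedLam.
Variable lam : R.
Hypothesis lam0 : 0 < lam.
Notation f := (phi p lam).
Notation df := (dphi p lam).

Let cf := @continuous_phi R p lam p2.
Let cdf := continuous_dphi p2 lam0.

Lemma integralT_phi2 : (\int[leb]_t (f t ^+ 2)%:E = (mass lam)%:E)%E.
Proof.
rewrite (integralT_even _ _ _ (integral_phi2 p2 lam0)).
- by congr EFin; rewrite /mass /action; ring.
- by move=> x; exact: sqr_ge0.
- by move=> x; under eq_fun do rewrite expr2; apply: cvgM; exact: cf.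
- by move=> x; rewrite phiN.
Qed.

Lemma integralT_dphi2 : (\int[leb]_t (df t ^+ 2)%:E = (action lam)%:E)%E.
Proof.
rewrite (integralT_even _ _ _ (integral_dphi2 p2 lam0)).
- by congr EFin; rewrite /action; ring.
- by move=> x; exact: sqr_ge0.
- by move=> x; under eq_fun do rewrite expr2; apply: cvgM; exact: cdf.
- by move=> x; rewrite dphiN sqrrN.
Qed.

Lemma L2T (g : R -> R) (c : R) : continuous g -> (\int[leb]_t (g t ^+ 2)%:E = c%:E)%E -> L2 setT g.
Proof.
move=> cg H; split; first exact: continuous_measurable_fun.
under eq_integral do rewrite real_normK ?num_real//.
by rewrite H ltry.
Qed.

Lemma L2_phi : L2 setT f. Proof. exact: L2T cf integralT_phi2. Qed.

Lemma L2_dphi : L2 setT df. Proof. exact: L2T cdf integralT_dphi2. Qed.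

Lemma phi_powp t : f t `^ p = p / 2 * (lam * f t ^+ 2 - df t ^+ 2).
Proof. by rewrite (dphi_sqr p2 lam0); field; rewrite gt_eqF ?pge0. Qed.

Lemma intg_phip : intg setT (fun t => f t `^ p).
Proof.
under eq_fun do rewrite phi_powp.
apply: intgZ => //; apply: intgB => //; last exact: L2_sq L2_dphi.
by apply: intgZ => //; exact: L2_sq L2_phi.
Qed.

Lemma RintegralT_phip : \int[leb]_t (f t `^ p) = p / 2 * (lam * mass lam - action lam).
Proof.
have i1 : intg setT (fun t => f t ^+ 2) by exact: L2_sq L2_phi.
have i2 : intg setT (fun t => df t ^+ 2) by exact: L2_sq L2_dphi.
have i3 : intg setT (fun t => lam * f t ^+ 2) by exact: intgZ.
under eq_Rintegral do rewrite phi_powp.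
rewrite RintegralZl//; last exact: intgB.
rewrite RintegralB// RintegralZl//; congr (_ * (_ * _ - _)).
  by rewrite /Rintegral integralT_phi2.
by rewrite /Rintegral integralT_dphi2.
Qed.

Lemma countable_bndT : countable ([set: R] `\` [set: R]°).
Proof. by rewrite interiorT setDv. Qed.

Lemma H1_phi : H1 setT f /\ \int[leb]_x (wderiv setT f x ^+ 2) = action lam.
Proof.
have [H E] := H1_C1 measurableT countable_bndT (is_derive_phi lam p2) cdf L2_phi L2_dphi.
by split=> //; rewrite E /Rintegral integralT_dphi2.
Qed.

Lemma H1_mass_phi : H1_mass_line (mass lam) f.
Proof.
split; [exact: cf|by case: H1_phi|].
by rewrite /Lpow Rintegral_powR2 /Rintegral integralT_phi2.
Qed.

Lemma energy_phi : energy_line p f = action lam - lam / 2 * mass lam.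
Proof.
rewrite /energy_line /Lpow Rintegral_powR2 H1_phi.2.
under [X in _ - _ * X]eq_Rintegral => x _ do rewrite gtr0_norm ?phi_gt0//.
by rewrite RintegralT_phip; field; rewrite gt_eqF ?pge0.
Qed.

End FixedLam.
End SolitonLine.

(** * Tails of functions on intervals *)

Section Tails.
Variable R : realType.
Implicit Types (h u v : R -> R) (I A B : set R) (a b x : R).

Lemma integral_Rintegral I h : measurable I -> intg I h ->
  (\int[leb]_(x in I) (h x)%:E = (\int[leb]_(x in I) h x)%:E)%E.
Proof. by move=> mI ih; rewrite /Rintegral fineK//; exact: integrable_fin_num. Qed.

Lemma le_Rintegral_subset A B h : measurable A -> measurable B -> A `<=` B -> intg B h ->
  (forall x, B x -> 0 <= h x) -> \int[leb]_(x in A) h x <= \int[leb]_(x in B) h x.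
Proof.
move=> mA mB AB iB h0; have iA := intgS mB mA AB iB.
apply: fine_le; [exact: integrable_fin_num|exact: integrable_fin_num|].
apply: ge0_subset_integral => //.
exact: measurable_int iB.
Qed.

Lemma cvg_Rintegral_bounded I h : measurable I -> intg I h -> (forall x, I x -> 0 <= h x) ->
  \int[leb]_(x in I `&` `[- n%:R, n%:R]) h x @[n --> \oo] --> \int[leb]_(x in I) h x.
Proof.
move=> mI ih h0.
pose F n : set R := I `&` `[- n%:R, n%:R].
have mF n : measurable (F n) by apply: measurableI => //; exact: measurable_itv.
have bigU : I = \bigcup_n F n.
  apply/seteqP; split=> [x Ix|x [n _ []//]].
  exists (Num.trunc `|x|).+1 => //; split => //=.
  by rewrite in_itv/= -ler_norml ltW// truncnS_gt.
have ihn n : intg (F n) h by apply: intgS ih => // x [].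
have H : (\int[leb]_(x in F n) (h x)%:E @[n --> \oo] -->
   \int[leb]_(x in \bigcup_n F n) (h x)%:E)%E.
  apply: (@ge0_nondecreasing_set_cvg_integral _ (measurableTypeR R) R F (EFin \o h) (@lebesgue_measure R)).
  - move=> m n mn; apply/subsetPset => x [Ix] /=; rewrite !in_itv/= -!ler_norml => xm; split => //=.
    by rewrite in_itv/= -ler_norml (le_trans xm)// ler_nat.
  - exact: mF.
  - by move=> n; exact: measurable_int (ihn n).
  - by move=> n x [/h0]; rewrite lee_fin.
by move: H; rewrite -bigU integral_Rintegral// => /fine_cvg.
Qed.

Lemma Rintegral_tail I h e : measurable I -> intg I h -> (forall x, I x -> 0 <= h x) -> 0 < e ->
  exists n : nat, forall A, measurable A -> A `<=` I -> (forall x, A x -> n%:R < `|x|) ->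
    \int[leb]_(x in A) h x <= e.
Proof.
move=> mI ih h0 e0.
have /cvgrPdist_le /(_ e e0) [n _ /(_ n (leqnn n)) /= H] := cvg_Rintegral_bounded mI ih h0.
exists n => A mA AI An; pose F : set R := I `&` `[- n%:R, n%:R].
have mF : measurable F by apply: measurableI => //; exact: measurable_itv.
have AFI : A `|` F `<=` I by move=> x [/AI|[]].
have mAF : measurable (A `|` F) by exact: measurableU.
have dAF : [disjoint A & F].
  apply/disj_setPS => x [/An xn [_ /=]]; rewrite in_itv/= -ler_norml.
  by rewrite leNgt xn.
have := le_Rintegral_subset mAF mI AFI ih h0.
rewrite Rintegral_setU//; last exact: intgS ih.
by move: H; rewrite ler_norml => /andP[_]; rewrite -/F; lra.
Qed.

(** Otherwise u^2 > e^2 on a set of infinite measure. *)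
Lemma L2_small I u (J : set R) e : measurable I -> measurable J -> J `<=` I -> leb J = +oo%E ->
  L2 I u -> 0 < e -> exists2 b, J b & `|u b| <= e.
Proof.
move=> mI mJ JI Joo Lu e0; apply: contrapT => H.
have big x : J x -> e < `|u x| by move=> Jx; rewrite ltNge; apply/negP => ux; apply: H; exists x.
have iu := L2_sq mJ (L2_subset mI mJ JI Lu).
have : intg J (fun=> e ^+ 2).
  apply: (@le_intg _ _ _ (fun x => u x ^+ 2)) => //.
  move=> x Jx; rewrite ger0_norm ?sqr_ge0// -(real_normK (num_real (u x))).
  by have := big x Jx; nra.
move=> /integrableP[_]; rewrite /= integral_cst//= Joo.
by rewrite gt0_muley ?ltxx// lte_fin normr_gt0 sqrf_eq0 gt_eqF.
Qed.

Lemma L2_small_right I u a e : measurable I -> `[a, +oo[ `<=` I -> L2 I u -> 0 < e ->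
  exists2 b, a <= b & `|u b| <= e.
Proof.
move=> mI aI Lu e0; have [|b] := L2_small mI (measurable_itv `[a, +oo[) aI _ Lu e0.
  by rewrite lebesgue_measure_itv/= ltry.
by rewrite /= in_itv/= andbT => ab ub; exists b.
Qed.

Lemma L2_small_left I u a e : measurable I -> `]-oo, a] `<=` I -> L2 I u -> 0 < e ->
  exists2 b, b <= a & `|u b| <= e.
Proof.
move=> mI aI Lu e0; have [|b] := L2_small mI (measurable_itv `]-oo, a]) aI _ Lu e0.
  by rewrite lebesgue_measure_itv/= ltNyr.
by rewrite /= in_itv/= => ab ub; exists b.
Qed.

Lemma H1_variation I u x y : measurable I -> H1 I u -> {within I, continuous u} ->
  x <= y -> `[x, y] `<=` I ->
  `| `|u y| - `|u x| | <= \int[leb]_(t in `[x, y]) `|wderiv I u t|.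
Proof.
move=> mI Hu cu; rewrite le_eqVlt => /orP[/eqP <- _|xy xyI].
  by rewrite subrr normr0; apply: Rintegral_ge0.
apply: le_trans (ler_dist_dist _ _) _.
have [Lv wd] := wderivP Hu.
rewrite -(weak_derivative_FTC Lv wd)//; apply: le_normr_Rintegral => //.
by apply: L2_intg; exact: L2_subset Lv.
Qed.

Lemma continuous_within_norm I u : {within I, continuous u} -> {within I, continuous (fun x => `|u x|)}.
Proof. by move=> cu x; apply: cvg_norm; exact: cu. Qed.

Lemma H1_chain I u (f df : R -> R) a b : measurable I -> H1 I u -> {within I, continuous u} ->
  a <= b -> `[a, b] `<=` I ->
  (forall s : R, 0 <= s -> is_derive s (1 : R) f (df s)) -> continuous df ->
  `|f `|u b| - f `|u a| | <= \int[leb]_(t in `[a, b]) (`|df `|u t| | * `|wderiv I u t|).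
Proof.
move=> mI Hu cu ab abI dF cdf.
have [Lv _] := wderivP Hu.
have iv : intg `[a, b] (wderiv I u) by apply: L2_intg; exact: L2_subset Lv.
apply: (@chain_variation R a b (fun x => `|u x|) (fun t => `|wderiv I u t|) f df) => //.
- exact: intg_norm.
- by apply: continuous_within_norm; exact: continuous_subspaceW cu.
- move=> x y ax xy yb; apply: H1_variation => // z /=; rewrite in_itv/= => /andP[xz zy].
  by apply: abI; rewrite /= in_itv/= (le_trans ax)//= (le_trans zy).
Qed.

(** The variation of u^2 is bounded by the integral of 2 |u u'|, whose tail is small; compare with a
    far point where |u| <= m / 2. Both ends are treated under an inclusion hypothesis, to serve
    half-lines and the line alike. *)
Lemma H1_vanishing I u (m : R) : measurable I -> H1 I u -> {within I, continuous u} -> 0 < m ->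
  exists2 T, 0 < T & (forall x, T <= x -> `[x, +oo[ `<=` I -> `|u x| <= m) /\
    (forall x, x <= - T -> `]-oo, x] `<=` I -> `|u x| <= m).
Proof.
move=> mI Hu cu m0.
have [Lv _] := wderivP Hu; have [Lu _] := Hu.
pose h t := `|2 * `|u t| | * `|wderiv I u t|.
have ih : intg I h.
  have : intg I (fun t => 2 * `|u t * wderiv I u t|).
    by apply: intgZ => //; apply: intg_norm; exact: L2_mul.
  by apply: eq_intg => // t _; rewrite /h !normrM normr_id (ger0_norm (x := 2))// mulrA.
have h0 t : I t -> 0 <= h t by move=> _; rewrite mulr_ge0.
have e0 : 0 < m ^+ 2 / 2 by rewrite divr_gt0// exprn_gt0.
have [n Hn] := Rintegral_tail mI ih h0 e0.
have dsq (s : R) : 0 <= s -> is_derive s (1 : R) (fun s : R => s ^+ 2) (2 * s).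
  by move=> _; apply: is_derive_eq; rewrite /GRing.scale/=; ring.
have csq : continuous (fun s : R => 2 * s).
  by move=> s; apply: cvgM; [exact: cvg_cst|exact: cvg_id].
have m20 : 0 < m / 2 by exact: divr_gt0.
have est a b : a <= b -> `[a, b] `<=` I -> (forall x, `[a, b]%classic x -> n%:R < `|x|) ->
    `| `|u b| ^+ 2 - `|u a| ^+ 2 | <= m ^+ 2 / 2.
  move=> ab abI abn; have mab : measurable `[a, b] by exact: measurable_itv.
  exact: le_trans (H1_chain mI Hu cu ab abI dsq csq) (Hn _ mab abI abn).
have n1 : 0 < n%:R + 1 :> R by rewrite ltr_wpDl.
(* The sum m^2 / 4 + m^2 / 2 is still below m^2. *)
have sqb (s t : R) : 0 <= s -> s <= m / 2 -> t ^+ 2 - s ^+ 2 <= m ^+ 2 / 2 -> t <= m.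
  by move=> s0 sm ts; rewrite leNgt; apply/negP => mt; nra.
exists (n%:R + 1) => //; split=> x xn xI.
  have [b xb ub] := L2_small_right mI xI Lu m20.
  have /est : `[x, b] `<=` I.
    by apply: subset_trans xI => z /=; rewrite !in_itv/= andbT => /andP[].
  move=> /(_ xb) H; have : `| `|u b| ^+ 2 - `|u x| ^+ 2| <= m ^+ 2 / 2.
    apply: H => z /=; rewrite in_itv/= => /andP[xz _].
    by rewrite ger0_norm; lra.
  by rewrite ler_norml => /andP[i3 _]; apply: (sqb _ _ (normr_ge0 (u b)) ub); lra.
have [b xb ub] := L2_small_left mI xI Lu m20.
have /est : `[b, x] `<=` I.
  by apply: subset_trans xI => z /=; rewrite !in_itv/= => /andP[].
move=> /(_ xb) H; have : `| `|u x| ^+ 2 - `|u b| ^+ 2| <= m ^+ 2 / 2.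
  apply: H => z /=; rewrite in_itv/= => /andP[_ zx].
  by rewrite ler0_norm; lra.
by rewrite ler_norml => /andP[_ i3]; apply: (sqb _ _ (normr_ge0 (u b)) ub); lra.
Qed.

(** Beyond some T, |u| is at most its value at a point x1 where u does not vanish, so a maximum over
    [0, max T x1] is global. *)
Lemma H1_max_itvy u : H1 `[0, +oo[ u -> {within `[0, +oo[, continuous u} ->
  exists2 xi, 0 <= xi & forall x, 0 <= x -> `|u x| <= `|u xi|.
Proof.
move=> Hu cu.
have [[x1 x10 ux1]|none] := pselect (exists2 x, 0 <= x & u x != 0); last first.
  exists 0 => // x x0; suff -> : u x = 0 by rewrite normr0.
  by apply/eqP/negP => ux; apply: none; exists x => //; exact/negP.
have mI : measurable `[0 : R, +oo[ by exact: measurable_itv.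
have m0 : 0 < `|u x1| by rewrite normr_gt0.
have [T T0 [HT _]] := H1_vanishing mI Hu cu m0.
have T1 : 0 <= Num.max T x1 by rewrite le_max ltW.
have [|xi xiT Hxi] := @EVT_max R (fun x => `|u x|) 0 (Num.max T x1) T1.
  apply: continuous_within_norm; apply: continuous_subspaceW cu.
  by move=> z /=; rewrite !in_itv/= andbT => /andP[].
exists xi; first by move: xiT; rewrite in_itv/= => /andP[].
move=> x x0; have [xT|/ltW xT] := leP x (Num.max T x1).
  by apply: Hxi; rewrite in_itv/= x0.
apply: (@le_trans _ _ `|u x1|).
  apply: HT; first by apply: le_trans xT; rewrite le_max lexx.
  by move=> z /=; rewrite !in_itv/= !andbT; exact: le_trans.
by apply: Hxi; rewrite in_itv/= x10 le_max lexx orbT.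
Qed.

Lemma H1_max_line u : H1 setT u -> continuous u ->
  exists xi, forall x, `|u x| <= `|u xi|.
Proof.
move=> Hu cu.
have [[x1 ux1]|none] := pselect (exists x, u x != 0); last first.
  exists 0 => x; suff -> : u x = 0 by rewrite normr0.
  by apply/eqP/negP => ux; apply: none; exists x; exact/negP.
have m0 : 0 < `|u x1| by rewrite normr_gt0.
have cu' : {within setT, continuous u} by exact: continuous_subspaceT.
have [T T0 [HT1 HT2]] := H1_vanishing measurableT Hu cu' m0.
pose S := Num.max T `|x1|.
have S1 : - S <= S by have : 0 <= S; [rewrite le_max ltW|lra].
have [|xi xiT Hxi] := @EVT_max R (fun x => `|u x|) (- S) S S1.
  by apply: continuous_within_norm; exact: continuous_subspaceT.
have x1S : `|x1| <= S by rewrite le_max lexx orbT.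
have TS : T <= S by rewrite le_max lexx.
exists xi => x; have [xS|Sx] := leP `|x| S.
  by apply: Hxi; rewrite in_itv/= -ler_norml.
apply: (@le_trans _ _ `|u x1|); last by apply: Hxi; rewrite in_itv/= -ler_norml.
have [x0|x0] := leP 0 x.
  by apply: HT1 => //; move: Sx; rewrite ger0_norm//; lra.
by apply: HT2 => //; move: Sx; rewrite ltr0_norm//; lra.
Qed.

End Tails.

(** * Calibration *)

Section Calibration.
Variables (R : realType) (p lam : R).
Hypotheses (p2 : 2 < p) (lam0 : 0 < lam).
Implicit Types (u v : R -> R) (I : set R) (a b x s : R).
Let M := amp p lam.
Let M0 : 0 < M := amp_gt0 p2 lam0.

(* [slope s] is the value of [|phi'|] where [phi = s], and [calib] is its primitive. *)
Definition slope s : R := Num.sqrt lam * amp p lam * gprof p (s / amp p lam).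
Definition calib s : R :=
  Num.sqrt lam * amp p lam ^+ 2 * (prim (gprof p) (s / amp p lam) - prim (gprof p) 0).

Lemma continuous_slope : continuous slope.
Proof.
move=> s; apply: cvgM; first exact: cvg_cst.
apply: (@continuous_comp R R R (fun s => s / amp p lam) (gprof p)); last exact: continuous_gprof.
by apply: cvgM; [exact: cvg_id|exact: cvg_cst].
Qed.

Lemma is_derive_calib s : 0 <= s -> is_derive s (1 : R) calib (slope s).
Proof.
move=> s0.
have dq : is_derive s (1 : R) (fun s => s / M) M^-1.
  by apply: is_derive_eq; rewrite /GRing.scale/= ?mulr0 ?add0r ?mulr1.
have q0 : 0 <= s / M by rewrite divr_ge0// ltW.
have dW := is_derive_prim (continuous_gprof p2) q0.
have dc := @is_derive1_comp R (prim (gprof p)) (fun s => s / M) s _ _ dW dq.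
have H := is_deriveZ (Num.sqrt lam * M ^+ 2) (is_deriveB dc (is_derive_cst (prim (gprof p) 0) s 1)).
apply: (is_derive_eq H); rewrite /GRing.scale/= /slope -/M.
by field; rewrite gt_eqF.
Qed.

Lemma slope_ge0 s : 0 <= s -> 0 <= slope s.
Proof.
move=> s0; rewrite /slope -/M; apply: mulr_ge0; first by apply: mulr_ge0; [exact: sqrtr_ge0|exact: ltW].
by apply: gprof_ge0; rewrite divr_ge0// ltW.
Qed.

Lemma slope_le s : 0 <= s -> slope s <= Num.sqrt lam * s.
Proof.
move=> s0; rewrite /slope -/M /gprof; set Q := Num.sqrt (1 - _).
have Q1 : Q <= 1 by rewrite -[leRHS]sqrtr1 ler_wsqrtr// gerBl powR_ge0.
have -> : Num.sqrt lam * M * (s / M * Q) = Num.sqrt lam * s * Q by field; rewrite gt_eqF.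
by rewrite ler_piMr// mulr_ge0// sqrtr_ge0.
Qed.

(** The first integral for an arbitrary height s. The bound by the amplitude keeps the radicand in
    [gprof] nonnegative; this is why the amplitude is matched with the maximum of |u|. *)
Lemma slope_sqr s : 0 <= s -> s <= M -> slope s ^+ 2 = lam * s ^+ 2 - 2 / p * s `^ p.
Proof.
move=> s0 sM; have q0 : 0 <= s / M by rewrite divr_ge0// ltW.
have q1 : s / M <= 1 by rewrite ler_pdivrMr// mul1r.
have E : s `^ p = s ^+ 2 * ((s / M) `^ (p - 2) * (p * lam / 2)).
  have -> : (s / M) `^ (p - 2) * (p * lam / 2) = s `^ (p - 2).
    by rewrite -(amp_pow p2 lam0) -powRM ?divfK ?gt_eqF//; exact: ltW.
  have [->|sn] := eqVneq s 0; first by rewrite expr2 !mul0r powR0// gt_eqF// (lt_trans _ p2).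
  transitivity (s `^ (2%:R + (p - 2))); first by congr (_ `^ _); ring.
  by rewrite (@powRD _ s 2%:R) ?sn ?implybT// powR_mulrn.
rewrite E /slope -/M /gprof (ger0_norm q0); set B := _ `^ (p - 2).
have B1 : 0 <= 1 - B.
  rewrite subr_ge0 /B; have : (s / M) `^ (p - 2) <= 1 `^ (p - 2).
    by apply: ge0_ler_powR; rewrite ?nnegrE// subr_ge0 ltW.
  by rewrite powR1.
rewrite !exprMn (sqr_sqrtr B1) (sqr_sqrtr (ltW lam0)).
by field; rewrite !gt_eqF// (lt_trans _ p2).
Qed.

Lemma calib0 : calib 0 = 0.
Proof. by rewrite /calib mul0r subrr mulr0. Qed.

(** One half, since [action] counts both the rise and the fall of the soliton. *)
Lemma calib_amp : calib M = action p lam / 2.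
Proof. by rewrite /calib -/M divff ?gt_eqF// /action /wtot -/M; field. Qed.

Lemma calib_le s t : 0 <= s -> s <= t -> calib s <= calib t.
Proof.
move=> s0 st; have dF (r : R) : s <= r <= t -> is_derive r (1 : R) calib (slope r).
  by move=> /andP[sr _]; apply: is_derive_calib; exact: le_trans sr.
have [r|c cst E] := @MVT_segment R calib slope s t st _ (is_derive_within dF).
  by rewrite in_itv/= => /andP[sr rt]; apply: dF; rewrite !ltW.
rewrite -subr_ge0 E mulr_ge0 ?subr_ge0// slope_ge0//.
by move: cst; rewrite in_itv/= => /andP[sc _]; exact: le_trans sc.
Qed.

Lemma calib_ge0 s : 0 <= s -> 0 <= calib s.
Proof. by move=> s0; rewrite -calib0; exact: calib_le. Qed.

Lemma calib_small e : 0 < e -> exists2 d, 0 < d & forall s, 0 <= s -> s <= d -> calib s <= e.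
Proof.
move=> e0; have c0 : calib s @[s --> 0] --> calib 0.
  apply: differentiable_continuous; apply/derivable1_diffP.
  by have := is_derive_calib (lexx 0) => ?; exact: ex_derive.
move: c0 => /cvgrPdist_le /(_ e e0) /nbhs_ballP[d d0 Hd].
exists (d / 2); first exact: divr_gt0.
move=> s s0 sd; have := Hd s; rewrite /ball/= calib0 !sub0r !normrN ger0_norm// => H.
apply: le_trans (ler_norm _) (H _); move: (d0) => /= d0'; lra.
Qed.

Lemma measurable_slope I u : measurable I -> measurable_fun I u -> measurable_fun I (fun x => slope `|u x|).
Proof.
move=> mI mu; apply: (@measurableT_comp _ _ _ _ _ _ slope).
  by apply: continuous_measurable_fun; exact: continuous_slope.
exact: measurableT_comp.
Qed.

Section Edge.
Variables (I : set R) (u : R -> R).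
Hypotheses (mI : measurable I) (Hu : H1 I u) (cu : {within I, continuous u})
  (uM : forall x, I x -> `|u x| <= M).
Let v := wderiv I u.
Let Lu : L2 I u. Proof. by case: Hu. Qed.
Let Lv : L2 I v. Proof. by case: (wderivP Hu). Qed.

(** As p > 2 and |u| is bounded, |u|^p is at most a constant times u^2. *)
Lemma intg_powp : intg I (fun x => `|u x| `^ p).
Proof.
have iu := L2_sq mI Lu; have [mu _] := Lu.
apply: (@le_intg _ _ _ (fun x => M `^ (p - 2) * u x ^+ 2)) => //; last exact: intgZ.
  apply: (@measurableT_comp _ _ _ _ _ _ (fun x => x `^ p)); first exact: measurable_powR.
  exact: measurableT_comp.
move=> x Ix; rewrite ger0_norm ?powR_ge0// -(real_normK (num_real (u x))).
move: (uM Ix) (normr_ge0 (u x)); move: `|u x| => s sM s0.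
have [->|sn] := eqVneq s 0; first by rewrite expr2 !mulr0 powR0// gt_eqF// (lt_trans _ p2).
have -> : s `^ p = s `^ (p - 2 + 2%:R) by congr (_ `^ _); ring.
rewrite (@powRD _ s (p - 2)) ?sn ?implybT// powR_mulrn// ler_wpM2r ?sqr_ge0//.
by apply: ge0_ler_powR; rewrite ?nnegrE// ?subr_ge0 ltW.
Qed.

Lemma L2_slope : L2 I (fun x => slope `|u x|).
Proof.
have [mu _] := Lu; split; first exact: measurable_slope.
have iu : intg I (fun x => lam * u x ^+ 2) by apply: intgZ => //; exact: L2_sq.
move: iu => /(le_intg mI (f := fun x => `|slope `|u x| | ^+ 2)).
case/(_ _ _)/integrableP => [||_].
- by apply: measurable_funX; apply: measurableT_comp => //; exact: measurable_slope.
- move=> x Ix; rewrite ger0_norm ?sqr_ge0// real_normK ?num_real//.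
  have := slope_le (normr_ge0 (u x)); have := slope_ge0 (normr_ge0 (u x)).
  rewrite -(real_normK (num_real (u x))) => h1 h2.
  rewrite -[X in _ <= X * _](sqrt_lam2 lam0) -exprMn.
  by rewrite ler_pXn2r ?nnegrE// (le_trans h1 h2).
apply: le_lt_trans; rewrite le_eqVlt; apply/orP; left; apply/eqP.
by apply: eq_integral => x _; rewrite gee0_abs// lee_fin sqr_ge0.
Qed.

(** [Jint] bounds the variation of [calib |u|] on the edge, and [Act] is the contribution of the
    edge to the energy plus [lam / 2] times the mass; their integrands differ by half a square. *)
Definition Jint : R := \int[leb]_(x in I) (`|slope `|u x| | * `|v x|).
Definition Act : R := \int[leb]_(x in I) (2^-1 * v x ^+ 2 + 2^-1 * slope `|u x| ^+ 2).

Lemma intg_J : intg I (fun x => `|slope `|u x| | * `|v x|).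
Proof.
have : intg I (fun x => `|slope `|u x| * v x|) by apply: intg_norm; apply: L2_mul => //; exact: L2_slope.
by apply: eq_intg => // x _; rewrite normrM.
Qed.

Lemma intg_Act : intg I (fun x => 2^-1 * v x ^+ 2 + 2^-1 * slope `|u x| ^+ 2).
Proof.
by apply: intgD => //; apply: intgZ => //; apply: L2_sq => //; exact: L2_slope.
Qed.

Lemma Jint_ge0 : 0 <= Jint.
Proof. by apply: Rintegral_ge0 => x _; rewrite mulr_ge0. Qed.

Lemma Jint_le_Act : Jint <= Act.
Proof.
apply: le_Rintegral => //; [exact: intg_J|exact: intg_Act|move=> x _].
rewrite -(real_normK (num_real (v x))) -(real_normK (num_real (slope _))).
by have := sqr_ge0 (`|v x| - `|slope `|u x| |); nra.
Qed.

(** By [slope_sqr], half the square of [slope |u|] consists of the mass and potential terms. *)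
Lemma ActE : Act = 2^-1 * Lpow 2 I v + lam / 2 * Lpow 2 I u - p^-1 * Lpow p I u.
Proof.
have iv := L2_sq mI Lv; have iu := L2_sq mI Lu; have ip := intg_powp.
rewrite /Lpow !Rintegral_powR2.
transitivity (\int[leb]_(x in I) (2^-1 * v x ^+ 2 + (lam / 2 * u x ^+ 2 - p^-1 * `|u x| `^ p))).
  apply: eq_Rintegral => x /set_mem Ix; rewrite slope_sqr ?uM//.
  by rewrite real_normK ?num_real//; field; rewrite gt_eqF// (lt_trans _ p2).
rewrite RintegralD//; last 2 first.
- exact: intgZ.
- by apply: intgB => //; exact: intgZ.
by rewrite RintegralB//; try exact: intgZ; rewrite !RintegralZl// addrA.
Qed.

(** The difference of the integrands is half the square of |u'| - slope |u|, and its integral is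
    0. *)
Lemma Act_eq_J : Act = Jint -> {ae leb, forall x, I x -> `|v x| = slope `|u x|}.
Proof.
move=> E.
pose h x := 2^-1 * (`|v x| - slope `|u x|) ^+ 2.
have hE x : h x = 2^-1 * v x ^+ 2 + 2^-1 * slope `|u x| ^+ 2 - `|slope `|u x| | * `|v x|.
  rewrite /h -(real_normK (num_real (v x))) (ger0_norm (slope_ge0 (normr_ge0 (u x)))); lra.
have ih : intg I h by apply: eq_intg (intgB mI intg_Act intg_J) => // x _; rewrite hE.
have h0 : \int[leb]_(x in I) h x = 0.
  transitivity (Act - Jint); last by rewrite E subrr.
  rewrite -RintegralB//; [|exact: intg_Act|exact: intg_J].
  by apply: eq_Rintegral => x _; rewrite hE.
have : (\int[leb]_(x in I) `|(h x)%:E| = 0)%E.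
  transitivity (\int[leb]_(x in I) (h x)%:E)%E.
    by apply: eq_integral => x _; rewrite gee0_abs// lee_fin mulr_ge0 ?sqr_ge0.
  by rewrite integral_Rintegral// h0.
have mh : measurable_fun I (EFin \o h) by exact: measurable_int ih.
move=> /(@ae_eq_integral_abs _ _ _ leb I mI (EFin \o h) mh).1.
have ae_f := ae_filter_ringOfSetsType (@lebesgue_measure R).
apply: filterS => x H Ix; have [/eqP] : (h x)%:E = 0%:E by exact: H.
by rewrite /h mulf_eq0 invr_eq0 pnatr_eq0/= sqrf_eq0 subr_eq0 => /eqP.
Qed.

Lemma calib_itv a b : a <= b -> `[a, b] `<=` I ->
  `|calib `|u b| - calib `|u a| | <= \int[leb]_(x in `[a, b]) (`|slope `|u x| | * `|v x|).
Proof.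
by move=> ab abI; exact: (H1_chain mI Hu cu ab abI is_derive_calib continuous_slope).
Qed.

(** Splitting at x counts the rise and the fall separately; x will be a maximum point. *)
Lemma calib_J2 a x b : a <= x -> x <= b -> `[a, b] `<=` I ->
  `|calib `|u x| - calib `|u a| | + `|calib `|u b| - calib `|u x| | <= Jint.
Proof.
move=> ax xb abI.
have axI : `[a, x] `<=` I.
  by apply: subset_trans abI => z /=; rewrite !in_itv/= => /andP[-> /le_trans]; exact.
have xbI : `[x, b] `<=` I.
  by apply: subset_trans abI => z /=; rewrite !in_itv/= => /andP[/(le_trans ax) -> ->].
have mab : measurable `[a, b] by exact: measurable_itv.
have iab := intgS mI mab abI intg_J.
apply: (@le_trans _ _ (\int[leb]_(x in `[a, b]) (`|slope `|u x| | * `|v x|))); last first.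
  by apply: le_Rintegral_subset => //; exact: intg_J.
by rewrite (Rintegral_split iab ax xb); apply: lerD; exact: calib_itv.
Qed.

Lemma calib_J a b : a <= b -> `[a, b] `<=` I -> `|calib `|u b| - calib `|u a| | <= Jint.
Proof. by move=> ab /(calib_J2 (lexx a) ab); rewrite subrr normr0 add0r. Qed.

(** The last term is the fall from x to infinity: apply [calib_J2] with a far point b where |u| is
    small. *)
Lemma calib_Jy a x : a <= x -> `[a, +oo[ `<=` I ->
  `|calib `|u x| - calib `|u a| | + calib `|u x| <= Jint.
Proof.
move=> ax aI; apply/ler_addgt0Pr => e e0; have [d d0 Hd] := calib_small e0.
have [|b xb ub] := @L2_small_right R I u x d mI _ Lu d0.
  by apply: subset_trans aI => z /=; rewrite !in_itv/= !andbT; exact: le_trans.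
have := @calib_J2 a x b ax xb _; have := Hd _ (normr_ge0 _) ub.
have := ler_norm (calib `|u x| - calib `|u b|); rewrite (distrC (calib `|u x|) (calib `|u b|)) => h1 h2 /(_ _) h3.
have : `[a, b] `<=` I by apply: subset_trans aI => z /=; rewrite !in_itv/= andbT => /andP[].
by move=> /h3; lra.
Qed.

End Edge.
End Calibration.

(** * The minimum of the energy on the line *)

Section LineBound.
Variables (R : realType) (p mu lam : R).
Hypotheses (p2 : 2 < p) (p6 : p < 6) (mu0 : 0 < mu) (lam0 : 0 < lam) (Hlam : mass p lam = mu).

Lemma Lpow0 (I : set R) (u : R -> R) : (forall x, I x -> u x = 0) -> Lpow 2 I u = 0.
Proof.
move=> u0; rewrite /Lpow Rintegral_powR2 -[RHS](mul0r (fine (leb I))) /Rintegral.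
rewrite (_ : (\int[leb]_(x in I) _)%E = 0%E) ?mul0r//.
apply: integral0_eq => x Ix.
by rewrite u0// expr0n.
Qed.

(** The rise to the maximum and the fall from it each contribute [calib] of the amplitude, in total
    [action p l] for the frequency [l] with this amplitude; [action_min] then compares [l] with
    [lam]. *)
Lemma energy_line_ge psi : H1_mass_line mu psi ->
  action p lam - lam / 2 * mu <= energy_line p psi.
Proof.
move=> [cpsi Hpsi Lpsi]; have [xi Hxi] := H1_max_line Hpsi cpsi.
have M0 : 0 < `|psi xi|.
  rewrite lt0r normr_ge0 andbT; apply/eqP => E.
  suff : mu = 0 by move/eqP; rewrite gt_eqF.
  rewrite -Lpsi Lpow0// => x _; apply/eqP; rewrite -normr_le0 -E; exact: Hxi.
have [l l0 El] := exists_amp p2 M0.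
have uM x : setT x -> `|psi x| <= amp p l by move=> _; rewrite El.
have cu : {within setT, continuous psi} by exact: continuous_subspaceT.
have J : action p l <= Jint p l setT psi.
  apply/ler_addgt0Pr => e e0; have [d d0 Hd] := calib_small p2 l0 (divr_gt0 e0 (ltr0Sn R 1)).
  have [Lu _] := Hpsi.
  have [a ax ua] := @L2_small_left R setT psi xi d measurableT (@subsetT _ _) Lu d0.
  have [b xb ub] := @L2_small_right R setT psi xi d measurableT (@subsetT _ _) Lu d0.
  have := calib_J2 p2 l0 measurableT Hpsi cu ax xb (@subsetT _ _).
  have := Hd _ (normr_ge0 _) ua; have := Hd _ (normr_ge0 _) ub.
  rewrite -El (calib_amp p2 l0).
  have := ler_norm (action p l / 2 - calib p l `|psi a|).
  have := ler_norm (action p l / 2 - calib p l `|psi b|).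
  rewrite (distrC (action p l / 2) (calib p l `|psi b|)); lra.
have := le_trans J (Jint_le_Act p2 l0 measurableT Hpsi).
rewrite (ActE p2 l0 measurableT Hpsi uM) Lpsi => A.
have B : action p lam - lam / 2 * mu <= action p l - l / 2 * mu.
  have [->//|ll] := eqVneq lam l.
  by apply: ltW; apply: action_min => //; rewrite eq_sym.
by apply: le_trans B _; rewrite lerBlDr /energy_line addrAC.
Qed.

Lemma phi_minimizer : minimizer_line p mu (phi p lam).
Proof.
split; first by rewrite -Hlam; exact: H1_mass_phi.
by move=> psi /energy_line_ge; rewrite energy_phi// Hlam.
Qed.

(** [soliton] is defined by choice; [phi] shows that a suitable function exists, and as both are
    minimizers their energies agree. *)
Lemma soliton_minimizer : minimizer_line p mu (soliton p mu) /\
  energy_line p (soliton p mu) = action p lam - lam / 2 * mu.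
Proof.
have : exists f, [/\ minimizer_line p mu f, forall x, 0 < f x & forall x, f (- x) = f x].
  by exists (phi p lam); split; [exact: phi_minimizer|exact: phi_gt0|exact: phiN].
move=> /(@xgetPex _ (fun=> 0)) [sm _ _]; split => //.
have [pm1 pm2] := phi_minimizer; have [sm1 sm2] := sm.
apply/eqP; rewrite eq_le; apply/andP; split.
  by have := sm2 _ pm1; rewrite energy_phi// Hlam.
exact: energy_line_ge.
Qed.

End LineBound.

(** * Edge-disjoint rays *)

Section Rays.
Variables (R : realType) (G : graph R).
Implicit Types (v w z a b : vertex G) (e f : edge G) (o : edge G * bool)
  (l P Q : seq (edge G * bool)).

Definition tailv o : vertex G := if o.2 then src o.1 else tgt o.1.
Definition headv o : vertex G := if o.2 then tgt o.1 else src o.1.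

(* [ray v l]: the oriented edges of [l] lead from [v] to a vertex at infinity,
   stopping as soon as one is met. *)
Fixpoint ray v l : bool :=
  if l is o :: l' then [&& ~~ at_infinity v, tailv o == v & ray (headv o) l'] else at_infinity v.

Definition edges l : seq (edge G) := map fst l.

Fixpoint verts v l : seq (vertex G) := if l is o :: l' then v :: verts (headv o) l' else [:: v].

Lemma verts_head v l : v \in verts v l.
Proof. by case: l => [|o l] /=; rewrite in_cons eqxx. Qed.

Lemma edges_verts v l o : ray v l -> o.1 \in edges l -> tailv o \in verts v l.
Proof.
elim: l v => //= o' l IH v /and3P[_ /eqP tv rl]; rewrite !in_cons => /orP[/eqP oo|el].
  have [->|->] : tailv o = tailv o' \/ tailv o = headv o'.
    by rewrite /tailv /headv oo; case: (o.2); case: (o'.2); [left|right|right|left].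
    by rewrite tv eqxx.
  by rewrite verts_head orbT.
by rewrite (IH _ rl el) orbT.
Qed.

Lemma ray_suffix v l z : ray v l -> z \in verts v l ->
  exists l1 l2, [/\ l = l1 ++ l2, ray z l2 & exists vs, verts v l = vs ++ verts z l2].
Proof.
move=> rl zl; elim: l v rl zl => [|o l IH] v /=.
  by rewrite inE => vi /eqP ->; exists [::], [::]; split => //; exists [::].
move=> /and3P[vi tv rl]; rewrite in_cons => /orP[/eqP ->|zl].
  by exists [::], (o :: l); split; [|rewrite /= vi tv rl|exists [::]].
have [l1 [l2 [El rl2 [vs E]]]] := IH _ rl zl.
by exists (o :: l1), l2; split => //; [rewrite El|exists (v :: vs); rewrite E].
Qed.

(** Loop erasure: if v recurs on the shortened remainder, keep only the part from that occurrence
    on. *)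
Lemma ray_shorten v l : ray v l ->
  exists l', [/\ ray v l', uniq (verts v l') & {subset edges l' <= edges l}].
Proof.
elim: l v => [|o l IH] v /=; first by move=> vi; exists [::].
move=> /and3P[vi tv rl]; have [l' [rl' ul' sl']] := IH _ rl.
have [vl'|vl'] := boolP (v \in verts (headv o) l'); last first.
  exists (o :: l'); rewrite /= vi tv rl' vl' ul'; split => // e.
  by rewrite !in_cons => /orP[->//|/sl' ->]; rewrite orbT.
have [l1 [l2 [E rl2 [vs Evs]]]] := ray_suffix rl' vl'.
exists l2; split => //; first by move: ul'; rewrite Evs cat_uniq => /and3P[].
by move=> e el; rewrite in_cons sl' ?orbT// E /edges map_cat mem_cat el orbT.
Qed.

(** A later use of the same edge, in either direction, would visit the tail of its first use
    again. *)
Lemma uniq_edges v l : ray v l -> uniq (verts v l) -> uniq (edges l).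
Proof.
elim: l v => //= o l IH v /and3P[_ /eqP tv rl] /andP[vl ul]; rewrite (IH _ rl ul) andbT.
by apply: contra vl => ol; rewrite -tv; exact: edges_verts rl ol.
Qed.

Lemma joinedP (A : pred (edge G)) v w : joined A v w ->
  exists o, [/\ o.1 \in A, tailv o = v & headv o = w].
Proof.
move=> /existsP[e /andP[eA /orP[]/andP[/eqP sv /eqP tw]]].
  by exists (e, true).
by exists (e, false).
Qed.

Lemma connect_ray (A : pred (edge G)) v w : at_infinity w -> connect (joined A) v w ->
  exists2 l, ray v l & {subset edges l <= A}.
Proof.
move=> wi /connectP[s]; elim: s v => [|x s IH] v /=; first by move=> _ <-; exists [::].
move=> /andP[vx xs] wE; have [vi|vi] := boolP (at_infinity v); first by exists [::].
have [k [kA tv hx]] := joinedP vx; have [l rl lA] := IH _ xs wE.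
exists (k :: l); first by rewrite /= vi tv eqxx hx.
by move=> e; rewrite /= in_cons => /orP[/eqP ->//|/lA].
Qed.

Definition flip o := (o.1, ~~ o.2).

Lemma tailv_flip o : tailv (flip o) = headv o.
Proof. by rewrite /tailv /headv /=; case: o.2. Qed.

Lemma headv_flip o : headv (flip o) = tailv o.
Proof. by rewrite /tailv /headv /=; case: o.2. Qed.

(** Two edge-disjoint rays from v, each without repeated vertices. At a vertex at infinity both are
    empty. *)
Definition twin v := exists P Q, [/\ ray v P, ray v Q, uniq (edges P ++ edges Q),
  uniq (verts v P) & uniq (verts v Q)].

Lemma uniq_sub_cat (T : eqType) (s1 s2 t1 t2 : seq T) : uniq (s1 ++ s2) ->
  uniq t1 -> uniq t2 -> {subset t1 <= s1} -> {subset t2 <= s2} -> uniq (t1 ++ t2).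
Proof.
rewrite !cat_uniq => /and3P[_ /hasPn H _] -> -> S1 S2; rewrite andbT /=.
by apply/hasPn => x /S2/H; apply: contra => /S1.
Qed.

(** Follow l from b until it meets P or Q, or reaches infinity. If it meets one of them, it
    continues along that ray while a keeps the other. The last clause records where the edges come
    from, which keeps the induction disjoint. *)
Lemma twin_attach a P Q e b l : ray a P -> ray a Q -> uniq (edges P ++ edges Q) ->
  e \notin edges P -> e \notin edges Q -> ray b l -> uniq (edges l) -> e \notin edges l ->
  exists Pa Pb, [/\ ray a Pa, ray b Pb, uniq (e :: edges Pa ++ edges Pb) &
    {subset edges Pa ++ edges Pb <= edges l ++ (edges P ++ edges Q)}].
Proof.
move=> rP rQ uPQ eP eQ; elim: l b => [|o l IH] b /=.
  move=> bi _ _; exists P, [::]; rewrite cats0 eP; split => //.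
    by move: uPQ; rewrite cat_uniq => /and3P[].
  by move=> x; rewrite mem_cat => ->.
move=> /and3P[bi /eqP tb rl] /andP[ol ul]; rewrite in_cons negb_or => /andP[eo el].
have sfx S S' : ray a S -> ray a S' -> uniq (edges S ++ edges S') -> e \notin edges S ->
    e \notin edges S' -> b \in verts a S -> {subset edges S ++ edges S' <= edges P ++ edges Q} ->
    exists Pa Pb, [/\ ray a Pa, ray b Pb, uniq (e :: edges Pa ++ edges Pb) &
      {subset edges Pa ++ edges Pb <= o.1 :: edges l ++ (edges P ++ edges Q)}].
  move=> rS rS' uS eS eS' bS sS; have [l1 [l2 [E rl2 _]]] := ray_suffix rS bS.
  have sl2 : {subset edges l2 <= edges S} by move=> x xl; rewrite E /edges map_cat mem_cat xl orbT.
  exists S', l2; split => //=.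
    rewrite mem_cat negb_or eS' (contra (sl2 _))//= uniq_catC.
    apply: (uniq_sub_cat uS) => //.
      by move: uS; rewrite cat_uniq E /edges map_cat cat_uniq => /and3P[/and3P[]].
    by move: uS; rewrite cat_uniq => /and3P[].
  move=> x; rewrite mem_cat => xx; rewrite in_cons mem_cat sS ?orbT// mem_cat.
  by case/orP: xx => [->|/sl2 ->]; rewrite ?orbT.
have [bP|bP] := boolP (b \in verts a P); first exact: (sfx P Q).
have [bQ|bQ] := boolP (b \in verts a Q).
  apply: (sfx Q P) => //; first by rewrite uniq_catC.
  by move=> x; rewrite !mem_cat orbC.
have [Pa [Pb [rPa rPb uPab sPab]]] := IH _ rl ul el.
exists Pa, (o :: Pb); split => //=.
- by rewrite bi tb eqxx.
(* An edge of P has both its ends among the vertices of P, whereas b is not one of them. *)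
- have oP : o.1 \notin edges P by apply: contra bP => oP; rewrite -tb; exact: edges_verts oP.
  have oQ : o.1 \notin edges Q by apply: contra bQ => oQ; rewrite -tb; exact: edges_verts oQ.
  have oPab : o.1 \notin edges Pa ++ edges Pb.
    by apply/negP => /sPab; rewrite !mem_cat (negPf ol) (negPf oP) (negPf oQ).
  move: uPab => /= /andP[ePab uPab]; apply/andP; split.
    by move: ePab; rewrite !mem_cat in_cons !negb_or eo.
  by rewrite -cat1s uniq_catCA /= oPab.
- move=> x; rewrite mem_cat /= in_cons orbCA in_cons => /orP[->//|xx].
  by rewrite sPab ?orbT// mem_cat.
Qed.

(** If one of the two rays uses the edge of [o], it starts with it: the remainder serves the head
    and the other ray serves the tail. Otherwise [twin_attach] applies. *)
Lemma twin_edge o : (exists2 l, ray (headv o) l & uniq (edges l) && (o.1 \notin edges l)) ->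
  twin (tailv o) -> exists Pa Pb, [/\ ray (tailv o) Pa, ray (headv o) Pb &
    uniq (o.1 :: edges Pa ++ edges Pb)].
Proof.
move=> [l rl /andP[ul ol]] [P [Q [rP rQ uPQ uvP uvQ]]].
have hd S S' : ray (tailv o) S -> ray (tailv o) S' -> uniq (edges S ++ edges S') ->
    uniq (verts (tailv o) S) -> o.1 \in edges S ->
    exists Pa Pb, [/\ ray (tailv o) Pa, ray (headv o) Pb & uniq (o.1 :: edges Pa ++ edges Pb)].
  case: S => // o' S /= /and3P[vi /eqP tt rS] rS' /andP[oS uS] /andP[vS _].
  rewrite in_cons => /orP[/eqP oo|oS2]; last first.
    by move: vS; rewrite (edges_verts rS oS2).
  exists S', S; split => //.
    (* One edge with the same tail: if the two orientations differ, the edge is a self-loop and the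
       heads still agree. *)
    suff -> : headv o = headv o' by [].
    by move: tt; rewrite /headv /tailv oo; case: (o.2); case: (o'.2).
  by rewrite oo /= mem_cat orbC -mem_cat oS uniq_catC.
have [Po|Po] := boolP (o.1 \in edges P); first exact: (hd P Q).
have [Qo|Qo] := boolP (o.1 \in edges Q); first by apply: (hd Q P) => //; rewrite uniq_catC.
have [Pa [Pb [? ? ? _]]] := twin_attach rP rQ uPQ Po Qo rl ul ol.
by exists Pa, Pb.
Qed.

Hypothesis H : forall e v, exists w, at_infinity w /\ connect (joined (predC1 e)) v w.

Lemma exists_ray e v : exists2 l, ray v l & uniq (edges l) && (e \notin edges l).
Proof.
have [w [wi /(connect_ray wi)[l rl lA]]] := H e v.
have [l' [rl' ul' sl']] := ray_shorten rl; exists l' => //.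
rewrite (uniq_edges rl' ul') /=; apply/negP => /sl'/lA.
by rewrite inE /= eqxx.
Qed.

(** From the head, one ray is [Pb]; the other crosses the edge backwards and follows [Pa]. Loop
    erasure restores simplicity. *)
Lemma twin_step o : twin (tailv o) -> twin (headv o).
Proof.
move=> /(twin_edge (exists_ray o.1 (headv o)))[Pa [Pb [ra rb u]]].
have [bi|bi] := boolP (at_infinity (headv o)); first by exists [::], [::].
have rc : ray (headv o) (flip o :: Pa) by rewrite /= bi tailv_flip eqxx headv_flip.
have [X [rX uX sX]] := ray_shorten rb; have [Y [rY uY sY]] := ray_shorten rc.
exists X, Y; split => //.
apply: uniq_sub_cat sX sY; rewrite ?(uniq_edges rX)// ?(uniq_edges rY)//.
by rewrite uniq_catC.
Qed.

(** Vertices at infinity are twins trivially; the property is carried back to v along a ray. *)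
Lemma all_twin v (e0 : edge G) : twin v.
Proof.
have [l rl _] := exists_ray e0 v; elim: l v rl => [|o l IH] v /=.
  by move=> vi; exists [::], [::].
move=> /and3P[_ /eqP <- /IH tw].
by have := @twin_step (flip o); rewrite tailv_flip headv_flip; apply.
Qed.

(* Menger's theorem for two edge-disjoint paths. *)
Lemma exists_trail e : exists l1 l2, [/\ ray (src e) l1, ray (tgt e) l2 &
  uniq (e :: edges l1 ++ edges l2)].
Proof. exact: (@twin_edge (e, true) (exists_ray e (tgt e)) (all_twin (src e) e)). Qed.

End Rays.

(** * Folding a trail onto the line *)

Section GraphFacts.
Variables (R : realType) (G : graph R).
Hypothesis len_gt0 : forall e : edge G, (0 < len e)%E.
Implicit Types (v w : vertex G) (e f : edge G) (x y t : R) (q r : edge G * R).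

Lemma edge_itvP e x : edge_itv e x <-> 0 <= x /\ (x%:E <= len e)%E.
Proof.
rewrite /edge_itv; have := len_gt0 e; case: (len e) => [l| |] //= _.
- by rewrite in_itv/= lee_fin; split=> [/andP[]|[-> ->]].
- by rewrite in_itv/= andbT leey; split=> [|[]].
Qed.

Lemma at_vertex_unique q v w : at_vertex q v -> at_vertex q w -> v = w.
Proof.
move=> [[q0 <-]|[ql <-]] [[q0' <-]|[ql' <-]] //.
  by have := len_gt0 q.1; rewrite -ql' q0 ltxx.
by have := len_gt0 q.1; rewrite -ql q0' ltxx.
Qed.

Lemma glued_sym q r : glued q r -> glued r q.
Proof. by move=> [->|[v [? ?]]]; [left|right; exists v]. Qed.

Lemma glued_trans q r s : glued q r -> glued r s -> glued q s.
Proof.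
move=> [-> //|[v [qv rv]]] [<-|[w [rw sw]]]; first by right; exists v.
by right; exists v; rewrite (at_vertex_unique rv rw) in qv *.
Qed.

Lemma at_vertex_point q v : at_vertex q v -> is_point q.
Proof.
move=> qv; apply/edge_itvP; have l0 := len_gt0 q.1.
case: qv => -[E _]; first by rewrite E; split => //; exact: ltW.
by rewrite E; split => //; rewrite -lee_fin E ltW.
Qed.

Lemma glued_point q r : glued q r -> is_point q -> is_point r.
Proof. by move=> [-> //|[v [_ /at_vertex_point]]]. Qed.

Lemma walk_cat q r s l l' : walk q r l -> walk r s l' -> walk q s (l + l').
Proof.
move=> W; elim: W s l' => [p1 p2 g|p1 e x y p2 l1 g ex ey _ IH] s l' W'.
  rewrite add0r; case: W' g => [p3 p4 g'|p3 e x y p4 l2 g' ex ey W'] g.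
    by apply: walk_end; exact: glued_trans g'.
  by apply: walk_edge ex ey W'; exact: glued_trans g'.
by rewrite -addrA; apply: walk_edge ex ey _ => //; exact: IH.
Qed.

Lemma walk_gluedl q q' r l : glued q q' -> walk q' r l -> walk q r l.
Proof. by move=> g W; rewrite -(add0r l); apply: walk_cat W; exact: walk_end. Qed.

Lemma walk_gluedr q r r' l : glued r r' -> walk q r l -> walk q r' l.
Proof. by move=> g W; rewrite -(addr0 l); apply: walk_cat W _; exact: walk_end. Qed.

Hypothesis deg1 : forall v, at_infinity v -> degree v = 1%N.

(** The half-line that makes v a vertex at infinity already exhausts the degree of v. *)
Lemma inf_edge v e : at_infinity v -> src e = v \/ tgt e = v -> len e = +oo%E /\ tgt e = v.
Proof.
move=> vi; have := deg1 vi; move/existsP: vi => [f /andP[/eqP fl /eqP ft]].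
rewrite /degree => D.
have t1 : (0 < #|[pred e : edge G | tgt e == v]|)%N.
  by apply/card_gt0P; exists f; rewrite inE ft.
have s0 : #|[pred e : edge G | src e == v]| = 0%N by lia.
have {}t1 : #|[pred e : edge G | tgt e == v]| = 1%N by lia.
move=> [es|et].
  by have /card0_eq/(_ e) := s0; rewrite inE es eqxx.
split => //; have [g Hg] := mem_card1 t1.
have := Hg f; have := Hg e; rewrite !inE ft et eqxx => /esym/eqP -> /esym/eqP <-.
exact: fl.
Qed.

Lemma src_finite e : ~~ at_infinity (src e).
Proof.
apply/negP => si; have [_ ts] := inf_edge si (or_introl erefl).
have := deg1 si; rewrite /degree.
have : (0 < #|[pred f : edge G | src f == src e]|)%N by apply/card_gt0P; exists e; rewrite inE.
have : (0 < #|[pred f : edge G | tgt f == src e]|)%N by apply/card_gt0P; exists e; rewrite inE ts.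
lia.
Qed.

Lemma tgt_finite e d : len e = d%:E -> ~~ at_infinity (tgt e).
Proof. by move=> ed; apply/negP => /inf_edge/(_ (or_intror erefl))[]; rewrite ed. Qed.

Lemma tgt_infinite e : len e = +oo%E -> at_infinity (tgt e).
Proof. by move=> ee; apply/existsP; exists e; rewrite ee !eqxx. Qed.

Lemma len_cases e : (exists2 d, 0 < d & len e = d%:E) \/ len e = +oo%E.
Proof.
have := len_gt0 e; case: (len e) => [d| |] //; last by right.
by rewrite lte_fin => d0; left; exists d.
Qed.

(** The differences of [om] telescope along the ray, and [om] vanishes at its end. *)
Lemma ray_sum (a : edge G -> R) (om : vertex G -> R) v l : (forall e, 0 <= a e) ->
  (forall e, om (src e) - om (tgt e) <= a e) -> (forall e, om (tgt e) - om (src e) <= a e) ->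
  (forall v, at_infinity v -> om v = 0) -> ray v l -> om v <= \sum_(e <- edges l) a e.
Proof.
move=> a0 h1 h2 omi; elim: l v => [|o l IH] v /=; first by move=> /omi ->; rewrite big_nil.
move=> /and3P[_ /eqP <- /IH]; rewrite big_cons /tailv /headv.
by case: (o.2) => H; [have := h1 o.1|have := h2 o.1]; lra.
Qed.

(* Edge e is laid on the line from [al e], to the right if [sg e] and to the left
   otherwise. *)
Definition pos (al : edge G -> R) (sg : edge G -> bool) q : R :=
  al q.1 + (if sg q.1 then q.2 else - q.2).

(** The edges are laid one after the other on [h, +oo[, each in its direction of travel; the final
    half-line covers what remains. Distinct edges meet only at common ends, which gives injectivity
    up to gluing. *)
Lemma ray_fold v l h : ray v l -> uniq (edges l) -> ~~ at_infinity v ->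
  exists al sg, [/\
    forall e x, e \in edges l -> edge_itv e x -> h <= pos al sg (e, x),
    forall t, h <= t -> exists e x, [/\ e \in edges l, edge_itv e x & pos al sg (e, x) = t],
    forall e x f y, e \in edges l -> f \in edges l -> edge_itv e x -> edge_itv f y ->
      pos al sg (e, x) = pos al sg (f, y) -> glued (e, x) (f, y) &
    forall e x, e \in edges l -> edge_itv e x -> pos al sg (e, x) = h -> at_vertex (e, x) v].
Proof.
elim: l v h => [|[e b] l IH] v h /=; first by move=> ->.
move=> /and3P[vi /eqP tv rl] /andP[el ul] _.
have [[d d0 ed]|ee] := len_cases e; last first.
  (* A half-line cannot be traversed from its end at infinity, since a ray stops there. *)
  have bt : b.
    move: tv vi; rewrite /tailv /=; case: (b) => // <-.
    by rewrite tgt_infinite.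
  move: tv rl; rewrite /tailv /headv bt /= => tv.
  case: l {IH el ul} => [_|o l] /=; last by rewrite tgt_infinite.
  exists (fun=> h), (fun=> true); rewrite /pos /=; split.
  - move=> f x; rewrite inE => /eqP -> /edge_itvP[x0 _]; lra.
  - move=> t ht; exists e, (t - h); rewrite inE eqxx; split => //; last ring.
    by apply/edge_itvP; rewrite ee leey subr_ge0.
  - move=> f x g y; rewrite !inE => /eqP -> /eqP -> _ _ E; left; congr (_, _); lra.
  - move=> f x; rewrite inE => /eqP -> _ E; left; split => //=; lra.
have hv : ~~ at_infinity (headv (e, b)).
  by rewrite /headv /=; case: (b); [exact: tgt_finite ed|exact: src_finite].
have [al' [sg' [r1 r2 r3 r4]]] := IH _ (h + d) rl ul hv.
have ne f : f \in edges l -> (f == e) = false.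
  by move=> fl; apply/eqP => fe; move: el; rewrite -fe fl.
exists (fun f => if f == e then (if b then h else h + d) else al' f).
exists (fun f => if f == e then b else sg' f).
set al := fun f => _; set sg := fun f => _.
have posl f x : f \in edges l -> pos al sg (f, x) = pos al' sg' (f, x).
  by move=> fl; rewrite /pos /al /sg /= ne.
have pose_ x : pos al sg (e, x) = if b then h + x else h + d - x.
  by rewrite /pos /al /sg /= eqxx; case: (b).
have itve x : edge_itv e x -> 0 <= x /\ x <= d by move=> /edge_itvP; rewrite ed lee_fin.
have mem f : f \in e :: edges l -> f = e \/ f \in edges l.
  by rewrite in_cons => /orP[/eqP|]; [left|right].
have top x : edge_itv e x -> pos al sg (e, x) = h + d -> at_vertex (e, x) (headv (e, b)).
  move=> /itve[x0 xd]; rewrite pose_ /headv /at_vertex /= ed; case: (b) => E; last by left; split=> //; lra.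
  by right; split => //; congr EFin; lra.
split.
- move=> f x /mem[->|fl] fx; last by rewrite posl//; have := r1 _ _ fl fx; lra.
  by have [x0 xd] := itve _ fx; rewrite pose_; case: (b); lra.
- move=> t ht; have [td|dt] := leP (h + d) t.
    have [f [x [fl fx E]]] := r2 t td; exists f, x; rewrite in_cons fl orbT posl//.
  exists e, (if b then t - h else h + d - t); rewrite in_cons eqxx pose_; split => //.
    by apply/edge_itvP; rewrite ed lee_fin; case: (b); split; lra.
  by case: (b); ring.
(* The edge e lies in [h, h + d] and the rest in [h + d, +oo[, so a common position is the vertex at
   h + d. *)
- have mix f x y : f \in edges l -> edge_itv e x -> edge_itv f y ->
      pos al sg (e, x) = pos al sg (f, y) -> glued (e, x) (f, y).
    move=> fl ex fy E; have := r1 _ _ fl fy; rewrite -posl// => h1.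
    have Ex : pos al sg (e, x) = h + d.
      apply/eqP; rewrite eq_le E h1 andbT -E pose_.
      by have [x0 xd] := itve _ ex; case: (b); lra.
    right; exists (headv (e, b)); split; first exact: top.
    by apply: r4 => //; rewrite -posl// -E.
  move=> f x g y /mem[->|fl] /mem[->|gl] fx gy E.
  + by left; congr (_, _); move: E; rewrite !pose_; case: (b); lra.
  + exact: mix.
  + by apply: glued_sym; exact: mix.
  + by apply: r3 => //; rewrite -!posl.
- move=> f x /mem[->|fl] fx E; last by have := r1 _ _ fl fx; rewrite -posl// E; lra.
  move: E; rewrite pose_ -tv /tailv /at_vertex /= ed; case: (b) => E; first by left; split => //; lra.
  by right; split => //; congr EFin; lra.
Qed.

(** The point xi of e0 is put at 0; the ray from [src e0] is folded onto [xi, +oo[ and reflected,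
    and the ray from [tgt e0] continues e0 to the right. *)
Lemma partial_fold (e0 : edge G) (xi : R) l1 l2 : edge_itv e0 xi ->
  ray (src e0) l1 -> ray (tgt e0) l2 -> uniq (e0 :: edges l1 ++ edges l2) ->
  exists al sg, let T := e0 :: edges l1 ++ edges l2 in [/\
    pos al sg (e0, xi) = 0,
    forall t, exists e x, [/\ e \in T, edge_itv e x & pos al sg (e, x) = t] &
    forall e x f y, e \in T -> f \in T -> edge_itv e x -> edge_itv f y ->
      pos al sg (e, x) = pos al sg (f, y) -> glued (e, x) (f, y)].
Proof.
move=> /edge_itvP[xi0 xil] ra1 ra2; rewrite cons_uniq mem_cat negb_or => /andP[/andP[e1 e2]].
rewrite cat_uniq => /and3P[u1 /hasPn dis u2].
have [al1 [sg1 [p1 p2 p3 p4]]] := ray_fold xi ra1 u1 (src_finite e0).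
(* Stated in terms of [len e0] so as to include the case where e0 is a half-line and the second ray
   is empty. *)
have [al2 [sg2 [q1 q2 q3 q4]]] : exists al sg, [/\
    forall e x, e \in edges l2 -> edge_itv e x -> exists2 d, len e0 = d%:E & d - xi <= pos al sg (e, x),
    forall t, (len e0 < (t + xi)%:E)%E ->
      exists e x, [/\ e \in edges l2, edge_itv e x & pos al sg (e, x) = t],
    forall e x f y, e \in edges l2 -> f \in edges l2 -> edge_itv e x -> edge_itv f y ->
      pos al sg (e, x) = pos al sg (f, y) -> glued (e, x) (f, y) &
    forall e x, e \in edges l2 -> edge_itv e x -> (pos al sg (e, x) + xi)%:E = len e0 ->
      at_vertex (e, x) (tgt e0)].
  have [[d d0 ed]|ee] := len_cases e0.
    have [al [sg [r1 r2 r3 r4]]] := ray_fold (d - xi) ra2 u2 (tgt_finite ed).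
    exists al, sg; split => //.
    - by move=> e x el ex; exists d => //; exact: r1.
    - by move=> t; rewrite ed lte_fin => dt; apply: r2; lra.
    - by move=> e x el ex; rewrite ed => -[E]; apply: r4 => //; lra.
  exists (fun=> 0), (fun=> true); move: ra2; case: (l2) => [_|o l] /=; last by rewrite tgt_infinite.
  by split=> // t; rewrite ee.
have ne1 f : f \in edges l1 -> (f == e0) = false.
  by move=> fl; apply/eqP => fe; move: e1; rewrite -fe fl.
have ne2 f : f \in edges l2 -> (f == e0) = false.
  by move=> fl; apply/eqP => fe; move: e2; rewrite -fe fl.
have n12 f : f \in edges l2 -> (f \in edges l1) = false by move=> /dis/negbTE.
pose al f := if f == e0 then - xi else if f \in edges l1 then - al1 f else al2 f.
pose sg f := if f == e0 then true else if f \in edges l1 then ~~ sg1 f else sg2 f.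
have pos0 x : pos al sg (e0, x) = x - xi by rewrite /pos /al /sg /= eqxx addrC.
have pos1 f x : f \in edges l1 -> pos al sg (f, x) = - pos al1 sg1 (f, x).
  by move=> fl; rewrite /pos /al /sg /= ne1// fl opprD; case: (sg1 f); rewrite /= ?opprK.
have pos2 f x : f \in edges l2 -> pos al sg (f, x) = pos al2 sg2 (f, x).
  by move=> fl; rewrite /pos /al /sg /= ne2// n12.
exists al, sg => T.
have memT f : f \in T -> [\/ f = e0, f \in edges l1 | f \in edges l2].
  rewrite /T in_cons mem_cat => /orP[/eqP|/orP[]]; by [constructor 1|constructor 2|constructor 3].
split.
- by rewrite pos0 subrr.
- move=> t; have [tx|tx] := leP xi (- t).
    have [f [x [fl fx E]]] := p2 _ tx; exists f, x; rewrite pos1// E opprK.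
    by rewrite /T in_cons mem_cat fl orbT.
  have [tl|lt] := leP (t + xi)%:E (len e0).
    exists e0, (t + xi); rewrite pos0 /T in_cons eqxx; split => //; last ring.
    by apply/edge_itvP; split => //; lra.
  have [f [x [fl fx E]]] := q2 _ lt; exists f, x; rewrite pos2//.
  by rewrite /T in_cons mem_cat fl !orbT.
- have mix01 f x y : f \in edges l1 -> edge_itv e0 x -> edge_itv f y ->
      pos al sg (e0, x) = pos al sg (f, y) -> glued (e0, x) (f, y).
    move=> fl /edge_itvP[x0 _] fy; rewrite pos0 pos1// => E; have h1 := p1 _ _ fl fy.
    right; exists (src e0); split; first by left; split => //=; lra.
    by apply: p4 => //; lra.
  have mix02 f x y : f \in edges l2 -> edge_itv e0 x -> edge_itv f y ->
      pos al sg (e0, x) = pos al sg (f, y) -> glued (e0, x) (f, y).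
    move=> fl /edge_itvP[x0 xl] fy; rewrite pos0 pos2// => E; have [d ed h1] := q1 _ _ fl fy.
    move: xl; rewrite ed lee_fin => xl.
    right; exists (tgt e0); split; first by right; split => //=; rewrite ed; congr EFin; lra.
    by apply: q4 => //; rewrite ed; congr EFin; lra.
  have mix12 f x g y : f \in edges l1 -> g \in edges l2 -> edge_itv f x -> edge_itv g y ->
      pos al sg (f, x) = pos al sg (g, y) -> False.
    move=> fl gl fx gy; rewrite pos1// pos2// => E.
    have h1 := p1 _ _ fl fx; have [d ed h2] := q1 _ _ gl gy.
    by have := len_gt0 e0; rewrite ed lte_fin; lra.
  move=> f x g y /memT[->|fl|fl] /memT[->|gl|gl] fx gy E.
  + by left; congr (_, _); move: E; rewrite !pos0; lra.
  + exact: mix01.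
  + exact: mix02.
  + by apply: glued_sym; exact: mix01.
  + by apply: p3 => //; move: E; rewrite !pos1// => /oppr_inj.
  + by case: (mix12 _ _ _ _ fl gl fx gy E).
  + by apply: glued_sym; exact: mix02.
  + by case: (mix12 _ _ _ _ gl fl gy fx (esym E)).
  + by apply: q3 => //; rewrite -!pos2.
Qed.

End GraphFacts.

Lemma finite_gap (R : realType) (T : eqType) (s : seq T) (P : T -> R -> Prop) :
  (forall i d d', P i d -> 0 < d' -> d' <= d -> P i d') ->
  (forall i, i \in s -> exists2 d, 0 < d & P i d) -> exists2 d, 0 < d & forall i, i \in s -> P i d.
Proof.
move=> mono; elim: s => [|i s IH] H; first by exists 1.
have [|d d0 Hd] := IH; first by move=> j js; apply: H; rewrite in_cons js orbT.
have [|d' d'0 Hd'] := H i; first by rewrite in_cons eqxx.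
have m0 : 0 < Num.min d d' by rewrite lt_min d0.
exists (Num.min d d') => // j; rewrite in_cons => /orP[/eqP ->|js].
  by apply: mono Hd' _ _ => //; rewrite ge_min lexx orbT.
by apply: mono (Hd _ js) _ _ => //; rewrite ge_min lexx.
Qed.

(** * Walks that follow the line *)

Section WalkFold.
Variables (R : realType) (G : graph R).
Hypothesis len_gt0 : forall e : edge G, (0 < len e)%E.
Variables (T : pred (edge G)) (al : edge G -> R) (sg : edge G -> bool).
Notation pos := (pos al sg).
Hypothesis C1 : forall t, exists e x, [/\ T e, edge_itv e x & pos (e, x) = t].
Hypothesis C2 : forall e x f y, T e -> T f -> edge_itv e x -> edge_itv f y ->
  pos (e, x) = pos (f, y) -> glued (e, x) (f, y).
Implicit Types (e f : edge G) (x y s t : R).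

(** The coordinate on e of the position t, possibly outside the edge. *)
Let inv e t := if sg e then t - al e else al e - t.

Lemma pos_inv e t : pos (e, inv e t) = t.
Proof. by rewrite /pos /inv /=; case: (sg e); ring. Qed.

Lemma pos_dist e x y : `|x - y| = `|pos (e, x) - pos (e, y)|.
Proof.
rewrite /pos /=; case: (sg e); first by congr `|_|; ring.
by rewrite distrC; congr `|_|; ring.
Qed.

Lemma pos_between e x y t : edge_itv e x -> edge_itv e y -> pos (e, x) <= t -> t <= pos (e, y) ->
  edge_itv e (inv e t).
Proof.
move=> /(edge_itvP len_gt0)[x0 xl] /(edge_itvP len_gt0)[y0 yl].
rewrite /pos /inv /=; case: (sg e) => h1 h2; apply/(edge_itvP len_gt0); (split; first lra).
  by apply: le_trans yl; rewrite lee_fin; lra.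
by apply: le_trans xl; rewrite lee_fin; lra.
Qed.

Lemma pos_max e t : (forall y, edge_itv e y -> pos (e, y) < t) ->
  exists2 x, edge_itv e x & forall y, edge_itv e y -> pos (e, y) <= pos (e, x).
Proof.
rewrite /pos /= => H; case: (boolP (sg e)) H => sge H; last first.
  exists 0; first by apply/(edge_itvP len_gt0); split => //; exact: ltW.
  by move=> y /(edge_itvP len_gt0)[y0 _]; lra.
have [[d d0 ed]|ee] := len_cases len_gt0 e.
  exists d; first by apply/(edge_itvP len_gt0); rewrite ed lee_fin; split => //; exact: ltW.
  by move=> y /(edge_itvP len_gt0)[_]; rewrite ed lee_fin; lra.
(* A half-line laid to the right contains this coordinate, whose position is at least t. *)
have [] : edge_itv e (Num.max 0 (t - al e)) /\ True.
  by split=> //; apply/(edge_itvP len_gt0); rewrite ee leey le_max lexx.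
move=> /H; have : t - al e <= Num.max 0 (t - al e) by rewrite le_max lexx orbT.
lra.
Qed.

(** The image of e is a closed interval: if it misses s and lies beyond it, it does so at a positive
    distance. *)
Lemma pos_gap s e : ~ (exists2 y, edge_itv e y & s < pos (e, y)) \/ ~ edge_itv e (inv e s) ->
  exists2 d, 0 < d & forall x, edge_itv e x -> s < pos (e, x) -> s + d <= pos (e, x).
Proof.
move=> H; have [[y ey sy]|none] := pselect (exists2 y, edge_itv e y & s < pos (e, y)); last first.
  by exists 1 => // x ex sx; case: none; exists x.
case: H => [[]|ns]; first by exists y.
have big x : edge_itv e x -> s < pos (e, x).
  move=> ex; rewrite ltNge; apply/negP => xs; apply: ns.
  by apply: (pos_between ex ey) => //; exact: ltW.
move: ns big; rewrite /pos /inv /=; case: (boolP (sg e)) => sge ns big.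
  exists (al e - s); last by move=> x /(edge_itvP len_gt0)[x0 _] _; lra.
  have : edge_itv e 0 by apply/(edge_itvP len_gt0); split => //; exact: ltW.
  by move/big; lra.
have [[d d0 ed]|ee] := len_cases len_gt0 e.
  exists (al e - d - s); last by move=> x /(edge_itvP len_gt0)[_]; rewrite ed lee_fin; lra.
  have : edge_itv e d by apply/(edge_itvP len_gt0); rewrite ed lee_fin; split => //; exact: ltW.
  by move/big; lra.
case: ns; apply/(edge_itvP len_gt0); rewrite ee leey; split => //.
by have := big y ey; have /(edge_itvP len_gt0)[y0 _] := ey; lra.
Qed.

(** Otherwise every edge of [T] leaves a gap to the right of s, and the smallest of these finitely
    many gaps is not covered, against [C1]. *)
Lemma extend_right s : exists e, [/\ T e, edge_itv e (inv e s) & exists2 y, edge_itv e y & s < pos (e, y)].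
Proof.
apply: contrapT => H.
have [||d d0 Hd] := @finite_gap R _ (enum (edge G))
  (fun e d => T e -> forall x, edge_itv e x -> s < pos (e, x) -> s + d <= pos (e, x)).
- by move=> e d d' Hd _ dd Te x ex sx; have := Hd Te x ex sx; lra.
- move=> e _; have [Te|Te] := boolP (T e); last by exists 1.
  have [|d d0 Hd] := @pos_gap s e; last by exists d.
  have [ei|] := pselect (edge_itv e (inv e s)); last by right.
  by left => ey; apply: H; exists e.
have [e [x [Te ex E]]] := C1 (s + d / 2).
by have := Hd e; rewrite mem_enum => /(_ isT Te x ex); rewrite E; lra.
Qed.

(** Induction on the number of edges of [T] that reach beyond s. Change to an edge given by
    [extend_right] and follow it either to t or to its right end, after which it no longer
    counts. *)
Lemma walk_fold s t e x f y : T e -> T f -> edge_itv e x -> edge_itv f y ->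
  s <= t -> pos (e, x) = s -> pos (f, y) = t -> walk (e, x) (f, y) (t - s).
Proof.
pose ahead s := [pred e | T e & `[< exists2 y, edge_itv e y & s < pos (e, y) >]].
move: {2}(#|ahead s|) (leqnn #|ahead s|) => n.
elim: n s e x => [|n IH] s e x hn Te Tf ex fy st xs yt;
  (move: st; rewrite le_eqVlt => /orP[/eqP stE|st];
    first by rewrite -stE subrr; apply: walk_end; apply: C2 => //; rewrite xs yt).
  have [g [Tg gs gy]] := extend_right s.
  have : (0 < #|ahead s|)%N by apply/card_gt0P; exists g; rewrite inE Tg; exact/asboolP.
  by rewrite ltnNge hn.
have [g [Tg gs gy]] := extend_right s.
have glu : glued (e, x) (g, inv g s) by apply: C2 => //; rewrite pos_inv.
have [[y2 gy2 ty2]|none] := pselect (exists2 y, edge_itv g y & t <= pos (g, y)).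
  have gt : edge_itv g (inv g t).
    by apply: (pos_between gs gy2) => //; rewrite pos_inv ltW.
  have -> : t - s = `|inv g s - inv g t| + 0.
    by rewrite addr0 (pos_dist g) !pos_inv distrC gtr0_norm// subr_gt0.
  apply: (walk_edge glu gs gt); apply: walk_end; apply: C2 => //.
  by rewrite pos_inv.
have lt_t z : edge_itv g z -> pos (g, z) < t.
  by move=> gz; rewrite ltNge; apply/negP => tz; apply: none; exists z.
have [z gz Hz] := pos_max lt_t.
have sz : s < pos (g, z) by case: gy => y' gy' sy'; exact: lt_le_trans sy' (Hz _ gy').
have zt := lt_t z gz.
have -> : t - s = `|inv g s - z| + (t - pos (g, z)).
  by rewrite (pos_dist g) pos_inv distrC gtr0_norm ?subr_gt0//; ring.
apply: (walk_edge glu gs gz); apply: IH => //; last exact: ltW.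
rewrite -ltnS; apply: leq_trans hn; apply: proper_card; apply/properP; split.
  apply/fintype.subsetP => k; rewrite !inE => /andP[-> /asboolP[k' kk' h]].
  by apply/asboolP; exists k' => //; exact: lt_trans h.
exists g; rewrite !inE Tg /=; first exact/asboolP.
by apply/asboolP => -[z' gz' zz']; have := Hz z' gz'; rewrite leNgt zz'.
Qed.

End WalkFold.

Lemma walk_fold_dist (R : realType) (G : graph R) (T : pred (edge G)) (al : edge G -> R)
    (sg : edge G -> bool) (e f : edge G) (x y : R) : (forall e : edge G, (0 < len e)%E) ->
  (forall t, exists e x, [/\ T e, edge_itv e x & pos al sg (e, x) = t]) ->
  (forall e x f y, T e -> T f -> edge_itv e x -> edge_itv f y ->
    pos al sg (e, x) = pos al sg (f, y) -> glued (e, x) (f, y)) ->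
  T e -> T f -> edge_itv e x -> edge_itv f y ->
  walk (e, x) (f, y) `|pos al sg (e, x) - pos al sg (f, y)|.
Proof.
move=> len_gt0 C1 C2 Te Tf ex fy.
have [le|/ltW le] := leP (pos al sg (e, x)) (pos al sg (f, y)).
  rewrite distrC ger0_norm ?subr_ge0//.
  exact: (walk_fold len_gt0 C1 C2).
pose al' e := - al e; pose sg' e := ~~ sg e.
have negpos k z : pos al' sg' (k, z) = - pos al sg (k, z).
  by rewrite /pos /al' /sg' /=; case: (sg k) => /=; ring.
have C1' t : exists e x, [/\ T e, edge_itv e x & pos al' sg' (e, x) = t].
  by have [k [z [Tk kz E]]] := C1 (- t); exists k, z; rewrite negpos E opprK.
have C2' e1 x1 e2 x2 : T e1 -> T e2 -> edge_itv e1 x1 -> edge_itv e2 x2 ->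
    pos al' sg' (e1, x1) = pos al' sg' (e2, x2) -> glued (e1, x1) (e2, x2).
  by move=> T1 T2 i1 i2; rewrite !negpos => /oppr_inj; exact: C2.
rewrite ger0_norm ?subr_ge0//.
have -> : pos al sg (e, x) - pos al sg (f, y) = - pos al sg (f, y) - - pos al sg (e, x) by ring.
by apply: (walk_fold len_gt0 C1' C2') => //; rewrite ?lerN2.
Qed.

Section FoldIsometry.
Variable R : realType.
Implicit Types G K : graph R.

(* A folding presents the graph as the quotient of the line by [|pos|]-preserving
   identifications; [fold_point a] says that a and -a are glued. *)
Definition folding G (al : edge G -> R) (sg : edge G -> bool) := [/\
  forall t, exists e x, edge_itv e x /\ pos al sg (e, x) = t,
  forall q r, is_point q -> is_point r -> pos al sg q = pos al sg r -> glued q r &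
  forall q r, is_point q -> is_point r -> glued q r -> `|pos al sg q| = `|pos al sg r|].

Definition fold_point G (al : edge G -> R) (sg : edge G -> bool) (a : R) :=
  0 < a /\ exists q r, [/\ is_point q, is_point r, glued q r, pos al sg q = a & pos al sg r = - a].

Section Two.
Variables (G K : graph R).
Hypothesis lenG : forall e : edge G, (0 < len e)%E.
Hypothesis lenK : forall e : edge K, (0 < len e)%E.
Variables (alG : edge G -> R) (sgG : edge G -> bool) (alK : edge K -> R) (sgK : edge K -> bool).
Hypotheses (FG : folding alG sgG) (FK : folding alK sgK)
  (GK : forall a, fold_point alG sgG a -> fold_point alK sgK a).

Lemma folding_section : exists f : edge G * R -> edge K * R,
  forall q, is_point (f q) /\ pos alK sgK (f q) = pos alG sgG q.
Proof.
have [CK _ _] := FK.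
have H q : exists r, is_point r /\ pos alK sgK r = pos alG sgG q.
  by have [e [x [ex E]]] := CK (pos alG sgG q); exists (e, x).
by have [f Hf] := choice H; exists f.
Qed.

Variable f : edge G * R -> edge K * R.
Hypothesis Hf : forall q, is_point (f q) /\ pos alK sgK (f q) = pos alG sgG q.

(** Glued points have equal or opposite positions. In the second case the common modulus is a fold
    point of [K] too, and its two glued points link [f q] to [f r]. *)
Lemma folding_glued q r : is_point q -> is_point r -> glued q r -> glued (f q) (f r).
Proof.
move=> qp rp qr; have [_ _ AG] := FG; have [_ BK _] := FK.
have [fq Eq] := Hf q; have [fr Er] := Hf r.
have [E|ne] := eqVneq (pos alG sgG q) (pos alG sgG r).
  by apply: BK => //; rewrite Eq Er.
have opp a b : is_point a -> is_point b -> glued a b -> pos alG sgG b < pos alG sgG a ->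
    glued (f a) (f b).
  move=> ap bp ab lt; have E := AG _ _ ap bp ab.
  have [fa Ea] := Hf a; have [fb Eb] := Hf b.
  have E' : pos alG sgG b = - pos alG sgG a.
    move: E; case: (ger0P (pos alG sgG a)); case: (ger0P (pos alG sgG b)); lra.
  have a0 : 0 < pos alG sgG a by lra.
  have [|_ [q' [r' [q'p r'p q'r' Eq' Er']]]] := GK (a := pos alG sgG a).
    by split => //; exists a, b; split.
  apply: (glued_trans lenK) (_ : glued _ q') _; first by apply: BK => //; rewrite Ea.
  apply: (glued_trans lenK) q'r' _; apply: BK => //.
  by rewrite Er' Eb.
have [lt|lt|E] := ltgtP (pos alG sgG r) (pos alG sgG q).
- exact: opp.
- by apply: glued_sym; apply: opp => //; exact: glued_sym.
- by rewrite E eqxx in ne.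
Qed.

(** Moving by |x - y| on an edge moves the position by the same amount, and [walk_fold_dist] gives a
    walk of this length in [K], possibly through several edges. *)
Lemma folding_walk q r l : is_point q -> walk q r l -> walk (f q) (f r) l.
Proof.
move=> + W; elim: W => [p1 p2 g|p1 e x y p2 l' g ex ey _ IH] p1p.
  by apply: walk_end; apply: folding_glued => //; exact: glued_point g p1p.
have [CK BK _] := FK.
have exp : is_point (e, x) by []. have eyp : is_point (e, y) by [].
apply: (walk_gluedl lenK) (folding_glued p1p exp g) _; apply: (walk_cat lenK) (IH eyp).
have [fx Ex] := Hf (e, x); have [fy Ey] := Hf (e, y).
have C1' t : exists k z, [/\ predT k, edge_itv k z & pos alK sgK (k, z) = t].
  by have [k [z [kz E]]] := CK t; exists k, z.
have C2' k z k' z' : predT k -> predT k' -> edge_itv k z -> edge_itv k' z' ->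
  pos alK sgK (k, z) = pos alK sgK (k', z') -> glued (k, z) (k', z').
  by move=> _ _ kz kz'; exact: BK.
rewrite (pos_dist alG sgG e) -Ex -Ey.
move: fx fy; case: (f (e, x)) => k z; case: (f (e, y)) => k' z' kz kz'.
exact: (walk_fold_dist lenK C1' C2').
Qed.

End Two.

(** The two sections are inverse to each other up to gluing and both preserve the lengths of walks;
    the distances are thus infima of the same sets. *)
Theorem folding_isometric G K (alG : edge G -> R) (sgG : edge G -> bool)
    (alK : edge K -> R) (sgK : edge K -> bool) :
  (forall e : edge G, (0 < len e)%E) -> (forall e : edge K, (0 < len e)%E) ->
  folding alG sgG -> folding alK sgK ->
  (forall a, fold_point alG sgG a <-> fold_point alK sgK a) -> isometric G K.
Proof.
move=> lG lK FG FK A.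
have A1 a : fold_point alG sgG a -> fold_point alK sgK a by move/A.
have A2 a : fold_point alK sgK a -> fold_point alG sgG a by move/A.
have [f Hf] := folding_section alG sgG FK.
have [g Hg] := folding_section alK sgK FG.
have [_ BG _] := FG; have [_ BK _] := FK.
have gf q : is_point q -> glued (g (f q)) q.
  by move=> qp; apply: BG => //; [case: (Hg (f q))|rewrite (Hg _).2 (Hf _).2].
have fg q : is_point q -> glued (f (g q)) q.
  by move=> qp; apply: BK => //; [case: (Hf (g q))|rewrite (Hf _).2 (Hg _).2].
exists f; split.
- by move=> q _; case: (Hf q).
- move=> q r qp rp; congr inf; apply/seteqP; split=> l /= W.
    have := folding_walk lK lG FK FG A2 Hg (Hf q).1 W.
    move=> /(walk_gluedr lG (gf r rp)); apply: (walk_gluedl lG).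
    by apply: glued_sym; exact: gf.
  exact: (folding_walk lG lK FG FK A1 Hf qp W).
- move=> q qp; exists (g q); first by case: (Hg q).
  exact: fg.
Qed.

End FoldIsometry.

(** * Classification of foldings *)

Section LineFold.
Variable R : realType.
Notation L := (line_graph R).

Definition line_al : edge L -> R := fun=> 0.
Definition line_sg : edge L -> bool := id.

Lemma line_len (e : edge L) : (0 < len e)%E.
Proof. exact: ltry. Qed.

Lemma line_pos (e : bool) x : pos line_al line_sg (e : edge L, x) = if e then x else - x.
Proof. by rewrite /pos /= /line_al add0r. Qed.

Lemma line_itv (e : edge L) x : edge_itv e x = (0 <= x) :> Prop.
Proof. by rewrite /edge_itv /= in_itv/= andbT. Qed.

Lemma line_vertex (q : edge L * R) v : at_vertex q v -> q.2 = 0 /\ v = None.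
Proof. by move=> [[-> <-]|[]]. Qed.

Lemma line_folding : folding line_al line_sg.
Proof.
split.
- move=> t; have [t0|t0] := leP 0 t.
    by exists true, t; rewrite line_pos; rewrite line_itv.
  exists false, (- t); rewrite line_pos opprK; split => //.
  by rewrite line_itv oppr_ge0 ltW.
- move=> [e x] [f y]; rewrite /is_point /= !line_itv => x0 y0.
  rewrite (line_pos e) (line_pos f); case: e; case: f => /= E.
  + by left; rewrite E.
  + by right; exists None; split; left; split => //=; lra.
  + by right; exists None; split; left; split => //=; lra.
  + by left; move/oppr_inj: E => ->.
- move=> [e x] [f y] _ _ [-> //|[v [/line_vertex[/= -> _] /line_vertex[/= -> _]]]].
  by rewrite (line_pos e) (line_pos f) oppr0 !if_same.
Qed.

Lemma line_fold_point a : ~ fold_point line_al line_sg a.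
Proof.
move=> [a0 [[e x] [[f y] [_ _ g]]]]; rewrite (line_pos e) (line_pos f) => E1 E2.
case: g => [[ef xy]|[v [/line_vertex[/= x0 _] _]]].
  by move: E2; rewrite -ef -xy E1; lra.
by move: E1; rewrite x0 oppr0 if_same; lra.
Qed.

End LineFold.

Section FoldedLine.
Variables (R : realType) (m : nat) (a : nat -> R).
Hypotheses (a1 : 0 < a 1%N) (amono : forall j, (1 <= j < m.+1)%N -> a j < a j.+1).
Notation K := (folded_line m.+1 a).

Lemma fl_lt i j : (1 <= i)%N -> (i < j)%N -> (j <= m.+1)%N -> a i < a j.
Proof.
move=> i1; elim: j => // j IH; rewrite ltnS leq_eqVlt => /orP[/eqP <-|ij] jm.
  by apply: amono; rewrite i1.
apply: lt_trans (IH ij (ltnW jm)) _; apply: amono.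
by rewrite (leq_trans i1 (ltnW ij)).
Qed.

Lemma fl_gt0 j : (1 <= j <= m.+1)%N -> 0 < a j.
Proof.
move=> /andP[j1 jm]; move: j1; rewrite leq_eqVlt => /orP[/eqP <- //|j1].
exact: lt_trans (fl_lt _ j1 jm).
Qed.

Lemma fl_len (e : edge K) : (0 < len e)%E.
Proof.
case: e => [[b|[]]|[i b]] /=; first exact: ltry.
  by rewrite lte_fin mulr_gt0.
by rewrite lte_fin subr_gt0; apply: amono; rewrite /= ltnS ltn_ord.
Qed.

Definition fl_al : edge K -> R := fun e => match e with
  | inl (inl b) => if b then a m.+1 else - a m.+1
  | inl (inr _) => - a 1%N
  | inr (i, b) => if b then a (i : nat).+1 else - a (i : nat).+1
  end.

Definition fl_sg : edge K -> bool := fun e => match e with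
  | inl (inl b) => b | inl (inr _) => true | inr (i, b) => b
  end.

Notation posK := (pos fl_al fl_sg).

(* The edges other than the loop are numbered by their level and their side. *)
Definition fl_edge (j : nat) (b : bool) : edge K :=
  if insub j is Some i then inr (i, b) else inl (inl b).

(** A half-line is the infinitely long edge of level [m], so that only the loop is special. *)
Lemma fl_edge_cases (e : edge K) : e = inl (inr tt) \/
  exists j b, [/\ (j <= m)%N, e = fl_edge j b, src e = inl (inord j),
    (forall x, posK (e, x) = if b then a j.+1 + x else - (a j.+1 + x)) &
    if (j < m)%N then tgt e = inl (inord j.+1) /\ len e = (a j.+2 - a j.+1)%:E else len e = +oo%E].
Proof.
case: e => [[b|[]]|[i b]]; [right|by left|right].
  exists m, b; split => //.
  - by rewrite /fl_edge insubF// ltnn.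
  - by congr inl; apply: val_inj; rewrite /= inordK.
  - by move=> x; rewrite /pos /=; case: b; ring.
  - by rewrite ltnn.
exists i, b; split.
- exact: ltnW.
- rewrite /fl_edge; case: insubP => [k _ ki|]; last by rewrite ltn_ord.
  by congr (inr (_, _)); apply: val_inj.
- by congr inl; apply: val_inj; rewrite /= inordK// ltnS ltnW.
- by move=> x; rewrite /pos /=; case: b; ring.
- rewrite ltn_ord; split => //.
  by congr inl; apply: val_inj; rewrite /= inordK// ltnS.
Qed.

Lemma fl_edgeP j b : (j <= m)%N -> [/\ src (fl_edge j b) = inl (inord j),
  (forall x, posK (fl_edge j b, x) = if b then a j.+1 + x else - (a j.+1 + x)) &
  if (j < m)%N then len (fl_edge j b) = (a j.+2 - a j.+1)%:E else len (fl_edge j b) = +oo%E].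
Proof.
move=> jm; rewrite /fl_edge; case: insubP => [i im ij|].
  rewrite -ij ltn_ord; split => //; last by move=> x; rewrite /pos /=; case: (b); ring.
  by congr inl; apply: val_inj; rewrite /= inordK// ltnS ltnW.
rewrite -leqNgt => mj; have -> : j = m by apply/eqP; rewrite eqn_leq jm.
rewrite ltnn; split => //; last by move=> x; rewrite /pos /=; case: (b); ring.
by congr inl; apply: val_inj; rewrite /= inordK.
Qed.

Lemma fl_loop x : posK (inl (inr tt) : edge K, x) = x - a 1%N.
Proof. by rewrite /pos /=; ring. Qed.

Lemma fl_vertex (q : edge K * R) v : at_vertex q v ->
  exists2 j, (j <= m)%N & v = inl (inord j) /\ `|posK q| = a j.+1.
Proof.
case: q => e x [[x0 <-]|[xl <-]].
  have {}x0 : x = 0 by exact: x0.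
  rewrite x0 -[(e, 0).1]/e; have [->|[j [b [jm _ -> E _]]]] := fl_edge_cases e.
    exists 0%N => //; split; first by congr inl; apply: val_inj; rewrite /= inordK.
    by rewrite fl_loop sub0r normrN gtr0_norm.
  exists j => //; split => //; rewrite E addr0.
  have aj : 0 < a j.+1 by apply: fl_gt0.
  by case: (b); rewrite ?normrN gtr0_norm.
have {}xl : x%:E = len e by exact: xl.
rewrite -[(e, x).1]/e; have [ee|[j [b [jm _ _ E]]]] := fl_edge_cases e.
  move: xl; rewrite ee /= => -[->]; exists 0%N => //; split.
    by congr inl; apply: val_inj; rewrite /= inordK.
  by rewrite fl_loop (_ : 2 * a 1%N - a 1%N = a 1%N) ?gtr0_norm//; ring.
case: ltnP => [jm'|_]; last by rewrite -xl.
move=> [-> el]; exists j.+1 => //; split => //.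
have -> : x = a j.+2 - a j.+1 by move: xl; rewrite el => -[].
rewrite E; have aj : 0 < a j.+2 by apply: fl_gt0.
have -> : a j.+1 + (a j.+2 - a j.+1) = a j.+2 by ring.
by case: (b); rewrite ?normrN gtr0_norm.
Qed.

Lemma fl_cover t : exists e x, edge_itv (e : edge K) x /\ posK (e, x) = t.
Proof.
have edge_ok j b x : (j <= m)%N -> 0 <= x -> ((j < m)%N -> a j.+1 + x <= a j.+2) ->
    edge_itv (fl_edge j b) x.
  move=> jm x0 xa; have [_ _ E] := fl_edgeP b jm; apply/(edge_itvP fl_len); split => //.
  by case: ltnP E xa => _ -> xa; rewrite ?leey// lee_fin; have := xa isT; lra.
have [t1|t1] := leP `|t| (a 1%N).
  exists (inl (inr tt)), (t + a 1%N); rewrite fl_loop; split; last ring.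
  apply/(edge_itvP fl_len); rewrite /= lee_fin.
  by move: t1; rewrite ler_norml => /andP[? ?]; split; lra.
(* The level whose two edges cover the positions t and -t, found by going up through the
   breakpoints. *)
have [j [jm aj ja]] : exists j, [/\ (j <= m)%N, a j.+1 <= `|t| & (j < m)%N -> `|t| <= a j.+2].
  have H k : (k <= m)%N -> (exists j, [/\ (j <= m)%N, a j.+1 <= `|t| & (j < m)%N -> `|t| <= a j.+2])
      \/ a k.+1 <= `|t|.
    elim: k => [_|k IH km]; first by right; exact: ltW.
    have [?|kt] := IH (ltnW km); first by left.
    have [lt|lt] := leP (a k.+2) `|t|; first by right.
    by left; exists k; split => //; [exact: ltnW|move=> _; exact: ltW].
  have [//|mt] := H m (leqnn m).
  by exists m; split => //; rewrite ltnn.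
have x0 : 0 <= `|t| - a j.+1 by lra.
have xa : (j < m)%N -> a j.+1 + (`|t| - a j.+1) <= a j.+2 by move=> /ja; lra.
have [t0|t0] := leP 0 t.
  exists (fl_edge j true), (`|t| - a j.+1); split; first exact: edge_ok.
  by have [_ -> _] := fl_edgeP true jm; rewrite ger0_norm//; ring.
exists (fl_edge j false), (`|t| - a j.+1); split; first exact: edge_ok.
by have [_ -> _] := fl_edgeP false jm; rewrite ltr0_norm//; ring.
Qed.

(** On one side and one level the position determines the coordinate. The loop or edges of two
    levels can share a position only at a breakpoint, where they have a common vertex. *)
Lemma fl_glued (q r : edge K * R) : is_point q -> is_point r -> posK q = posK r -> glued q r.
Proof.
case: q r => e x [f y] /(edge_itvP fl_len)[/= x0 xl] /(edge_itvP fl_len)[/= y0 yl].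
have loop_level j b (g : edge K) z w : (j <= m)%N -> g = fl_edge j b -> src g = inl (inord j) ->
    (forall z, posK (g, z) = if b then a j.+1 + z else - (a j.+1 + z)) ->
    0 <= z -> 0 <= w -> w <= 2 * a 1%N -> posK (inl (inr tt) : edge K, w) = posK (g, z) ->
    glued (inl (inr tt) : edge K, w) (g, z).
  move=> jm gE gs gp z0 w0 wl; rewrite fl_loop gp => E.
  have j0 : j = 0%N.
    apply/eqP; rewrite -leqn0 leqNgt; apply/negP => j0.
    have := @fl_lt 1%N j.+1 isT j0 jm; move: E; case: (b); lra.
  right; exists (inl ord0); move: E; rewrite j0 => E; split; last first.
    left; rewrite gs j0; split; first by case: (b) E => /= E; lra.
    by congr inl; apply: val_inj; rewrite /= inordK.
  by case: (b) E => E; [right|left]; split => //=; [congr EFin|]; lra.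
have same_level j k b (g h : edge K) z w : (j < k)%N -> (k <= m)%N ->
    (forall z, posK (g, z) = if b then a j.+1 + z else - (a j.+1 + z)) ->
    tgt g = inl (inord j.+1) -> len g = (a j.+2 - a j.+1)%:E ->
    src h = inl (inord k) -> (forall z, posK (h, z) = if b then a k.+1 + z else - (a k.+1 + z)) ->
    (z%:E <= len g)%E -> 0 <= w -> posK (g, z) = posK (h, w) -> glued (g, z) (h, w).
  move=> jk km gp gt gl hs hp zl w0; rewrite gp hp => E.
  have {}E : a j.+1 + z = a k.+1 + w by case: (b) E => // /oppr_inj.
  move: zl; rewrite gl lee_fin => zl.
  have kj : k = j.+1.
    apply/eqP; rewrite eqn_leq jk andbT leqNgt; apply/negP => kj.
    by have := @fl_lt j.+2 k.+1 isT kj km; lra.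
  right; exists (inl (inord k)); split; last by left; split => //=; move: E; rewrite kj; lra.
  by right; rewrite gl gt kj; split => //=; congr EFin; move: E; rewrite kj; lra.
have [ee|[j [b [jm je js jp jt]]]] := fl_edge_cases e;
  have [fe|[k [c [km ke ks kp kt]]]] := fl_edge_cases f => E.
- by left; move: E; rewrite ee fe !fl_loop => /addIr ->.
- move: xl E; rewrite ee /= lee_fin => xl E.
  exact: (loop_level k c).
- apply: glued_sym; move: yl E; rewrite fe /= lee_fin => yl E.
  exact: (loop_level j b).
- have bc : b = c.
    move: E; rewrite jp kp; have := @fl_gt0 j.+1; have := @fl_gt0 k.+1; rewrite /= !ltnS jm km.
    by move=> /(_ isT) ? /(_ isT) ?; case: (b); case: (c) => //; lra.
  rewrite -bc in ke kp.
  have [jk|kj|jk] := ltngtP j k.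
  + move: jt; rewrite (leq_trans jk km) => -[je1 je2].
    exact: (same_level j k b).
  + apply: glued_sym; move: kt; rewrite (leq_trans kj jm) => -[ke1 ke2].
    by apply: (same_level k j b).
  + left; rewrite je ke jk; congr (_, _).
    by move: E; rewrite jp kp jk; case: (b) => [/addrI|/oppr_inj/addrI].
Qed.

Lemma fl_folding : folding fl_al fl_sg.
Proof.
split; [exact: fl_cover|exact: fl_glued|move=> q r _ _ [-> //|[v [qv rv]]]].
have [j jm [vj ->]] := fl_vertex qv; have [k km [vk ->]] := fl_vertex rv.
move: vk; rewrite vj => -[] /(congr1 val); rewrite /= !inordK ?ltnS// => -> //.
Qed.

Lemma fl_fold_point t : fold_point fl_al fl_sg t <-> exists2 j, (j <= m)%N & t = a j.+1.
Proof.
split=> [[t0 [q [r [_ _ g Eq Er]]]]|[j jm ->]].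
  case: g => [qr|[v [qv _]]]; first by move: Er; rewrite -qr Eq; lra.
  have [j jm [_]] := fl_vertex qv; rewrite Eq gtr0_norm// => E; by exists j.
have aj : 0 < a j.+1 by apply: fl_gt0.
split => //; exists (fl_edge j true, 0), (fl_edge j false, 0).
have [s1 p1 _] := fl_edgeP true jm; have [s2 p2 _] := fl_edgeP false jm.
have v1 : at_vertex (fl_edge j true, 0) (inl (inord j)) by left.
have v2 : at_vertex (fl_edge j false, 0) (inl (inord j)) by left.
split.
- exact: (at_vertex_point fl_len v1).
- exact: (at_vertex_point fl_len v2).
- by right; exists (inl (inord j)).
- by rewrite p1 addr0.
- by rewrite p2 addr0.
Qed.

End FoldedLine.

Section Classification.
Variables (R : realType) (G : graph R).
Hypothesis lenG : forall e : edge G, (0 < len e)%E.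
Variables (al : edge G -> R) (sg : edge G -> bool).
Hypothesis FG : folding al sg.

(** Two distinct glued points lie at a vertex, so a fold point is the position of an end of an edge.
    The junk value of [fine] on a half-line only adds a candidate, which the filter tests. *)
Lemma finite_fold_points : exists s : seq R, sorted <%R s /\ forall a, a \in s <-> fold_point al sg a.
Proof.
pose cand := [seq pos al sg (e, 0) | e <- enum (edge G)] ++
  [seq pos al sg (e, fine (len e)) | e <- enum (edge G)].
pose s := sort <=%R (undup [seq a <- cand | `[< fold_point al sg a >]]).
exists s; split.
  rewrite lt_sorted_uniq_le sort_uniq undup_uniq /=.
  by apply: sort_sorted; exact: le_total.
move=> a; rewrite mem_sort mem_undup mem_filter; split=> [/andP[/asboolP]//|Aa].
apply/andP; split; first exact/asboolP.
have [a0 [[e x] [r [_ _ g Eq Er]]]] := Aa.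
rewrite mem_cat; case: g => [qr|[v [qv _]]]; first by move: Er; rewrite -qr Eq; lra.
apply/orP; case: qv => /= -[E _]; [left|right]; apply/mapP; exists e; rewrite ?mem_enum//.
  by rewrite -Eq E.
by rewrite -Eq -E.
Qed.

Theorem folding_classification :
  [\/ isometric G (line_graph R),
      exists a1 : R, 0 < a1 /\ isometric G (folded_line 1 (fun=> a1)) |
      exists (n : nat) (a : nat -> R),
        [/\ (2 <= n)%N, 0 < a 1%N,
            forall j : nat, (1 <= j < n)%N -> a j < a j.+1 &
            isometric G (folded_line n a)]].
Proof.
have [s [ss Hs]] := finite_fold_points.
case: s ss Hs => [|a1 s] ss Hs.
  constructor 1; apply: (folding_isometric lenG (@line_len R) FG (line_folding R)) => a.
  by split=> [/Hs//|/line_fold_point].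
have a10 : 0 < a1 by have [] := (Hs a1).1 (mem_head _ _).
case: s ss Hs => [|a2 s] ss Hs.
  constructor 2; exists a1; split => //.
  have mono j : (1 <= j < 1)%N -> a1 < a1 by case: j.
  apply: (folding_isometric lenG (fl_len (m := 0) (a := fun=> a1) a10 mono) FG
    (fl_folding (m := 0) (a := fun=> a1) a10 mono)) => a.
  rewrite fl_fold_point// -Hs inE; split=> [/eqP ->|[j _ ->]//]; by exists 0%N.
(* The leading 0 shifts the indices, as the breakpoints are numbered from 1. *)
constructor 3; pose b := nth 0 (0 :: [:: a1, a2 & s]); exists (size s).+2, b.
have mono j : (1 <= j < (size s).+2)%N -> b j < b j.+1.
  case: j => // j /= js; rewrite /b /=.
  by have /(sortedP 0) /(_ j) := ss; apply; rewrite /= ltnS.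
split => //; apply: (folding_isometric lenG (fl_len (m := (size s).+1) (a := b) a10 mono) FG
    (fl_folding (m := (size s).+1) (a := b) a10 mono)) => a.
rewrite fl_fold_point// -Hs; split=> [/(nthP 0)[j js <-]|[j jm ->]].
  by exists j.
by rewrite /b /=; apply: mem_nth; rewrite /= ltnS.
Qed.

End Classification.

(** * The lower bound on the graph *)

Section EdgeSets.
Variables (R : realType) (G : graph R).
Hypothesis len_gt0 : forall e : edge G, (0 < len e)%E.
Implicit Types (e : edge G).

Lemma edge_itv_bounded e d : len e = d%:E -> edge_itv e = `[0, d]%classic.
Proof. by rewrite /edge_itv => ->. Qed.

Lemma edge_itv_infinite e : len e = +oo%E -> edge_itv e = `[0, +oo[%classic.
Proof. by rewrite /edge_itv => ->. Qed.

Lemma measurable_edge e : measurable (edge_itv e).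
Proof. by rewrite /edge_itv; case: (len e) => [d| |]; exact: measurable_itv. Qed.

Lemma edge_itv0 e : edge_itv e 0.
Proof. by apply/(edge_itvP len_gt0); split => //; exact: ltW. Qed.

Lemma countable_edge_bnd e : countable (edge_itv e `\` (edge_itv e)°).
Proof.
have oo (a b : R) : `]a, b[ `<=` edge_itv e -> `]a, b[ `<=` (edge_itv e)°.
  move=> sub; rewrite -[X in X `<=` _](interior_id _).1; last exact: interval_open.
  exact: interiorS.
have [[d d0 ed]|ee] := len_cases len_gt0 e.
  apply: (@sub_countable _ _ _ [set 0; d]); last exact: finite_set_countable.
  apply: subset_card_le => x [/(edge_itvP len_gt0)[x0]]; rewrite ed lee_fin => xd nx.
  have [->|xn0] := eqVneq x 0; first by left.
  have [->|xnd] := eqVneq x d; first by right.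
  case: nx; apply: (oo 0 d); last by rewrite /= in_itv/= !lt_neqAle x0 xd (eq_sym 0) xn0 xnd.
  by move=> y /=; rewrite in_itv/= => /andP[y0 yd]; apply/(edge_itvP len_gt0); rewrite ed lee_fin !ltW.
apply: (@sub_countable _ _ _ [set 0]); last exact: finite_set_countable.
apply: subset_card_le => x [/(edge_itvP len_gt0)[x0 _] nx].
apply/eqP; rewrite eq_le x0 andbT leNgt; apply/negP => xp; apply: nx; apply: (oo 0 (x + 1)).
  by move=> y /=; rewrite in_itv/= => /andP[y0 _]; apply/(edge_itvP len_gt0); rewrite ee leey ltW.
by rewrite /= in_itv/=; apply/andP; split; lra.
Qed.

Lemma edge_sub e x y : edge_itv e x -> edge_itv e y -> `[x, y] `<=` edge_itv e.
Proof.
move=> /(edge_itvP len_gt0)[x0 _] /(edge_itvP len_gt0)[_ yl] z /=; rewrite in_itv/= => /andP[xz zy].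
apply/(edge_itvP len_gt0); split; first exact: le_trans xz.
by apply: le_trans yl; rewrite lee_fin.
Qed.

Lemma graph_max (u : edge G -> R -> R) : inhabited (edge G) -> H1_graph u ->
  exists e0 xi, edge_itv e0 xi /\ forall e x, edge_itv e x -> `|u e x| <= `|u e0 xi|.
Proof.
move=> [e1] [[cu _] Hu].
have H e : exists xi, edge_itv e xi /\ forall x, edge_itv e x -> `|u e x| <= `|u e xi|.
  have [[d d0 ed]|ee] := len_cases len_gt0 e.
    have := continuous_within_norm (cu e); rewrite (edge_itv_bounded ed) => ce.
    have [xi xid Hxi] := EVT_max (ltW d0) ce.
    by exists xi; split => // x /= xe; exact: Hxi.
  have := cu e; have := Hu e; rewrite (edge_itv_infinite ee) => He ce.
  have [xi xi0 Hxi] := H1_max_itvy He ce.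
  exists xi; split; first by rewrite /= in_itv/= xi0.
  by move=> x /=; rewrite in_itv/= andbT; exact: Hxi.
have [xi Hxi] := choice H.
have [e0 _ He0] := @arg_maxP _ R _ e1 predT (fun e => `|u e (xi e)|) isT.
exists e0, (xi e0); split; first by case: (Hxi e0).
move=> e x ex; apply: le_trans (He0 e isT).
by case: (Hxi e) => _; apply.
Qed.

Lemma sum_sub_le (a : edge G -> R) (s : seq (edge G)) : (forall e, 0 <= a e) -> uniq s ->
  \sum_(e <- s) a e <= \sum_e a e.
Proof.
move=> a0 us; rewrite big_uniq// [leLHS]big_mkcond/=.
by apply: ler_sum => e _; case: ifP.
Qed.

End EdgeSets.

Section LowerBound.
Variables (R : realType) (p mu : R) (G : graph R).
Hypotheses (mu_gt0 : 0 < mu) (p2 : 2 < p) (p6 : p < 6) (G_metric : metric_graph G)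
  (HG : forall (e : edge G) (v : vertex G),
     exists w : vertex G, at_infinity w /\ connect (joined (predC1 e)) v w).
Let len_gt0 : forall e : edge G, (0 < len e)%E. Proof. by case: G_metric. Qed.
Let deg1 : forall v : vertex G, at_infinity v -> degree v = 1%N. Proof. by case: G_metric. Qed.

Variable u : edge G -> R -> R.
Hypothesis Hu : H1_mass mu u.
Let H1u e : H1 (edge_itv e) (u e). Proof. by case: Hu => -[]. Qed.
Let cu e : {within edge_itv e, continuous (u e)}. Proof. by case: Hu => -[[]]. Qed.
Let gu : forall q r, is_point q -> is_point r -> glued q r -> u q.1 q.2 = u r.1 r.2.
Proof. by case: Hu => -[[]]. Qed.

(** Extends |u| to all vertices, with its limit value 0 at infinity, where the graph has no
    point. *)
Lemma vertex_values : exists uv : vertex G -> R, [/\ forall v, 0 <= uv v,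
  forall v, at_infinity v -> uv v = 0 &
  forall e x v, at_vertex (e, x) v -> `|u e x| = uv v].
Proof.
have H v : exists y : R, [/\ 0 <= y, at_infinity v -> y = 0 &
    forall e x, at_vertex (e, x) v -> `|u e x| = y].
  have [[e [x qv]]|none] := pselect (exists e x, at_vertex (e, x) v); last first.
    by exists 0; split => // e x ev; case: none; exists e, x.
  exists `|u e x|; split => // [vi|f y rv].
    case: qv => /= -[E ev].
      by have := src_finite deg1 e; rewrite ev vi.
    by have [] := inf_edge deg1 vi (or_intror ev); rewrite -E.
  congr `|_|; apply: (gu (q := (f, y)) (r := (e, x))).
  - exact: at_vertex_point rv.
  - exact: at_vertex_point qv.
  - by right; exists v.
have [uv Huv] := choice H.
by exists uv; split=> [v|v|e x v]; case: (Huv v) => // _ _; apply.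
Qed.

(** With [om] the value of [calib |u|] at the vertices, each ray from an end of e0 contributes at
    least [om] there, and e0 supplies the rest of the rise and the fall. The edges of the trail are
    distinct, so the contributions add up. *)
Lemma action_le_J l e0 xi : 0 < l -> edge_itv e0 xi ->
  (forall e x, edge_itv e x -> `|u e x| <= `|u e0 xi|) -> amp p l = `|u e0 xi| ->
  action p l <= \sum_e Jint p l (edge_itv e) (u e).
Proof.
move=> l0 e0x Hmax El.
have [l1 [l2 [r1 r2 un]]] := exists_trail HG e0.
have [uv [uv0 uvi uvE]] := vertex_values.
pose J e := Jint p l (edge_itv e) (u e).
have J0 e : 0 <= J e by exact: Jint_ge0.
pose om v := calib p l (uv v).
have om0 v : 0 <= om v by exact: calib_ge0.
have srcE e : om (src e) = calib p l `|u e 0| by rewrite /om -(uvE e 0)//; left.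
have tgtE e d : len e = d%:E -> om (tgt e) = calib p l `|u e d|.
  by move=> ed; rewrite /om -(uvE e d)//; right.
have tgt0 e : len e = +oo%E -> om (tgt e) = 0.
  by move=> ee; rewrite /om uvi ?calib0//; exact: tgt_infinite.
have Jdiff e : `|om (tgt e) - om (src e)| <= J e.
  rewrite srcE; have [[d d0 ed]|ee] := len_cases len_gt0 e.
    rewrite (tgtE _ _ ed); apply: (calib_J p2 l0 (measurable_edge e) (H1u e) (@cu e) (ltW d0)).
    by rewrite (edge_itv_bounded ed).
  rewrite tgt0// sub0r normrN ger0_norm ?calib_ge0//.
  have := calib_Jy p2 l0 (measurable_edge e) (H1u e) (@cu e) (lexx 0).
  rewrite subrr normr0 add0r; apply.
  by rewrite (edge_itv_infinite ee).
have omi v : at_infinity v -> om v = 0 by move=> /uvi; rewrite /om => ->; exact: calib0.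
have J1 e : om (src e) - om (tgt e) <= J e.
  by apply: le_trans (Jdiff e); rewrite distrC ler_norm.
have J2 e : om (tgt e) - om (src e) <= J e by apply: le_trans (Jdiff e); rewrite ler_norm.
have s1 := ray_sum J0 J1 J2 omi r1; have s2 := ray_sum J0 J1 J2 omi r2.
have WM : calib p l `|u e0 xi| = action p l / 2 by rewrite -El calib_amp.
have [x0 xl] := (edge_itvP len_gt0 e0 xi).1 e0x.
(* Each of the two climbs to the maximum goes from [om] at the end of e0 to [action p l / 2]. *)
have Je0 : action p l <= om (src e0) + om (tgt e0) + J e0.
  rewrite srcE; have [[d d0 ed]|ee] := len_cases len_gt0 e0.
    have xd : xi <= d by move: xl; rewrite ed lee_fin.
    have e0d : edge_itv e0 d by apply/(edge_itvP len_gt0); rewrite ed lexx ltW.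
    have := calib_J2 p2 l0 (measurable_edge e0) (H1u e0) (@cu e0) x0 xd
      (edge_sub len_gt0 (edge_itv0 len_gt0 e0) e0d).
    rewrite WM (tgtE _ _ ed) -/(J e0).
    have := ler_norm (action p l / 2 - calib p l `|u e0 0|).
    have := ler_norm (action p l / 2 - calib p l `|u e0 d|).
    by rewrite (distrC (action p l / 2) (calib p l `|u e0 d|)); lra.
  have := calib_Jy p2 l0 (measurable_edge e0) (H1u e0) (@cu e0) x0.
  rewrite (edge_itv_infinite ee) WM tgt0// -(edge_itv_infinite ee) -/(J e0) => /(_ (@subset_refl _ _)).
  by have := ler_norm (action p l / 2 - calib p l `|u e0 0|); lra.
have := sum_sub_le J0 un; rewrite big_cons big_cat /=.
by rewrite -/(J e0); lra.
Qed.

Lemma Act_sum l : 0 < l -> (forall e x, edge_itv e x -> `|u e x| <= amp p l) ->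
  \sum_e Act p l (edge_itv e) (u e) = energy p u + l / 2 * mu.
Proof.
move=> l0 uM; case: Hu => _ <-; rewrite /energy !mulr_sumr -sumrB -big_split /=.
apply: eq_bigr => e _; rewrite (ActE p2 l0 (measurable_edge e) (H1u e) (uM e)).
exact: addrAC.
Qed.

Variable lam : R.
Hypotheses (lam0 : 0 < lam) (Hlam : mass p lam = mu).

Lemma calibrated_max : exists e0 xi l, [/\ edge_itv e0 xi, 0 < l, amp p l = `|u e0 xi| &
  forall e x, edge_itv e x -> `|u e x| <= `|u e0 xi|].
Proof.
have [[e1] _ _ _] := G_metric.
have [e0 [xi [e0x Hmax]]] := graph_max len_gt0 (inhabits e1) Hu.1.
have M0 : 0 < `|u e0 xi|.
  rewrite lt0r normr_ge0 andbT; apply/eqP => E.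
  suff : mu = 0 by move/eqP; rewrite gt_eqF.
  case: Hu => _ <-; apply: big1 => e _; apply: Lpow0 => x ex.
  by apply/eqP; rewrite -normr_le0 -E; exact: Hmax.
have [l l0 El] := exists_amp p2 M0.
by exists e0, xi, l.
Qed.

Lemma energy_ge : action p lam - lam / 2 * mu <= energy p u.
Proof.
have [e0 [xi [l [e0x l0 El Hmax]]]] := calibrated_max.
have uM e x : edge_itv e x -> `|u e x| <= amp p l by rewrite El; exact: Hmax.
have S1 := action_le_J l0 e0x Hmax El.
have S2 : \sum_e Jint p l (edge_itv e) (u e) <= \sum_e Act p l (edge_itv e) (u e).
  by apply: ler_sum => e _; exact: Jint_le_Act (measurable_edge e) (H1u e).
have B : action p lam - lam / 2 * mu <= action p l - l / 2 * mu.
  have [->//|ll] := eqVneq lam l.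
  by apply: ltW; apply: action_min => //; rewrite eq_sym.
apply: le_trans B _; rewrite lerBlDr; apply: le_trans S1 _; apply: le_trans S2 _.
by rewrite Act_sum.
Qed.

(** Equality throughout [energy_ge]: the strict [action_min] forces [l = lam], and the nonnegative
    differences [Act - Jint], having sum 0, vanish on every edge. *)
Lemma energy_eq : energy p u = action p lam - lam / 2 * mu ->
  exists e0 xi, [/\ edge_itv e0 xi, amp p lam = `|u e0 xi|,
    forall e x, edge_itv e x -> `|u e x| <= `|u e0 xi| &
    forall e, {ae leb, forall x, edge_itv e x -> `|wderiv (edge_itv e) (u e) x| = slope p lam `|u e x| }].
Proof.
move=> E; have [e0 [xi [l [e0x l0 El Hmax]]]] := calibrated_max.
have uM e x : edge_itv e x -> `|u e x| <= amp p l by rewrite El; exact: Hmax.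
have S1 := action_le_J l0 e0x Hmax El.
have JA e : Jint p l (edge_itv e) (u e) <= Act p l (edge_itv e) (u e).
  exact: Jint_le_Act (measurable_edge e) (H1u e).
have S2 : \sum_e Jint p l (edge_itv e) (u e) <= \sum_e Act p l (edge_itv e) (u e).
  by apply: ler_sum => e _.
have S3 := Act_sum l0 uM; rewrite E in S3.
have ll : l = lam.
  apply/eqP; apply: contraT => ll.
  have := action_min p2 p6 lam0 Hlam l0 ll.
  move: (le_trans S1 S2); rewrite S3; lra.
rewrite ll in El S1 S2 S3 JA *; exists e0, xi; split => // e.
apply: (Act_eq_J p2 lam0 (measurable_edge e) (H1u e)); apply/eqP.
have : \sum_e (Act p lam (edge_itv e) (u e) - Jint p lam (edge_itv e) (u e)) = 0.
  by rewrite sumrB; move: S1 S2; rewrite S3; lra.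
move=> /psumr_eq0P H; rewrite -subr_eq0; apply/eqP; apply: H => // e' _.
by rewrite subr_ge0.
Qed.

End LowerBound.

(** * Rigidity *)

Section Compare.
Variables (R : realType) (p lam : R).
Hypotheses (p2 : 2 < p) (lam0 : 0 < lam).
Implicit Types (s t d l : R).
Notation slope := (slope p lam).
Notation M := (amp p lam).
Notation f := (phi p lam).

Lemma dphi_slope t : 0 <= t -> dphi p lam t = - slope (f t).
Proof. by move=> t0; rewrite (dphi_gprof p2 lam0 t0) /slope !mulNr. Qed.

Lemma slope_phi_gt0 t : 0 < t -> 0 < slope (f t).
Proof.
move=> t0; have M0 := amp_gt0 p2 lam0; rewrite /slope; apply: mulr_gt0.
  by apply: mulr_gt0 => //; rewrite sqrtr_gt0.
apply: (gprof_gt0 p2); first by rewrite divr_gt0// phi_gt0.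
by rewrite ltr_pdivrMr// mul1r -(phi0 p lam); exact: phi_lt.
Qed.

(* A bounded regularization of the derivative [1 / slope] of the inverse of [phi]. *)
Definition slowness d s : R := (Num.max (slope s) d)^-1.

Lemma max_gt0 d s : 0 < d -> 0 < Num.max (slope s) d.
Proof. by move=> d0; rewrite lt_max d0 orbT. Qed.

Lemma slowness_gt0 d s : 0 < d -> 0 < slowness d s.
Proof. by move=> d0; rewrite invr_gt0 max_gt0. Qed.

Lemma continuous_slowness d : 0 < d -> continuous (slowness d).
Proof.
move=> d0 s; apply: cvgV; first by rewrite gt_eqF// max_gt0.
apply: (@continuous_max _ _ slope (fun=> d)); last exact: cvg_cst.
exact: (@continuous_slope R p lam p2).
Qed.

Lemma slowness_slope d s : 0 < d -> 0 <= s -> slowness d s * slope s <= 1.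
Proof.
move=> d0 s0; rewrite /slowness mulrC ler_pdivrMr ?max_gt0// mul1r.
by rewrite le_max lexx.
Qed.

Lemma prim_slowness_diff d s t (c : R) : 0 < d -> 0 <= s -> s <= t ->
  (forall r, s <= r <= t -> c <= slowness d r) ->
  c * (t - s) <= prim (slowness d) t - prim (slowness d) s.
Proof.
move=> d0 s0 st H.
have dF (r : R) : s <= r <= t -> is_derive r (1 : R) (prim (slowness d)) (slowness d r).
  move=> /andP[sr _]; apply: is_derive_prim; first exact: continuous_slowness.
  exact: le_trans sr.
have [r|c' cst E] := @MVT_segment R _ (slowness d) s t st _ (is_derive_within dF).
  by rewrite in_itv/= => /andP[sr rt]; apply: dF; rewrite !ltW.
by rewrite E ler_wpM2r ?subr_ge0// H.
Qed.

(** The time that [phi] takes to fall from [M] to [phi l], up to eta. The initial time eta is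
    discarded because [slope] vanishes at [M]. *)
Lemma prim_slowness_phi l eta : 0 <= l -> 0 < eta ->
  exists d, [/\ 0 < d, d <= 1 & l - eta <= prim (slowness d) M - prim (slowness d) (f l)].
Proof.
move=> l0 eta0; have [le|lt] := leP l eta.
  exists 1; split => //; apply: (@le_trans _ _ 0); first by rewrite subr_le0.
  have := @prim_slowness_diff 1 (f l) M 0 ltr01 (ltW (phi_gt0 p2 lam0 l)) (phi_le_amp p2 lam0 l).
  by rewrite mul0r; apply => r _; exact: ltW (slowness_gt0 _ _).
have [|t0 t0i Ht0] := @EVT_min R (fun t => slope (f t)) eta l (ltW lt).
  apply: continuous_subspaceT => t; apply: (@continuous_comp R R R f slope).
    exact: (@continuous_phi R p lam p2).
  exact: (@continuous_slope R p lam p2).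
have tpos : 0 < t0 by move: t0i; rewrite in_itv/= => /andP[? _]; exact: lt_le_trans eta0 _.
(* Below the minimum of [slope] along [phi] on [eta, l], so that there the regularization is exact
   and the primitive plus t is constant. *)
pose d := Num.min 1 (slope (f t0)).
have d0 : 0 < d by rewrite lt_min ltr01 slope_phi_gt0.
exists d; split => //; first by rewrite ge_min lexx.
have dG (t : R) : eta <= t <= l -> is_derive t (1 : R) (fun t => prim (slowness d) (f t) + t) 0.
  move=> tl; have t00 : 0 <= t by case/andP: tl => ? _; apply: le_trans (ltW eta0) _.
  have dW := is_derive_prim (continuous_slowness d0) (ltW (phi_gt0 p2 lam0 t)).
  have dc := @is_derive1_comp R (prim (slowness d)) f t _ _ dW (is_derive_phi lam p2 t).
  have H := is_deriveD dc (is_derive_id t (1 : R)).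
  apply: (is_derive_eq H); rewrite (dphi_slope t00) /slowness.
  have -> : Num.max (slope (f t)) d = slope (f t).
    by apply/max_idPl; rewrite /d ge_min Ht0 ?orbT// in_itv.
  rewrite mulrN mulVf ?addNr// gt_eqF// slope_phi_gt0//.
  by case/andP: tl => ? _; exact: lt_le_trans eta0 _.
have [r|c cst E] := @MVT_segment R _ (fun=> 0) eta l (ltW lt) _ (is_derive_within dG).
  by rewrite in_itv/= => /andP[sr rt]; apply: dG; rewrite !ltW.
have := @prim_slowness_diff d (f eta) M 0 d0 (ltW (phi_gt0 p2 lam0 eta)) (phi_le_amp p2 lam0 eta).
rewrite mul0r => /(_ _) K.
have {K} : 0 <= prim (slowness d) M - prim (slowness d) (f eta).
  by apply: K => r _; exact: ltW (slowness_gt0 _ _).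
have lin (x y z s t : R) : y + s - (z + t) = 0 -> 0 <= x - z -> s - t <= x - y by clear; lra.
by move=> K; apply: (lin _ _ _ _ _ _ K); rewrite -[RHS](mul0r (l - eta)); exact: E.
Qed.

(** If s < phi l, falling from phi l to s takes a further time of at least g, uniformly in d <= 1,
    which exceeds the loss g / 2 allowed in [prim_slowness_phi]. *)
Lemma phi_compare s l : 0 <= s -> 0 <= l ->
  (forall d, 0 < d -> prim (slowness d) M - prim (slowness d) s <= l) -> f l <= s.
Proof.
move=> s0 l0 H; rewrite leNgt; apply/negP => sf.
have M0 := amp_gt0 p2 lam0.
(* Bounds both [slope] on [0, M] and every d <= 1, hence [slowness] from below. *)
pose C := Num.sqrt lam * M + 1.
have C0 : 0 < C by rewrite ltr_wpDl// mulr_ge0 ?sqrtr_ge0 ?ltW.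
pose g := (f l - s) / C.
have g0 : 0 < g by rewrite divr_gt0// subr_gt0.
have [d [d0 d1 Hd]] := prim_slowness_phi l0 (divr_gt0 g0 (ltr0Sn R 1)).
have := @prim_slowness_diff d s (f l) C^-1 d0 s0 (ltW sf).
have -> : C^-1 * (f l - s) = g by rewrite mulrC.
move=> /(_ _) K; have {K} : g <= prim (slowness d) (f l) - prim (slowness d) s.
  apply: K => r /andP[sr rf]; rewrite lef_pV2 ?posrE ?max_gt0// ge_max; apply/andP; split.
    have r0 : 0 <= r by exact: le_trans sr.
    apply: le_trans (slope_le p2 lam0 r0) _; apply: (@le_trans _ _ (Num.sqrt lam * M)); last by rewrite lerDl.
    by rewrite ler_wpM2l ?sqrtr_ge0// (le_trans rf)// phi_le_amp.
  by apply: le_trans d1 _; rewrite lerDr mulr_ge0 ?sqrtr_ge0// ltW.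
have := H d d0; move: Hd; move: (prim _ M) (prim _ s) (prim _ (f l)) => x y z.
by move: g g0 => g; clear; lra.
Qed.

(** By the chain rule the variation is at most the integral of [slowness * |u'| = slowness * slope],
    which is at most 1. *)
Lemma prim_slowness_lipschitz (I : set R) (u : R -> R) d a b : 0 < d -> measurable I ->
  H1 I u -> {within I, continuous u} ->
  {ae leb, forall x, I x -> `|wderiv I u x| = slope `|u x| } -> a <= b -> `[a, b] `<=` I ->
  `|prim (slowness d) `|u b| - prim (slowness d) `|u a| | <= b - a.
Proof.
move=> d0 mI Hu cu ae_v ab abI.
have cs := continuous_slowness d0.
have mab : measurable `[a, b] by exact: measurable_itv.
have [mu_ _] := Hu.1; have [Lv _] := wderivP Hu.
have mu' : measurable_fun `[a, b] u by exact: measurable_funS mu_.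
have mv' : measurable_fun `[a, b] (wderiv I u) by case: Lv => mv _; exact: measurable_funS mv.
have ms : measurable_fun `[a, b] (fun t => slowness d `|u t|).
  apply: (@measurableT_comp _ _ _ _ _ _ (slowness d)); first exact: continuous_measurable_fun.
  exact: measurableT_comp.
have mg : measurable_fun `[a, b] (fun t => slope `|u t|) by exact: measurable_slope.
apply: le_trans (H1_chain mI Hu cu ab abI (fun (s : R) (s0 : 0 <= s) => is_derive_prim cs s0) cs) _.
have -> : b - a = \int[leb]_(t in `[a, b]) 1.
  by rewrite (@Rintegral_FTC2 R (fun=> 1) id a b ab)//; exact: cst_continuous.
have i1 : intg `[a, b] (fun=> 1 : R) by apply: continuous_intg => x; exact: cst_continuous.
have i2 : intg `[a, b] (fun t => slowness d `|u t| * slope `|u t|).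
  apply: (@le_intg _ _ _ (fun=> 1)) => //; first exact: measurable_funM.
  move=> t _; rewrite ger0_norm; first exact: slowness_slope.
  by rewrite mulr_ge0 ?slope_ge0// ltW// slowness_gt0.
have -> : \int[leb]_(t in `[a, b]) (`|slowness d `|u t| | * `|wderiv I u t|) =
          \int[leb]_(t in `[a, b]) (slowness d `|u t| * slope `|u t|).
  congr fine; apply: ae_eq_integral => //.
  - by apply/measurable_EFinP; apply: measurable_funM; apply: measurableT_comp.
  - by apply/measurable_EFinP; exact: measurable_funM.
  have ae_f := ae_filter_ringOfSetsType (@lebesgue_measure R).
  apply: filterS ae_v => x Hx xab; rewrite Hx; last exact: abI.
  by rewrite ger0_norm// ltW// slowness_gt0.
apply: le_Rintegral => // t _; exact: slowness_slope.
Qed.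

End Compare.

(** A positive value at x would persist, up to a factor 2, on a nondegenerate segment of I ending at
    x. *)
Lemma within_Rintegral_eq0 (R : realType) (I : set R) (h : R -> R) : measurable I ->
  (forall x y, I x -> I y -> `[x, y] `<=` I) -> (forall x, I x -> exists2 y, I y & y != x) ->
  {within I, continuous h} -> intg I h -> (forall x, I x -> 0 <= h x) ->
  \int[leb]_(x in I) h x = 0 -> forall x, I x -> h x = 0.
Proof.
move=> mI cI nI ch ih h0 E x Ix; apply/eqP; rewrite eq_le h0// andbT leNgt; apply/negP => hx.
have hx2 : 0 < h x / 2 by rewrite divr_gt0.
have [d d0 Hd] := (within_continuous_distP I h).1 ch x Ix _ hx2.
have [a [b [ab abI near]]] : exists a b, [/\ a < b, `[a, b] `<=` I & forall z, a <= z <= b -> `|z - x| < d].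
  have d2 : 0 < d / 2 by rewrite divr_gt0.
  have [y Iy] := nI x Ix; rewrite neq_lt => /orP[yx|xy].
    exists (Num.max y (x - d / 2)), x; split; first by rewrite gt_max yx/=; lra.
      by move=> z /=; rewrite in_itv/= ge_max => /andP[/andP[yz _] zx]; apply: (cI y x Iy Ix); rewrite /= in_itv/= yz.
    by move=> z; rewrite ge_max => /andP[/andP[_ z1] z2]; rewrite ler0_norm; lra.
  exists x, (Num.min y (x + d / 2)); split; first by rewrite lt_min xy/=; lra.
    by move=> z /=; rewrite in_itv/= le_min => /andP[xz /andP[zy _]]; apply: (cI x y Ix Iy); rewrite /= in_itv/= xz.
  by move=> z; rewrite le_min => /andP[z1 /andP[_ z2]]; rewrite ger0_norm; lra.
have mab : measurable `[a, b] by exact: measurable_itv.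
have i1 : intg `[a, b] (fun=> h x / 2) by apply: continuous_intg => z; exact: cst_continuous.
have := le_Rintegral_subset mab mI abI ih h0; rewrite E.
have : \int[leb]_(z in `[a, b]) (h x / 2) <= \int[leb]_(z in `[a, b]) h z.
  apply: le_Rintegral => //; first exact: intgS ih.
  move=> z zab; have Iz := abI _ zab; move: zab; rewrite /= in_itv/= => /near /(Hd z Iz).
  by rewrite ler_norml => /andP[+ _]; lra.
have -> : \int[leb]_(z in `[a, b]) (h x / 2) = h x / 2 * b - h x / 2 * a.
  apply: (@Rintegral_FTC2 R (fun=> h x / 2) (fun z => h x / 2 * z) a b (ltW ab)); first exact: cst_continuous.
  by move=> z; apply: (is_derive_eq (is_deriveZ (h x / 2) (is_derive_id z (1 : R)))); rewrite /GRing.scale/= mulr1.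
have : 0 < h x / 2 * (b - a) by rewrite mulr_gt0 ?subr_gt0// divr_gt0.
lra.
Qed.

Section Rigidity.
Variables (R : realType) (p lam : R) (G : graph R).
Hypotheses (p2 : 2 < p) (lam0 : 0 < lam) (G_metric : metric_graph G)
  (HG : forall (e : edge G) (v : vertex G),
     exists w : vertex G, at_infinity w /\ connect (joined (predC1 e)) v w).
Let len_gt0 : forall e : edge G, (0 < len e)%E. Proof. by case: G_metric. Qed.
Let deg1 : forall v : vertex G, at_infinity v -> degree v = 1%N. Proof. by case: G_metric. Qed.
Notation f := (phi p lam).

Variable u : edge G -> R -> R.
Hypothesis Hu : H1_mass (mass p lam) u.
Let H1u e : H1 (edge_itv e) (u e). Proof. by case: Hu => -[]. Qed.
Let cu e : {within edge_itv e, continuous (u e)}. Proof. by case: Hu => -[[]]. Qed.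
Let gu : forall q r, is_point q -> is_point r -> glued q r -> u q.1 q.2 = u r.1 r.2.
Proof. by case: Hu => -[[]]. Qed.

Variables (e0 : edge G) (xi : R).
Hypotheses (e0x : edge_itv e0 xi) (u_max : amp p lam = `|u e0 xi|)
  (slope_eq : forall e, {ae leb, forall x, edge_itv e x -> `|wderiv (edge_itv e) (u e) x| = slope p lam `|u e x| }).

(** The edgewise Lipschitz bound adds up along a walk, as u agrees at glued points. *)
Lemma walk_lipschitz d q r l : 0 < d -> walk q r l -> is_point q ->
  0 <= l /\ prim (slowness p lam d) `|u q.1 q.2| - prim (slowness p lam d) `|u r.1 r.2| <= l.
Proof.
move=> d0; elim=> [q1 q2 g|q1 e x y q2 l' g ex ey _ IH] q1p.
  by rewrite (gu q1p (glued_point len_gt0 g q1p) g) subrr.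
have [l0 IHl] := IH ey; rewrite (gu q1p (ex : is_point (e, x)) g) /= in IHl *.
split; first by rewrite addr_ge0.
have lip a b : edge_itv e a -> edge_itv e b -> a <= b ->
    `|prim (slowness p lam d) `|u e b| - prim (slowness p lam d) `|u e a| | <= b - a.
  move=> ea eb ab; apply: (prim_slowness_lipschitz p2 lam0 d0 (measurable_edge e) (H1u e) (@cu e)) => //.
  exact: edge_sub.
suff : prim (slowness p lam d) `|u e x| - prim (slowness p lam d) `|u e y| <= `|x - y| by lra.
have [xy|/ltW yx] := leP x y.
  rewrite (distrC x) (@ger0_norm _ (y - x)) ?subr_ge0//; apply: (le_trans _ (lip _ _ ex ey xy)).
  by rewrite distrC ler_norm.
by rewrite (@ger0_norm _ (x - y)) ?subr_ge0//; apply: (le_trans _ (lip _ _ ey ex yx)); rewrite ler_norm.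
Qed.

Lemma walk_phi e x l : walk (e0, xi) (e, x) l -> f l <= `|u e x|.
Proof.
move=> W; apply: (phi_compare p2 lam0) => //; first by case: (walk_lipschitz ltr01 W e0x).
by move=> d d0; have [_] := walk_lipschitz d0 W e0x; rewrite -u_max.
Qed.

Section Fold.
Variables (T : pred (edge G)) (al : edge G -> R) (sg : edge G -> bool).
Notation pos := (pos al sg).
Hypotheses (T0 : T e0) (pos0 : pos (e0, xi) = 0)
  (C1 : forall t, exists e x, [/\ T e, edge_itv e x & pos (e, x) = t])
  (C2 : forall e x f y, T e -> T f -> edge_itv e x -> edge_itv f y ->
    pos (e, x) = pos (f, y) -> glued (e, x) (f, y)).

Lemma fold_phi e x : T e -> edge_itv e x -> f (pos (e, x)) <= `|u e x|.
Proof.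
move=> Te ex; have := walk_fold_dist len_gt0 C1 C2 T0 Te e0x ex.
by move/walk_phi; rewrite pos0 sub0r normrN phi_norm.
Qed.

(** The part of the line covered by e, as a preimage under the inverse of [pos] on e. *)
Let J e := affine (sg e) (if sg e then - al e else al e) @^-1` edge_itv e.

Lemma continuous_pullback e : continuous (fun x => f (pos (e, x)) ^+ 2).
Proof.
move=> x; apply: (@continuous_comp R R R (fun x => pos (e, x)) (fun s => f s ^+ 2)).
  exact: (@continuous_affine R (sg e) (al e)).
by apply: cvgM; exact: (@continuous_phi R p lam p2).
Qed.

Lemma integral_edge e : (\int[leb]_(x in edge_itv e) (f (pos (e, x)) ^+ 2)%:E =
  \int[leb]_t ((fun s => (f s ^+ 2)%:E) \_ (J e)) t)%E.
Proof.
rewrite -integral_mkcond.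
rewrite (ge0_integral_affine (sg e) (if sg e then - al e else al e) (measurable_edge e)).
- apply: eq_integral => t _; congr ((f _ ^+ 2)%:E).
  by rewrite /pos /affine /=; case: (sg e); ring.
- apply/measurable_EFinP; apply: measurable_funTS; apply: continuous_measurable_fun.
  exact: continuous_pullback.
- by move=> x _; rewrite lee_fin sqr_ge0.
Qed.

Lemma measurable_pullback e : measurable_fun (edge_itv e) (fun x => f (pos (e, x)) ^+ 2).
Proof.
apply: measurable_funTS; apply: continuous_measurable_fun; exact: continuous_pullback.
Qed.

(** The sets [J e] for e in [T] cover the line by [C1]; a position covered several times only
    increases the sum. *)
Lemma mass_le_sum :
  ((mass p lam)%:E <= \sum_(e | T e) \int[leb]_(x in edge_itv e) (f (pos (e, x)) ^+ 2)%:E)%E.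
Proof.
have mJ e : measurable (J e).
  by rewrite /J -[_ @^-1` _]setTI; apply: measurable_affine => //; exact: measurable_edge.
have mf : measurable_fun setT (fun s => (f s ^+ 2)%:E).
  apply/measurable_EFinP; apply: continuous_measurable_fun => x.
  by apply: cvgM; exact: (@continuous_phi R p lam p2).
have mr e : measurable_fun setT ((fun s => (f s ^+ 2)%:E) \_ (J e)).
  by apply/(measurable_restrict _ _ _).1 => //; exact: measurable_funTS.
have r0 e t : (0 <= ((fun s => (f s ^+ 2)%:E) \_ (J e)) t)%E.
  by rewrite patchE; case: ifP => // _; rewrite lee_fin sqr_ge0.
rewrite -(integralT_phi2 p2 lam0).
under eq_bigr => e _ do rewrite integral_edge.
rewrite -big_filter -ge0_integral_sum//.
apply: ge0_le_integral => //.
- by move=> t _; rewrite lee_fin sqr_ge0.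
- exact: emeasurable_sum.
move=> t _; have [e [x [Te ex E]]] := C1 t.
rewrite big_filter (bigD1 e)//= patchE ifT.
  by rewrite leeDl// sume_ge0.
rewrite inE /J /=; suff -> : affine (sg e) (if sg e then - al e else al e) t = x by [].
by rewrite -E /pos /affine /=; case: (sg e); ring.
Qed.

Let intg_sq e : intg (edge_itv e) (fun x => u e x ^+ 2).
Proof. by apply: L2_sq; [exact: measurable_edge|case: (H1u e)]. Qed.

Let intg_pullback e : T e -> intg (edge_itv e) (fun x => f (pos (e, x)) ^+ 2).
Proof.
move=> Te; apply: (@le_intg _ _ _ (fun x => u e x ^+ 2)); first exact: measurable_edge.
- exact: measurable_pullback.
- move=> x ex; rewrite ger0_norm ?sqr_ge0// -(real_normK (num_real (u e x))).
  by rewrite lerXn2r ?nnegrE ?fold_phi// ltW// phi_gt0.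
- exact: intg_sq.
Qed.

Let edge_convex (e : edge G) x y : edge_itv e x -> edge_itv e y -> `[x, y] `<=` edge_itv e.
Proof. exact: edge_sub. Qed.

Let edge_other (e : edge G) x : edge_itv e x -> exists2 y, edge_itv e y & y != x.
Proof.
move=> ex; have [->|x0] := eqVneq x 0; last by exists 0; [exact: edge_itv0|rewrite eq_sym].
have [[d d0 ed]|ee] := len_cases len_gt0 e.
  by exists d; [apply/(edge_itvP len_gt0); rewrite ed lexx ltW|rewrite gt_eqF].
by exists 1; [apply/(edge_itvP len_gt0); rewrite ee leey ler01|rewrite oner_eq0].
Qed.

Let sq_within e : {within edge_itv e, continuous (fun x => u e x ^+ 2)}.
Proof. by move=> x; apply: cvgM; exact: cu. Qed.

(** The trail alone carries at least [mass p lam], which is the whole mass of u. As phi^2 <= u^2 on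
    the trail, the integrals agree edge by edge, and continuity gives pointwise equality. *)
Lemma fold_eq : (forall e x, T e -> edge_itv e x -> `|u e x| = f (pos (e, x))) /\
  (forall e x, ~~ T e -> edge_itv e x -> u e x = 0).
Proof.
pose P e := if T e then \int[leb]_(x in edge_itv e) (f (pos (e, x)) ^+ 2) else 0.
pose U e := \int[leb]_(x in edge_itv e) (u e x ^+ 2).
have mono e x : T e -> edge_itv e x -> f (pos (e, x)) ^+ 2 <= u e x ^+ 2.
  move=> Te ex; rewrite -(real_normK (num_real (u e x))).
  by rewrite lerXn2r ?nnegrE ?fold_phi// ltW// phi_gt0.
have PU e : P e <= U e.
  rewrite /P; case: ifPn => Te; last by apply: Rintegral_ge0 => x _; exact: sqr_ge0.
  apply: le_Rintegral => //; first exact: measurable_edge.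
  - exact: intg_pullback.
  - by move=> x; exact: mono.
have UM : \sum_e U e = mass p lam.
  case: Hu => _ <-; apply: eq_bigr => e _; by rewrite /Lpow Rintegral_powR2.
have MP : mass p lam <= \sum_e P e.
  have := mass_le_sum; rewrite -big_mkcond/= -lee_fin -sumEFin.
  move=> /le_trans; apply; apply: lee_sum => e Te.
  by rewrite integral_Rintegral//; [exact: measurable_edge|exact: intg_pullback].
have Z e : U e = P e.
  have : \sum_e (U e - P e) = 0.
    apply/eqP; rewrite eq_le sumr_ge0 ?andbT; last by move=> *; rewrite subr_ge0.
    by rewrite sumrB UM subr_le0.
  move=> /psumr_eq0P H; apply/eqP; rewrite -subr_eq0; apply/eqP; apply: H => // e' _.
  by rewrite subr_ge0.
split=> e x Te ex.
  have : u e x ^+ 2 - f (pos (e, x)) ^+ 2 = 0.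
    apply: (@within_Rintegral_eq0 R (edge_itv e) (fun x => u e x ^+ 2 - f (pos (e, x)) ^+ 2)) => //.
    - exact: measurable_edge.
    - exact: edge_convex.
    - exact: edge_other.
    - have c2 : {within edge_itv e, continuous (fun x => f (pos (e, x)) ^+ 2)}.
        by apply: continuous_subspaceT; exact: continuous_pullback.
      by move=> y; apply: cvgB; [exact: sq_within|exact: c2].
    - by apply: intgB => //; [exact: measurable_edge|exact: intg_pullback].
    - by move=> y ey; rewrite subr_ge0 mono.
    - rewrite RintegralB//; [|exact: measurable_edge|exact: intg_pullback].
      by apply/eqP; rewrite subr_eq0; apply/eqP; have := Z e; rewrite /P Te.
  move=> /subr0_eq; rewrite -(real_normK (num_real (u e x))) => /eqP.
  by rewrite eqrXn2// => [/eqP//|]; rewrite ltW// phi_gt0.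
apply/eqP; rewrite -sqrf_eq0; apply/eqP.
apply: (@within_Rintegral_eq0 R (edge_itv e) (fun x => u e x ^+ 2)) => //.
- exact: measurable_edge.
- exact: edge_convex.
- exact: edge_other.
- by move=> y _; exact: sqr_ge0.
- by have := Z e; rewrite /P (negbTE Te).
Qed.

Let incident (e : edge G) v := src e = v \/ tgt e = v.

(** At a finite vertex, |u| would be both a value of [phi], hence positive, and 0 on an edge outside
    [T]. A vertex at infinity has a single edge. *)
Lemma incident_fold e g v : T e -> incident e v -> incident g v -> T g.
Proof.
have [TE T0'] := fold_eq.
move=> Te ev gv; have [vi|vf] := boolP (at_infinity v).
  have [ee et] := inf_edge deg1 vi ev; have [ge gt] := inf_edge deg1 vi gv.
  have : (#|[pred k : edge G | tgt k == v]| <= 1)%N.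
    by have := deg1 vi; rewrite /degree; lia.
  move=> /card_le1_eqP /(_ e g); rewrite !inE et gt eqxx => /(_ isT isT) E.
  by have -> : g = e by exact: E.
have end_ k : incident k v -> exists x, at_vertex (k, x) v.
  case=> kv; first by exists 0; left.
  have [[d d0 kd]|ke] := len_cases len_gt0 k; first by exists d; right.
  by move: vf; rewrite -kv tgt_infinite.
have [x ex] := end_ _ ev; have [y gy] := end_ _ gv.
apply: contraT => Tg.
have ix := at_vertex_point len_gt0 ex; have iy := at_vertex_point len_gt0 gy.
have := gu ix iy (or_intror (ex_intro _ v (conj ex gy))); rewrite /= (T0' g y Tg iy) => u0.
by have := TE e x Te ix; rewrite u0 normr0 => H; have := phi_gt0 p2 lam0 (pos (e, x)); rewrite -H ltxx.
Qed.

Lemma fold_all e : T e.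
Proof.
pose Q v := `[< forall k, incident k v -> T k >].
have step v w : joined predT v w -> Q v -> Q w.
  move=> /existsP[k /andP[_ /orP[]]] /andP[/eqP kv /eqP kw] /asboolP Qv; apply/asboolP => g gw.
    by apply: (incident_fold (Qv k (or_introl kv)) _ gw); right.
  by apply: (incident_fold (Qv k (or_intror kw)) _ gw); left.
have [_ _ _ con] := G_metric.
have /connectP[s ps E] := con (src e0) (src e).
have : Q (src e0) by apply/asboolP => g gv; apply: (incident_fold T0 _ gv); left.
elim: s (src e0) ps E => [|w s IH] v /= => [_ <- /asboolP|/andP[vw ps] E Qv].
  by apply; left.
by apply: (IH w) => //; exact: step vw Qv.
Qed.

(** Glued points have the same |u|, that is the same value of [phi] at |pos|, and [phi] is injective
    there. *)
Lemma fold_folding : folding al sg.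
Proof.
have [TE _] := fold_eq; split.
- by move=> t; have [e [x [_ ex E]]] := C1 t; exists e, x.
- by move=> [e x] [g y] ex gy; apply: C2; rewrite ?fold_all.
- move=> [e x] [g y] ex gy /(gu ex gy) /= E.
  have := TE e x (fold_all e) ex; rewrite E (TE g y (fold_all g) gy).
  rewrite -(phi_norm p lam (pos (e, x))) -(phi_norm p lam (pos (g, y))) => H.
  by apply/esym; apply: (phi_inj p2 lam0 _ _ H).
Qed.

End Fold.

Lemma rigidity : exists al sg, folding (G := G) al sg.
Proof.
have [l1 [l2 [r1 r2 un]]] := exists_trail HG e0.
have [al [sg [p0 C1 C2]]] := partial_fold len_gt0 deg1 e0x r1 r2 un.
exists al, sg; apply: (@fold_folding (mem (e0 :: edges l1 ++ edges l2))) => //.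
by rewrite inE mem_head.
Qed.

End Rigidity.

(** * The upper bound *)

Section Shift.
Variables (R : realType) (k : R -> R).
Hypotheses (ck : continuous k) (k0 : forall x, 0 <= k x) (ik : intg setT k).
Implicit Types s : R.

Let mk D : measurable_fun D k.
Proof. by apply: measurable_funTS; exact: continuous_measurable_fun. Qed.

Lemma integral_shift s :
  (\int[leb]_(x in `[0%R, +oo[) (k (s + x))%:E = \int[leb]_(x in `[s, +oo[) (k x)%:E)%E.
Proof.
rewrite [RHS](ge0_integral_affine true s).
- congr (integral _ _ _); apply/seteqP; split=> x /=; rewrite !in_itv/= !andbT /affine; lra.
- exact: measurable_itv.
- by apply/measurable_EFinP.
- by move=> x _; rewrite lee_fin.
Qed.

Lemma intg_half s : intg `[s, +oo[ k.
Proof. by apply: (intgS _ _ _ ik) => //; exact: measurable_itv. Qed.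

Lemma intg_shift s : intg `[0, +oo[ (fun x => k (s + x)).
Proof.
apply/integrableP; split.
  apply/measurable_EFinP; apply: measurable_funTS; apply: continuous_measurable_fun => x.
  by apply: (@continuous_comp R R R (fun x => s + x) k); [apply: cvgD; [exact: cvg_cst|exact: cvg_id]|exact: ck].
under eq_integral => x _ do rewrite /= ger0_norm//.
rewrite integral_shift; have /integrableP[_] := intg_half s.
by under eq_integral => x _ do rewrite /= ger0_norm//.
Qed.

Lemma Rintegral_shift s :
  \int[leb]_(x in `[0, +oo[) k (s + x) = \int[leb]_(x in `[s, +oo[) k x.
Proof. by rewrite /Rintegral integral_shift. Qed.

Lemma cvg_shift_away : \int[leb]_(x in `[0, +oo[) k (n%:R + x) @[n --> \oo] --> (0 : R).
Proof.
apply/cvgrPdist_le => e e0.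
have [m Hm] := Rintegral_tail measurableT ik (fun x _ => k0 x) e0.
exists m.+1 => // n /= mn; rewrite Rintegral_shift sub0r normrN ger0_norm; last by apply: Rintegral_ge0 => x _; exact: k0.
apply: Hm => //.
move=> x /=; rewrite in_itv/= andbT => nx; apply: lt_le_trans (ler_norm x); apply: lt_le_trans nx.
by rewrite ltr_nat.
Qed.

Lemma cvg_shift_towards :
  \int[leb]_(x in `[0, +oo[) k (- n%:R + x) @[n --> \oo] --> \int[leb]_x k x.
Proof.
apply/cvgrPdist_le => e e0.
have [m Hm] := Rintegral_tail measurableT ik (fun x _ => k0 x) e0.
exists m => // n /= mn; rewrite Rintegral_shift.
have E : [set: R] = `]-oo, (- n%:R)[ `|` `[(- n%:R), +oo[.
  by apply/seteqP; split=> x //= _; rewrite !in_itv/= andbT; case: (ltP x (- n%:R)); [left|right].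
have dis : [disjoint (`]-oo, (- n%:R)[ : set R) & (`[(- n%:R), +oo[ : set R)].
  by apply/disj_setPS => x /= []; rewrite !in_itv/= andbT => a b; move: (lt_le_trans a b); rewrite ltxx.
have -> : \int[leb]_x k x = \int[leb]_(x in `]-oo, (- n%:R)[) k x + \int[leb]_(x in `[(- n%:R), +oo[) k x.
  by rewrite -Rintegral_setU -?E//; exact: measurable_itv.
rewrite addrK ger0_norm; last by apply: Rintegral_ge0 => x _; exact: k0.
apply: Hm => // x /=; rewrite in_itv/= => xn; rewrite ltrNr in xn.
apply: (@le_lt_trans _ _ n%:R); first by rewrite ler_nat.
by apply: lt_le_trans xn _; rewrite -normrN ler_norm.
Qed.

End Shift.

Lemma cvg_sumr (R : realType) (I : Type) (s : seq I) (F : I -> nat -> R) (l : I -> R) :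
  (forall i, F i n @[n --> \oo] --> l i) -> \sum_(i <- s) F i n @[n --> \oo] --> \sum_(i <- s) l i.
Proof.
move=> H; elim: s => [|i s IH].
  by rewrite big_nil; under eq_fun do rewrite big_nil; exact: cvg_cst.
by rewrite big_cons; under eq_fun do rewrite big_cons; apply: cvgD.
Qed.

Section UpperBound.
Variables (R : realType) (p lam : R) (G : graph R).
Hypotheses (p2 : 2 < p) (lam0 : 0 < lam) (len_gt0 : forall e : edge G, (0 < len e)%E).
Variable e1 : edge G.
Hypothesis e1_inf : len e1 = +oo%E.
Notation f := (phi p lam).
Notation df := (dphi p lam).
Implicit Types (e : edge G) (n : nat) (c : R).

(* A soliton centred at coordinate n of the half-line [e1]; it is even, so that
   its values at all vertices agree if it is continued by [f (n + x)]. *)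
Definition offset n e (x : R) : R :=
  (if e == e1 then - n%:R else n%:R) + (if len e == +oo%E then x else 0).

Let w e : R := (len e == +oo%E)%:R.

Lemma offset_infinite n e x : len e = +oo%E ->
  offset n e x = (if e == e1 then - n%:R else n%:R) + x.
Proof. by rewrite /offset => ->. Qed.

Lemma offset_bounded n e x (d : R) : len e = d%:E -> offset n e x = n%:R.
Proof.
rewrite /offset => ed; rewrite ed /= addr0; case: eqP => // E.
by move: ed; rewrite E e1_inf.
Qed.

Lemma is_derive_offset n e x : is_derive x (1 : R) (offset n e) (w e).
Proof.
rewrite /offset /w; case: (len e == _) => /=.
  apply: (is_derive_eq (is_deriveD (is_derive_cst _ x (1 : R)) (is_derive_id x (1 : R)))).
  by rewrite add0r.
apply: (is_derive_eq (is_deriveD (is_derive_cst _ x (1 : R)) (is_derive_cst _ x (1 : R)))).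
by rewrite add0r.
Qed.

Lemma continuous_offset n e : continuous (offset n e).
Proof.
move=> x; apply: differentiable_continuous; apply/derivable1_diffP.
by have := is_derive_offset n e x => ?; exact: ex_derive.
Qed.

Section Profile.
Variable k : R -> R.
Hypotheses (ck : continuous k) (k0 : forall x, 0 <= k x) (ik : intg setT k).

Lemma continuous_offset_comp n e : continuous (fun x => k (offset n e x)).
Proof. by move=> x; apply: (@continuous_comp R R R (offset n e) k); [exact: continuous_offset|exact: ck]. Qed.

Lemma intg_offset n e : intg (edge_itv e) (fun x => k (offset n e x)).
Proof.
have [[d d0 ed]|ee] := len_cases len_gt0 e.
  by rewrite (edge_itv_bounded ed); apply: continuous_intg; apply: continuous_subspaceT; exact: continuous_offset_comp.
under eq_fun do rewrite offset_infinite//.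
by rewrite (edge_itv_infinite ee); exact: intg_shift.
Qed.

Lemma cvg_offset e : k n%:R @[n --> \oo] --> (0 : R) ->
  \int[leb]_(x in edge_itv e) k (offset n e x) @[n --> \oo] --> (if e == e1 then \int[leb]_x k x else 0).
Proof.
move=> kn; have [[d d0 ed]|ee] := len_cases len_gt0 e.
  rewrite ifF; last by apply/eqP => E; move: ed; rewrite E e1_inf.
  have E n : \int[leb]_(x in edge_itv e) k (offset n e x) = d * k n%:R.
    rewrite (edge_itv_bounded ed).
    under eq_Rintegral do rewrite (offset_bounded _ _ ed).
    transitivity (k n%:R * d - k n%:R * 0); last ring.
    apply: (@Rintegral_FTC2 R (fun=> k n%:R) (fun z => k n%:R * z) 0 d (ltW d0)).
      exact: cst_continuous.
    by move=> z; apply: (is_derive_eq (is_deriveZ (k n%:R) (is_derive_id z (1 : R)))); rewrite /GRing.scale/= mulr1.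
  under eq_fun do rewrite E.
  by rewrite -[0](mulr0 d); apply: cvgM => //; exact: cvg_cst.
have E n : \int[leb]_(x in edge_itv e) k (offset n e x) =
    \int[leb]_(x in `[0, +oo[) k ((if e == e1 then - n%:R else n%:R) + x).
  by rewrite (edge_itv_infinite ee); apply: eq_Rintegral => x _; rewrite offset_infinite.
under eq_fun do rewrite E.
by case: (e == e1); [exact: cvg_shift_towards|exact: cvg_shift_away].
Qed.

End Profile.

Let sqf x := f x ^+ 2.
Let sqdf x := df x ^+ 2.
Let powf x := f x `^ p.

Let csqf : continuous sqf.
Proof. by move=> x; apply: cvgM; exact: (@continuous_phi R p lam p2). Qed.
Let csqdf : continuous sqdf.
Proof. by move=> x; apply: cvgM; exact: (@continuous_dphi R p lam p2 lam0). Qed.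
Let p_gt0 : 0 < p. Proof. exact: lt_trans p2. Qed.
Let cpowf : continuous powf.
Proof.
have -> : powf = fun x => `|f x| `^ p by apply/funext => x; rewrite /powf ger0_norm// ltW// phi_gt0.
move=> x; apply: (@continuous_comp R R R f (fun r => `|r| `^ p)); first exact: (@continuous_phi R p lam p2).
exact: continuous_powR_norm.
Qed.
Let isqf : intg setT sqf. Proof. by apply: L2_sq => //; exact: L2_phi. Qed.
Let isqdf : intg setT sqdf. Proof. by apply: L2_sq => //; exact: L2_dphi. Qed.
Let ipowf : intg setT powf. Proof. exact: intg_phip. Qed.
Let sqf0 x : 0 <= sqf x. Proof. exact: sqr_ge0. Qed.
Let sqdf0 x : 0 <= sqdf x. Proof. exact: sqr_ge0. Qed.
Let powf0 x : 0 <= powf x. Proof. exact: powR_ge0. Qed.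

(** The factor c serves to restore the mass exactly. *)
Definition translate c n e (x : R) : R := c * f (offset n e x).

Let m n := \sum_e \int[leb]_(x in edge_itv e) sqf (offset n e x).
Let D n := \sum_e w e * \int[leb]_(x in edge_itv e) sqdf (offset n e x).
Let P n := \sum_e \int[leb]_(x in edge_itv e) powf (offset n e x).

Let is_derive_translate c n e x :
  is_derive x (1 : R) (translate c n e) (c * w e * df (offset n e x)).
Proof.
have dc := @is_derive1_comp R f (offset n e) x _ _ (is_derive_phi lam p2 (offset n e x)) (is_derive_offset n e x).
apply: (is_derive_eq (is_deriveZ c dc)); rewrite /GRing.scale/=; ring.
Qed.

Let L2_offset e (g : R -> R) : continuous g -> intg (edge_itv e) (fun x => g x ^+ 2) -> L2 (edge_itv e) g.
Proof.
move=> cg ig; split; first by apply: measurable_funTS; exact: continuous_measurable_fun.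
have /integrableP[_] := ig; apply: le_lt_trans; rewrite le_eqVlt; apply/orP; left; apply/eqP.
by apply: eq_integral => x _; rewrite /= normrX.
Qed.

Let H1_translate c n e : H1 (edge_itv e) (translate c n e) /\
  \int[leb]_(x in edge_itv e) (wderiv (edge_itv e) (translate c n e) x ^+ 2) =
  c ^+ 2 * (w e * \int[leb]_(x in edge_itv e) sqdf (offset n e x)).
Proof.
have cdu : continuous (fun x => c * w e * df (offset n e x)).
  move=> x; apply: cvgM; first exact: cvg_cst.
  apply: (@continuous_comp R R R (offset n e) df); first exact: continuous_offset.
  exact: (@continuous_dphi R p lam p2 lam0).
have cu : continuous (translate c n e).
  move=> x; apply: cvgM; first exact: cvg_cst.
  apply: (@continuous_comp R R R (offset n e) f); first exact: continuous_offset.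
  exact: (@continuous_phi R p lam p2).
have ww : w e ^+ 2 = w e by rewrite /w; case: (_ == _); rewrite ?expr1n ?expr0n.
have Edu x : (c * w e * df (offset n e x)) ^+ 2 = c ^+ 2 * w e * sqdf (offset n e x).
  by rewrite 2!exprMn ww.
have iE := intg_offset csqdf sqdf0 isqdf n e.
have [||H1t E2] := H1_C1 (measurable_edge e) (countable_edge_bnd len_gt0 e) (is_derive_translate c n e) cdu.
- apply: L2_offset; first exact: cu.
  under eq_fun do rewrite exprMn.
  by apply: intgZ; [exact: measurable_edge|exact: intg_offset csqf sqf0 isqf n e].
- apply: L2_offset; first exact: cdu.
  under eq_fun do rewrite Edu.
  by apply: intgZ; [exact: measurable_edge|exact: iE].
split => //; apply: (etrans E2); under eq_Rintegral do rewrite Edu.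
by rewrite RintegralZl ?mulrA//; exact: measurable_edge.
Qed.

Let translate_mass c n : \sum_e Lpow 2 (edge_itv e) (translate c n e) = c ^+ 2 * m n.
Proof.
rewrite mulr_sumr; apply: eq_bigr => e _; rewrite /Lpow Rintegral_powR2.
under eq_Rintegral do rewrite exprMn.
by rewrite RintegralZl; [|exact: measurable_edge|exact: intg_offset csqf sqf0 isqf n e].
Qed.

Let translate_H1 c n : H1_graph (translate c n).
Proof.
split; last by move=> e; case: (H1_translate c n e).
have val e x v : at_vertex (e, x) v -> translate c n e x = c * f n%:R.
  rewrite /translate /offset => -[[/= -> _]|[/= E _]].
    by rewrite if_same addr0; case: (e == e1); rewrite ?phiN.
  by rewrite -E /= addr0; case: (e == e1); rewrite ?phiN.
split; last first.
  move=> [e x] [g y] _ _ [[<- <-]|[v [/val ev /val gv]]]; first by [].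
  by rewrite /fst /snd ev gv; reflexivity.
move=> e.
apply: continuous_subspaceT => x; apply: differentiable_continuous; apply/derivable1_diffP.
by have := is_derive_translate c n e x => ?; exact: ex_derive.
Qed.

Let translate_energy c n : 0 <= c ->
  energy p (translate c n) = 2^-1 * (c ^+ 2 * D n) - p^-1 * (c `^ p * P n).
Proof.
move=> c0; rewrite /energy; congr (_ * _ - _ * _); rewrite mulr_sumr; apply: eq_bigr => e _.
  by rewrite /Lpow Rintegral_powR2; case: (H1_translate c n e).
have E x : `|translate c n e x| `^ p = c `^ p * powf (offset n e x).
  have fx : 0 <= f (offset n e x) by rewrite ltW// phi_gt0.
  by rewrite /translate normrM (ger0_norm c0) (ger0_norm fx) powRM.
rewrite /Lpow; under eq_Rintegral do rewrite E.
by rewrite RintegralZl; [|exact: measurable_edge|exact: intg_offset cpowf powf0 ipowf n e].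
Qed.

Let f_cvg : f n%:R @[n --> \oo] --> (0 : R).
Proof. apply: (cvg_comp _ _ (@cvgr_idn R)); exact: phi_cvg0. Qed.

Let sum_e1 (a : R) : \sum_e (if e == e1 then a else 0) = a.
Proof. by rewrite -big_mkcond/= big_pred1_eq. Qed.

Let m_cvg : m n @[n --> \oo] --> mass p lam.
Proof.
have -> : mass p lam = \sum_e (if e == e1 then \int[leb]_x sqf x else 0).
  by rewrite sum_e1 /Rintegral integralT_phi2.
apply: cvg_sumr => e; apply: cvg_offset => //.
by rewrite -[0](mulr0 0); apply: cvgM.
Qed.

Let D_cvg : D n @[n --> \oo] --> action p lam.
Proof.
have -> : action p lam = \sum_e w e * (if e == e1 then \int[leb]_x sqdf x else 0).
  transitivity (\sum_e (if e == e1 then action p lam else 0)); first by rewrite sum_e1.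
  apply: eq_bigr => e _; case: eqP => [->|_]; last by rewrite mulr0.
  by rewrite /w e1_inf eqxx mul1r /Rintegral integralT_dphi2.
apply: cvg_sumr => e; apply: cvgM; first exact: cvg_cst.
apply: cvg_offset => //; apply/cvgrPdist_le => eps eps0.
have lf : Num.sqrt lam * f n%:R @[n --> \oo] --> (0 : R).
  by rewrite -[0](mulr0 (Num.sqrt lam)); apply: cvgM; [exact: cvg_cst|exact: f_cvg].
have /cvgrPdist_le /(_ eps eps0) : (Num.sqrt lam * f n%:R) ^+ 2 @[n --> \oo] --> (0 : R).
  by rewrite -[0](mulr0 0); apply: cvgM.
apply: filterS => n; rewrite !sub0r !normrN !ger0_norm ?sqr_ge0// => H; apply: (le_trans _ H).
by rewrite /sqdf -(real_normK (num_real (df _))) lerXn2r ?nnegrE// ?dphi_le// mulr_ge0 ?sqrtr_ge0// ltW// phi_gt0.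
Qed.

Let P_cvg : P n @[n --> \oo] --> p / 2 * (lam * mass p lam - action p lam).
Proof.
have -> : p / 2 * (lam * mass p lam - action p lam) = \sum_e (if e == e1 then \int[leb]_x powf x else 0).
  by rewrite sum_e1 RintegralT_phip.
apply: cvg_sumr => e; apply: cvg_offset => //.
have -> : powf = fun x => `|f x| `^ p by apply/funext => x; rewrite /powf ger0_norm// ltW// phi_gt0.
have -> : 0 = `|0 : R| `^ p by rewrite normr0 powR0// gt_eqF.
by apply: (@cvg_comp _ _ _ (fun n => f n%:R) (fun r => `|r| `^ p) _ _ _ f_cvg); exact: continuous_powR_norm.
Qed.

Lemma energy_upper eps : 0 < mass p lam -> 0 < eps ->
  exists2 u : edge G -> R -> R, H1_mass (mass p lam) u &
    energy p u <= action p lam - lam / 2 * mass p lam + eps.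
Proof.
move=> mu0 eps0; set mu := mass p lam in mu0 *.
(* This normalization gives mass [mu] and tends to 1, so the energies have the same limit as without
   it. *)
pose q n := mu / m n; pose c n := Num.sqrt (q n).
have q1 : q n @[n --> \oo] --> (1 : R).
  have mun0 : mu != 0 by rewrite gt_eqF.
  rewrite -(divff mun0); apply: cvgM; first exact: cvg_cst.
  by apply: cvgV; [rewrite gt_eqF|exact: m_cvg].
have c1 : c n @[n --> \oo] --> (1 : R).
  rewrite -[1]sqrtr1; apply: (@cvg_comp _ _ _ q Num.sqrt _ _ _ q1); exact: sqrt_continuous.
have cp1 : c n `^ p @[n --> \oo] --> (1 : R).
  have -> : (fun n => c n `^ p) = (fun n => `|c n| `^ p).
    by apply/funext => n; rewrite ger0_norm// sqrtr_ge0.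
  have -> : 1 = `|1 : R| `^ p by rewrite normr1 powR1.
  by apply: (@cvg_comp _ _ _ c (fun r => `|r| `^ p) _ _ _ c1); exact: continuous_powR_norm.
have Ecvg : 2^-1 * (c n ^+ 2 * D n) - p^-1 * (c n `^ p * P n) @[n --> \oo] -->
    action p lam - lam / 2 * mu.
  have -> : action p lam - lam / 2 * mu = 2^-1 * (1 * 1 * action p lam) -
      p^-1 * (1 * (p / 2 * (lam * mass p lam - action p lam))).
    by rewrite /mu; field; rewrite gt_eqF.
  apply: cvgB; apply: cvgM; try exact: cvg_cst; apply: cvgM => //.
  by apply: cvgM.
have /cvgrPdist_le /(_ eps eps0) near1 := Ecvg.
(* The tolerance [mu] itself ensures that [m n] is positive. *)
have /cvgrPdist_lt /(_ mu mu0) near2 := m_cvg.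
have [N _ HN] := filterI near1 near2.
have [/= h1 h2] := HN N (leqnn N).
have mN : 0 < m N by move: h2; rewrite -/mu ltr_norml; lra.
exists (translate (c N) N).
  split; first exact: translate_H1.
  by rewrite translate_mass sqr_sqrtr ?divfK ?gt_eqF// divr_ge0// ltW.
rewrite translate_energy ?sqrtr_ge0//.
by move: h1; rewrite ler_norml => /andP[+ _]; rewrite -/mu; lra.
Qed.

End UpperBound.

Theorem theorem2p5 (R : realType) (mu p : R) (G : graph R)
  (mu_gt0 : 0 < mu) (p_gt2 : 2 < p) (p_lt6 : p < 6)
  (G_metric : metric_graph G)
  (H : forall (e : edge G) (v : vertex G),
     exists w : vertex G, at_infinity w /\ connect (joined (predC1 e)) v w) :
  [/\ ereal_inf [set (energy p u)%:E | u in [set u | @H1_mass R G mu u]]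
        = (energy_line p (soliton p mu))%:E,
      minimizer_line p mu (soliton p mu) &
      (exists u : edge G -> R -> R, H1_mass mu u /\
         (energy p u)%:E =
         ereal_inf [set (energy p w)%:E | w in [set w | @H1_mass R G mu w]]) ->
      [\/ isometric G (line_graph R),
          exists a1 : R, 0 < a1 /\ isometric G (folded_line 1 (fun=> a1)) |
          exists (n : nat) (a : nat -> R),
            [/\ (2 <= n)%N, 0 < a 1%N,
                forall j : nat, (1 <= j < n)%N -> a j < a j.+1 &
                isometric G (folded_line n a)]]].
Proof.
have [lam lam0 Hlam] := exists_mass p_gt2 p_lt6 mu_gt0.
have [Hmin Esol] := soliton_minimizer p_gt2 p_lt6 mu_gt0 lam0 Hlam.
have [[e] len_gt0 _ _] := G_metric.
(* The hypothesis on any one edge already provides a vertex at infinity, hence a half-line to send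
   solitons along. *)
have [e1 e1_inf] : exists e1 : edge G, len e1 = +oo%E.
  by have [w [/existsP[e1 /andP[/eqP ? _]] _]] := H e (src e); exists e1.
set E0 := ereal_inf _.
have EE : E0 = (energy_line p (soliton p mu))%:E.
  rewrite Esol; apply/eqP; rewrite eq_le; apply/andP; split; last first.
    apply: le_ereal_inf_tmp => _ /= [u Hu <-]; rewrite lee_fin.
    exact: (energy_ge mu_gt0 p_gt2 p_lt6 G_metric H Hu lam0 Hlam).
  apply/lee_addgt0Pr => eps eps0.
  have [u Hu Eu] := energy_upper p_gt2 lam0 len_gt0 e1_inf (ltac:(rewrite Hlam; exact: mu_gt0)) eps0.
  apply: (@le_trans _ _ (energy p u)%:E); last by rewrite -EFinD lee_fin -Hlam.
  by apply: ereal_inf_lbound; exists u; rewrite // -Hlam.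
split => // -[u [Hu Eu]].
have : energy p u = action p lam - lam / 2 * mu.
  by apply: EFin_inj; rewrite -Esol -EE.
move=> /(energy_eq mu_gt0 p_gt2 p_lt6 G_metric H Hu lam0 Hlam) [e0 [xi [e0x u_max _ slope_eq]]].
rewrite -Hlam in Hu.
have [al [sg F]] := rigidity p_gt2 lam0 G_metric H Hu e0x u_max slope_eq.
exact: (folding_classification len_gt0 F).
Qed.
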